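(* Let $d\ge 2$ and let $M^+,R^+,S^+,O^+$ be the classes of holomorphic functions on $\mathbb B^d$ defined in the context. Then $$M^+\subset R^+\subset S^+\subset O^+,$$ and each of these inclusions is proper.
   Context: $\mathbb B^d$ is the open unit ball of $\mathbb C^d$ and $\langle z,w\rangle=\sum_j z_j\overline{w_j}$. $O^+$ is the set of holomorphic functions $f$ on $\mathbb B^d$ with $\Re f\ge 0$. $S^+$ is the set of holomorphic $f$ on $\mathbb B^d$ for which the Hermitian kernel $\dfrac{f(z)+\overline{f(w)}}{1-\langle z,w\rangle}$ is positive semidefinite on $\mathbb B^d$. $H^2_d$ (Drury–Arveson space) is the reproducing kernel Hilbert space on $\mathbb B^d$ with kernel $1/(1-\langle z,w\rangle)$; $S_j$ is the (bounded) operator of multiplication by $z_j$ on $H^2_d$; $\mathcal T_d$ is the unital C*-algebra generated by $S_1,\dots,S_d$; and $H(z,S)=2\bigl(I-\sum_{j=1}^d z_jS_j\bigr)^{-1}-I$ for $z\in\mathbb B^d$. $R^+$ is the set of functions of the form $f(z)=\rho(H(z,S))+it$ with $\rho$ a positive linear functional on $\mathcal T_d$ and $t\in\mathbb R$. $M^+$ is the set of functions of the form $f(z)=\int_{\partial\mathbb B^d}\frac{1+\langle z,\zeta\rangle}{1-\langle z,\zeta\rangle}\,d\mu(\zeta)+it$ with $\mu$ a finite positive Borel measure on $\partial\mathbb B^d$ and $t\in\mathbb R$. *)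

(* Defs.v *)
From HB Require Import structures.
From mathcomp Require Import all_boot all_order all_algebra.
From mathcomp Require Import sesquilinear complex.
From mathcomp Require Import all_classical all_reals all_analysis.

Set Implicit Arguments.
Unset Strict Implicit.
Unset Printing Implicit Defensive.

Import Order.TTheory GRing.Theory Num.Theory numFieldNormedType.Exports.

Local Open Scope classical_set_scope.
Local Open Scope ring_scope.

(* MathComp-Analysis equips every abstract numFieldType with its norm topology,
   through R^o; these instances do the same for the concrete type R[i]. *)
#[non_forgetful_inheritance]
HB.instance Definition _ (R : realType) := GRing.ComAlgebra.copy R[i] R[i]^o.
#[non_forgetful_inheritance]
HB.instance Definition _ (R : realType) := Vector.copy R[i] R[i]^o.
#[non_forgetful_inheritance]
HB.instance Definition _ (R : realType) := NormedModule.copy R[i] R[i]^o.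
#[non_forgetful_inheritance]
HB.instance Definition _ (R : realType) := Num.ClosedField.on R[i].

Section Ball.
Context {R : realType} (d : nat).
Local Notation C := R[i].

Definition herm (z w : 'rV[C]_d) : C := \sum_j z 0 j * (w 0 j)^*.

Definition unit_ball : set 'rV[C]_d := [set z | herm z z < 1].

Definition unit_sphere : set 'rV[C]_d := [set z | herm z z = 1].

(* A function on the ball is represented by a total function on C^d whose
   values outside the ball are irrelevant; since the ball is open, complex
   differentiability at its points does not depend on these values. The sup
   norm carried by 'rV[C]_d is equivalent to the Euclidean one. *)
Definition holomorphic (f : 'rV[C]_d -> C) : Prop :=
  forall z, unit_ball z -> differentiable f z.

End Ball.

(* In R[i], [0 <= x] says that x is real and nonnegative, so that a positive
   semidefinite kernel is in particular Hermitian. *)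
Definition psd_kernel {R : realType} {X : Type} (K : X -> X -> R[i]) : Prop :=
  forall (n : nat) (x : 'I_n -> X) (a : 'I_n -> R[i]),
    0 <= \sum_i \sum_j a i * (a j)^* * K (x i) (x j).

(* The elements of the Hilbert space are identified with functions on X via
   the linear injection [rkhs_eval]; [rkhs_ker x] is the function k(., x). *)
Record rkhs (R : realType) (X : Type) (k : X -> X -> R[i]) := Rkhs {
  rkhs_space :> completeNormedModType R[i] ;
  rkhs_dot : {dot rkhs_space for Num.conj} ;
  rkhs_normE : forall f : rkhs_space, `|f| ^+ 2 = rkhs_dot f f ;
  rkhs_eval : rkhs_space -> X -> R[i] ;
  rkhs_eval_linear : forall (a : R[i]) (f g : rkhs_space) (x : X),
    rkhs_eval (a *: f + g) x = a * rkhs_eval f x + rkhs_eval g x ;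
  rkhs_eval_inj : injective rkhs_eval ;
  rkhs_ker : X -> rkhs_space ;
  rkhs_kerE : forall x y : X, rkhs_eval (rkhs_ker x) y = k y x ;
  rkhs_reproducing : forall (f : rkhs_space) (x : X),
    rkhs_eval f x = rkhs_dot f (rkhs_ker x) }.

Section Operators.
Context {R : realType} {H : completeNormedModType R[i]}.
Variable dot : {dot H for Num.conj}.

Definition bounded_op : set (H -> H) := [set T | linear T /\ continuous T].

Definition adjoint (T T' : H -> H) : Prop :=
  forall x y, dot (T x) y = dot x (T' y).

(* Norm-closed unital *-subalgebras of B(H); the approximation clause says
   that T is a limit of elements of A for the operator norm. *)
Definition unital_Cstar_subalgebra (A : set (H -> H)) : Prop :=
  [/\ A `<=` bounded_op,
      A id,
      (forall (a : R[i]) S T, A S -> A T -> A (fun x => a *: S x + T x)),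
      (forall S T, A S -> A T -> A (S \o T))
    & (forall S S', A S -> bounded_op S' -> adjoint S S' -> A S')] /\
  (forall T, bounded_op T ->
     (forall e : R, 0 < e ->
        exists2 S, A S & forall x, `|T x - S x| <= e%:C%C * `|x|) -> A T).

Definition generated_Cstar (G : set (H -> H)) : set (H -> H) :=
  smallest unital_Cstar_subalgebra G.

(* Only the values of rho on A matter. *)
Definition positive_functional (A : set (H -> H)) (rho : (H -> H) -> R[i]) :=
  (forall (a : R[i]) S T, A S -> A T ->
     rho (fun x => a *: S x + T x) = a * rho S + rho T) /\
  (forall S S', A S -> A S' -> adjoint S S' -> 0 <= rho (S' \o S)).

(* The inverse of T when T is bijective. *)
Definition op_inv (T : H -> H) : H -> H := fun y => xget 0 [set x | T x = y].

End Operators.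

Section DruryArveson.
Context {R : realType} (d : nat).
Local Notation C := R[i].
Local Notation B := (set_type (@unit_ball R d)).

Definition da_kernel (z w : B) : C := (1 - herm (val z) (val w))^-1.

Variable H : rkhs da_kernel.

(* The element of H whose underlying function is z |-> z_j f(z). *)
Definition shift (j : 'I_d) (f : H) : H :=
  xget 0 [set g : H | forall z : B, rkhs_eval g z = val z 0 j * rkhs_eval f z].

Definition toeplitz_algebra : set (H -> H) :=
  generated_Cstar (rkhs_dot H) [set T | exists j : 'I_d, T = shift j].

Definition herglotz_op (z : 'rV[C]_d) : H -> H := fun x =>
  2 *: op_inv (fun y => y - \sum_j z 0 j *: shift j y) x - x.

End DruryArveson.

Arguments toeplitz_algebra {R d} H.
Arguments herglotz_op {R d} H z.

Section Classes.
Context (R : realType) (d : nat).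
Local Notation C := R[i].
Local Notation B := (set_type (@unit_ball R d)).

Definition Oplus : set ('rV[C]_d -> C) :=
  [set f | holomorphic f /\ forall z, unit_ball z -> 0 <= complex.Re (f z)].

Definition Splus : set ('rV[C]_d -> C) :=
  [set f | holomorphic f /\
     psd_kernel (fun z w : B =>
       (f (val z) + (f (val w))^*) / (1 - herm (val z) (val w)))].

(* The space with kernel [da_kernel] is unique up to a unitary compatible with
   evaluation, so the class does not depend on the model H of it. *)
Definition Rplus : set ('rV[C]_d -> C) :=
  [set f | exists (H : rkhs (@da_kernel R d)) (rho : (H -> H) -> C) (t : R),
     positive_functional (rkhs_dot H) (toeplitz_algebra H) rho /\
     forall z, unit_ball z -> f z = rho (herglotz_op H z) + (0 +i* t)%C].

Definition borel_space := g_sigma_algebraType (@open 'rV[C]_d).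

Definition cintegral (mu : {finite_measure set borel_space -> \bar R})
    (D : set 'rV[C]_d) (g : 'rV[C]_d -> C) : C :=
  (Rintegral mu D (fun x => complex.Re (g x)) +i*
   Rintegral mu D (fun x => complex.Im (g x)))%C.

(* Finite Borel measures on the sphere are the restrictions to it of finite
   Borel measures on C^d, hence the integration over [unit_sphere]. *)
Definition Mplus : set ('rV[C]_d -> C) :=
  [set f | exists (mu : {finite_measure set borel_space -> \bar R}) (t : R),
     forall z, unit_ball z ->
       f z = cintegral mu (@unit_sphere R d)
               (fun zeta => (1 + herm z zeta) / (1 - herm z zeta))
             + (0 +i* t)%C].

End Classes.

Arguments Oplus : clear implicits.
Arguments Splus : clear implicits.
Arguments Rplus : clear implicits.
Arguments Mplus : clear implicits.

(* Main.v *)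
(* R+ in S+: for a positive functional [rho], positivity of the kernel of
   [f(z) = rho (H(z,S))] reduces to the positivity of an operator, which is tested on
   combinations of kernel functions. There it becomes the positivity of twice the Gram
   kernel of the vectors [\sum_(m, n) z^{(x) m} (x) (conj u)^{(x) n}] of the full Fock space.

   M+ in R+: the normalized kernel vectors at the points [r conj zeta] define states of
   [T_d]; averaging them against [mu] and letting [r] tend to 1 along an ultrafilter gives
   a positive functional whose value at [H(z,S)] is the Herglotz integral.

   Strictness: the Cayley transform [(1 + q) / (1 - q)] of [q = z_i^2 + z_j^2] lies in O+,
   but its kernel is not positive at five explicit points. For [q = a z_i^2 + b z_j^2] with
   [a^2 + b^2 = 1] it lies in S+, because [(1 - q(z) conj q(w)) / (1 - <z,w>)] is a positive
   kernel; a functional representing it satisfies [rho (S_i^2) = a] and [rho (S_j^2) = b],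
   so the row contraction inequality and Cauchy-Schwarz are saturated: [rho] vanishes on
   [S_i S_j (S_i S_j)^*] and on [(S_i^2 - a) (S_i^2 - a)^*], hence
   [a b = a rho (S_j^2) = rho (S_i^2 S_j^2) = 0]. Finally a vector state with
   [Re rho (1 - S_i^2 - S_j^2) < 0] gives a function of R+ outside M+, since this quantity
   depends only on the second-order Taylor coefficients of the function at 0 and is
   nonnegative when the function comes from a measure. *)

From HB Require Import structures.
Require Import Defs.
From mathcomp Require Import all_boot all_order all_algebra.
From mathcomp Require Import sesquilinear complex ring lra.
From mathcomp Require Import all_classical all_reals all_analysis measurable_realfun.

Set Implicit Arguments.
Unset Strict Implicit.
Unset Printing Implicit Defensive.

Import Order.TTheory GRing.Theory Num.Theory numFieldNormedType.Exports.

Local Open Scope classical_set_scope.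
Local Open Scope ring_scope.

(** * Real-valued norms over the complex numbers *)

Section Norms.
Context {R : realType}.
Local Notation C := R[i].

(** A functional is only assumed linear on the algebra and nonnegative on squares [S' \o S]; neither
    continuity nor monotonicity is given. The operators met below are positive as quadratic forms,
    so square roots inside the algebra are needed before [rho] can be applied to an inequality.
    Boundedness of [rho], and with it holomorphy of [rho (H(z,S))], then follows. The examples come
    from the Drury-Arveson norm: z_i^2 and z_j^2 are orthogonal unit vectors, so a z_i^2 + b z_j^2
    has norm 1 when a^2 + b^2 = 1, and is in fact a contractive multiplier, whereas z_i^2 + z_j^2 is
    bounded by 1 on the ball and has norm sqrt 2. This gap between the supremum norm and the
    multiplier norm is what breaks positivity at five points, and what yields a vector on which 1 -
    S_i^2 - S_j^2 has negative real part, although it has nonnegative real part at every kernel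
    vector. *)

Definition nrm {V : normedModType C} (x : V) : R := complex.Re `|x|.

Lemma nrmE {V : normedModType C} (x : V) : `|x| = (nrm x)%:C%C.
Proof. by rewrite /nrm RRe_real. Qed.

Section Normed.
Context {V : normedModType C}.
Implicit Types x y : V.

Lemma nrm_ge0 x : 0 <= nrm x.
Proof. by rewrite -ler0c -nrmE. Qed.

Lemma nrmD x y : nrm (x + y) <= nrm x + nrm y.
Proof. by rewrite -lecR rmorphD /= -!nrmE ler_normD. Qed.

Lemma nrmN x : nrm (- x) = nrm x.
Proof. by rewrite /nrm normrN. Qed.

Lemma nrmB x y : nrm (x - y) <= nrm x + nrm y.
Proof. by rewrite -(nrmN y) nrmD. Qed.

Lemma nrmC x y : nrm (x - y) = nrm (y - x).
Proof. by rewrite -nrmN opprB. Qed.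

Lemma nrm0 : nrm (0 : V) = 0.
Proof. by rewrite /nrm normr0. Qed.

Lemma nrm0_eq0 x : nrm x = 0 -> x = 0.
Proof. by move=> x0; apply/normr0_eq0; rewrite nrmE x0. Qed.

Lemma nrmZ (a : C) x : nrm (a *: x) = nrm (a : C) * nrm x.
Proof.
by apply: (@complexI R); rewrite rmorphM /= -!nrmE normrZ.
Qed.

Lemma nrm_sum (I : Type) (s : seq I) (P : pred I) (F : I -> V) :
  nrm (\sum_(i <- s | P i) F i) <= \sum_(i <- s | P i) nrm (F i).
Proof.
elim/big_ind2 : _ => [|x1 x2 y1 y2 h1 h2|//]; first by rewrite nrm0.
by rewrite (le_trans (nrmD _ _)) // lerD.
Qed.

End Normed.

Lemma nrmM (a b : C) : nrm (a * b) = nrm a * nrm b.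
Proof.
by apply: (@complexI R); rewrite rmorphM /= -!nrmE normrM.
Qed.

Lemma nrm1 : nrm (1 : C) = 1.
Proof. by rewrite /nrm normr1. Qed.

Lemma nrmX (a : C) n : nrm (a ^+ n) = nrm a ^+ n.
Proof. by elim: n => [|n ih]; rewrite ?nrm1 // !exprS nrmM ih. Qed.

Lemma nrmR (r : R) : nrm (r%:C%C : C) = `|r|.
Proof. by rewrite /nrm normc_def /= expr0n addr0 sqrtr_sqr. Qed.

Lemma nrm_nat n : nrm (n%:R : C) = n%:R.
Proof. by rewrite -(rmorph_nat (real_complex R)) nrmR ger0_norm. Qed.

Lemma nrm_conj (a : C) : nrm a^* = nrm a.
Proof. by rewrite /nrm normcJ. Qed.

Lemma nrm_i : nrm ('i%C : C) = 1.
Proof. by rewrite /nrm normc_def /= expr0n /= add0r expr1n sqrtr1. Qed.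

Lemma nrm_sqr (a : C) : nrm a ^+ 2 = complex.Re a ^+ 2 + complex.Im a ^+ 2.
Proof.
by apply: (@complexI R); rewrite add_Re2_Im2 nrmE rmorphXn.
Qed.

Lemma nrm_sqrC (a : C) : a * a^* = (nrm a ^+ 2)%:C%C.
Proof. by rewrite -sqr_normc nrmE rmorphXn. Qed.

Lemma Re_le_nrm (a : C) : complex.Re a <= nrm a.
Proof. by apply: le_trans (ler_norm _) _; rewrite -lecR -nrmE normc_ge_Re. Qed.

Lemma absRe_le_nrm (a : C) : `|complex.Re a| <= nrm a.
Proof. by rewrite -lecR -nrmE normc_ge_Re. Qed.

Lemma absIm_le_nrm (a : C) : `|complex.Im a| <= nrm a.
Proof.
rewrite -(@ler_pXn2r _ 2) ?nnegrE ?nrm_ge0 // nrm_sqr real_normK ?num_real //.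
by rewrite lerDr sqr_ge0.
Qed.

Lemma nrm_le_ReIm (a : C) : nrm a <= `|complex.Re a| + `|complex.Im a|.
Proof.
rewrite -(@ler_pXn2r _ 2) ?nnegrE ?nrm_ge0 ?addr_ge0 // nrm_sqr.
have := mulr_ge0 (normr_ge0 (complex.Re a)) (normr_ge0 (complex.Im a)).
rewrite sqrrD !real_normK ?num_real //; lra.
Qed.

Lemma ReD (a b : C) : complex.Re (a + b) = complex.Re a + complex.Re b.
Proof. by case: a b => ? ? []. Qed.
Lemma ImD (a b : C) : complex.Im (a + b) = complex.Im a + complex.Im b.
Proof. by case: a b => ? ? []. Qed.
Lemma ReN (a : C) : complex.Re (- a) = - complex.Re a.
Proof. by case: a. Qed.
Lemma ImN (a : C) : complex.Im (- a) = - complex.Im a.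
Proof. by case: a. Qed.
Lemma ReM (a b : C) : complex.Re (a * b) =
  complex.Re a * complex.Re b - complex.Im a * complex.Im b.
Proof. by case: a b => ? ? []. Qed.
Lemma ImM (a b : C) : complex.Im (a * b) =
  complex.Re a * complex.Im b + complex.Im a * complex.Re b.
Proof. by case: a b => ? ? [] *. Qed.
Lemma ReJ (a : C) : complex.Re a^* = complex.Re a.
Proof. by case: a. Qed.
Lemma ImJ (a : C) : complex.Im a^* = - complex.Im a.
Proof. by case: a. Qed.
Lemma ReRM (r : R) (a : C) : complex.Re (r%:C%C * a) = r * complex.Re a.
Proof. by rewrite ReM /= mul0r subr0. Qed.
Lemma ImRM (r : R) (a : C) : complex.Im (r%:C%C * a) = r * complex.Im a.
Proof. by rewrite ImM /= mul0r addr0. Qed.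

Lemma ge0cE (a : C) : (0 <= a) = (complex.Im a == 0) && (0 <= complex.Re a).
Proof. by rewrite lecE. Qed.

Lemma ge0c_Re (a : C) : 0 <= a -> a = (complex.Re a)%:C%C.
Proof. by move/ger0_Im; case: a => a b /= ->. Qed.

Lemma eq_ReIm (a b : C) :
  complex.Re a = complex.Re b -> complex.Im a = complex.Im b -> a = b.
Proof. by case: a b => ? ? [? ?] /= -> ->. Qed.

Lemma conjRC (r : R) : (r%:C%C : C)^* = r%:C%C.
Proof. exact: conjc_real. Qed.

End Norms.

(** The form in which approximations are closed: an estimate with error [c * e] for every [e], where
    [c] may vanish. The witness divides by [c + 1] for that reason. *)
Lemma le_eps {R : realType} (a b c : R) :
  0 <= c -> (forall e, 0 < e -> a <= b + c * e) -> a <= b.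
Proof.
move=> c0 h; rewrite leNgt; apply/negP => ab.
have d0 : 0 < (a - b) / (2 * (c + 1)).
  by apply: divr_gt0; [rewrite subr_gt0 | apply: mulr_gt0; lra].
have := h _ d0.
have -> : c * ((a - b) / (2 * (c + 1))) = (a - b) * (c / (2 * (c + 1))).
  by field; lra.
have : c / (2 * (c + 1)) <= 1 / 2.
  by rewrite ler_pdivrMr; [nra | lra].
move=> h1 h2; nra.
Qed.

Lemma inv_nat_lt {R : realType} (e : R) : 0 < e ->
  exists N : nat, forall k : nat, (N <= k)%N -> (k.+1%:R : R)^-1 < e.
Proof.
move=> e0; exists (Num.truncn e^-1).+1 => k Nk.
rewrite -[e]invrK ltf_pV2 ?posrE ?ltr0n ?invr_gt0 //.
by apply: lt_trans (truncnS_gt _) _; rewrite ltr_nat ltnS.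
Qed.

Lemma exp_lt_eps {R : realType} (q : R) (e : R) : 0 <= q < 1 -> 0 < e ->
  exists N : nat, forall k : nat, (N <= k)%N -> q ^+ k < e.
Proof.
move=> /andP[q0 q1] e0.
have /cvgrPdist_lt /(_ e e0) := @cvg_expr R q ltac:(rewrite ger0_norm //).
move=> [N _ hN]; exists N => k Nk.
by have := hN k Nk; rewrite sub0r normrN ger0_norm ?exprn_ge0.
Qed.

(** * Completeness and geometric convergence *)

Section Complete.
Context {R : realType} {H : completeNormedModType R[i]}.

Lemma nrm_complete (u : nat -> H) :
  (forall e : R, 0 < e -> exists N, forall m n, (N <= m)%N -> (N <= n)%N ->
     nrm (u m - u n) < e) ->
  exists l, forall e : R, 0 < e -> exists N, forall n, (N <= n)%N ->
    nrm (u n - l) < e.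
Proof.
move=> hu.
have : cauchy (u n @[n --> \oo]).
  apply/cauchy_ballP => e e0.
  have e0' : 0 < complex.Re e by move: e0; rewrite ltcE => /andP[].
  have [N hN] := hu _ e0'.
  exists ([set x | exists2 n, (N <= n)%N & x = u n], [set x | exists2 n, (N <= n)%N & x = u n]).
    by split; exists N => // n Nn; exists n.
  move=> [x y] [[m Nm ->] [n Nn ->]] /=.
  rewrite -ball_normE /ball_/=.
  rewrite nrmE ltcE /= hN // andbT.
  by move: e0; rewrite ltcE eq_sym => /andP[].
move=> /cauchy_cvg /cvg_ex[l]; move/cvgrPdist_lt => hl; exists l => e e0.
have := hl e%:C%C; rewrite ltcR => /(_ e0)[N _ hN].
by exists N => n Nn; rewrite nrmC -ltcR -nrmE; apply: hN.
Qed.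

Lemma geometric_cauchy (u : nat -> H) (c q : R) : 0 <= q < 1 ->
  (forall n, nrm (u n.+1 - u n) <= c * q ^+ n) ->
  exists l, forall n, nrm (u n - l) <= c / (1 - q) * q ^+ n.
Proof.
move=> /andP[q0 q1] hu.
have c0 : 0 <= c by have := hu 0; rewrite expr0 mulr1; apply: le_trans (nrm_ge0 _).
have c'0 : 0 <= c / (1 - q) by rewrite divr_ge0 // subr_ge0 ltW.
(* The exact remainder q^n - q^(n + k), and not just q^n, is what the induction on [k] preserves. *)
have tail n k : nrm (u (n + k)%N - u n) <= c / (1 - q) * (q ^+ n - q ^+ (n + k)).
  elim: k => [|k ih]; first by rewrite addn0 !subrr nrm0 mulr0.
  have -> : u (n + k.+1)%N - u n = (u (n + k).+1 - u (n + k)%N) + (u (n + k)%N - u n).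
    by rewrite addrA subrK addnS.
  apply: le_trans (nrmD _ _) _; apply: le_trans (lerD (hu _) ih) _.
  rewrite addnS exprS le_eqVlt; apply/orP; left; apply/eqP; field; lra.
have tail' n m : (n <= m)%N -> nrm (u m - u n) <= c / (1 - q) * q ^+ n.
  move=> nm; rewrite -(subnKC nm); apply: le_trans (tail _ _) _.
  by rewrite ler_wpM2l // lerBlDr lerDl exprn_ge0.
have [|l hl] := @nrm_complete u.
  move=> e e0.
  have : 0 < e / (2 * (c / (1 - q) + 1)) by apply: divr_gt0 => //; lra.
  move=> /(exp_lt_eps (introT andP (conj q0 q1)))[N hN]; exists N => m n Nm Nn.
  have h p : (N <= p)%N -> nrm (u p - u N) < e / 2.
    move=> Np; apply: le_lt_trans (tail' _ _ Np) _.
    have := hN N (leqnn _); rewrite ltr_pdivlMr; last lra.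
    have := exprn_ge0 N q0; set qN := q ^+ N; set d := c / _ in c'0 *; nra.
  rewrite -(subrK (u N) (u m)) -addrA (le_lt_trans (nrmD _ _)) //.
  rewrite (nrmC (u N)); have := h _ Nm; have := h _ Nn; lra.
exists l => n; apply: (@le_eps _ _ _ 1) => // e e0; rewrite mul1r.
have [N hN] := hl _ e0.
have := hN (maxn n N) (leq_maxr _ _).
have := tail' n (maxn n N) (leq_maxl _ _).
rewrite -{2}(subrK (u (maxn n N)) (u n)) -addrA => h1 h2.
apply: le_trans (nrmD _ _) _; rewrite (nrmC (u n)); lra.
Qed.

End Complete.

(** Common core of the Cauchy-Schwarz inequalities for vectors, finite sums, positive operators and
    functionals: the hypothesis is the expansion of a nonnegative form, evaluated at [a] = - t [u]^*
    with t real. *)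
Lemma hermitian_disc {R : realType} (p q : R) (u : R[i]) : 0 <= q ->
  (forall a : R[i], 0 <= p + 2 * complex.Re (a * u) + nrm a ^+ 2 * q) ->
  nrm u ^+ 2 <= p * q.
Proof.
move=> q0 h.
have h' (t : R) : 0 <= p - 2 * t * nrm u ^+ 2 + t ^+ 2 * nrm u ^+ 2 * q.
  have := h (- t%:C%C * u^*).
  have -> : - t%:C%C * u^* * u = - (t%:C%C * (u * u^*)) by ring.
  rewrite nrm_sqrC nrmM nrmN nrm_conj nrmR ReN ReRM exprMn real_normK ?num_real //=; lra.
move: h' => {h}; move: (nrm u ^+ 2) => n h.
(* If q = 0 the expression is affine in t, and t = (p + 1) / (2 n) gives it the value -1 unless n =
   0; otherwise t = 1 / q is the minimizer. *)
move: q0; rewrite le_eqVlt => /predU1P[q0|q0].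
  rewrite -q0 mulr0 leNgt; apply/negP => n0.
  have := h ((p + 1) / (2 * n)); rewrite -q0 mulr0 addr0.
  have -> : 2 * ((p + 1) / (2 * n)) * n = p + 1 by field; rewrite gt_eqF.
  by lra.
have := h q^-1.
have -> : p - 2 * q^-1 * n + q^-1 ^+ 2 * n * q = p - n / q by field; rewrite gt_eqF.
by rewrite subr_ge0 ler_pdivrMr.
Qed.

(** * Hilbert spaces and bounded operators *)

Section Hilbert.
Context {R : realType} {H : completeNormedModType R[i]}.
Variable dot : {dot H for Num.conj}.
Hypothesis normE : forall x : H, `|x| ^+ 2 = dot x x.
Local Notation C := R[i].
Implicit Types (x y z : H) (a b : C).

Lemma dotDl x y z : dot (x + y) z = dot x z + dot y z.
Proof. exact: linearDl. Qed.
Lemma dotDr x y z : dot x (y + z) = dot x y + dot x z.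
Proof. exact: linearDr. Qed.
Lemma dotNl x y : dot (- x) y = - dot x y.
Proof. exact: linearNl. Qed.
Lemma dotNr x y : dot x (- y) = - dot x y.
Proof. exact: linearNr. Qed.
Lemma dotBl x y z : dot (x - y) z = dot x z - dot y z.
Proof. by rewrite dotDl dotNl. Qed.
Lemma dotBr x y z : dot x (y - z) = dot x y - dot x z.
Proof. by rewrite dotDr dotNr. Qed.
Lemma dotZl a x y : dot (a *: x) y = a * dot x y.
Proof. exact: linearZl_LR. Qed.
Lemma dotZr a x y : dot x (a *: y) = a^* * dot x y.
Proof. exact: linearZr_LR. Qed.
Lemma dot0l x : dot 0 x = 0.
Proof. exact: linear0l. Qed.
Lemma dot0r x : dot x 0 = 0.
Proof. exact: linear0r. Qed.
Lemma dotC x y : dot x y = (dot y x)^*.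
Proof. by rewrite (@hermC _ _ _ _ dot) expr0 mul1r. Qed.
Lemma dot_suml (I : Type) (s : seq I) (P : pred I) (F : I -> H) y :
  dot (\sum_(i <- s | P i) F i) y = \sum_(i <- s | P i) dot (F i) y.
Proof.
by elim/big_rec2 : _ => [|i u v _ <-]; rewrite ?dot0l // dotDl.
Qed.
Lemma dot_sumr (I : Type) (s : seq I) (P : pred I) (F : I -> H) y :
  dot y (\sum_(i <- s | P i) F i) = \sum_(i <- s | P i) dot y (F i).
Proof.
by elim/big_rec2 : _ => [|i u v _ <-]; rewrite ?dot0r // dotDr.
Qed.

Lemma dotxx x : dot x x = (nrm x ^+ 2)%:C%C.
Proof. by rewrite -normE nrmE rmorphXn. Qed.

Lemma nrm2D x y :
  nrm (x + y) ^+ 2 = nrm x ^+ 2 + 2 * complex.Re (dot x y) + nrm y ^+ 2.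
Proof.
have -> : nrm (x + y) ^+ 2 = complex.Re (dot (x + y) (x + y)) by rewrite dotxx.
rewrite dotDl !dotDr !ReD !dotxx /= (dotC y x) ReJ; lra.
Qed.

Lemma nrm2B x y :
  nrm (x - y) ^+ 2 = nrm x ^+ 2 - 2 * complex.Re (dot x y) + nrm y ^+ 2.
Proof. by rewrite nrm2D nrmN dotNr ReN mulrN. Qed.

Lemma dot_CS x y : nrm (dot x y) <= nrm x * nrm y.
Proof.
rewrite -(@ler_pXn2r _ 2) ?nnegrE ?mulr_ge0 ?nrm_ge0 // exprMn.
apply: hermitian_disc => [|a]; first by rewrite exprn_ge0 ?nrm_ge0.
have := exprn_ge0 2 (nrm_ge0 (x + a^* *: y)).
by rewrite nrm2D dotZr conjCK nrmZ nrm_conj exprMn.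
Qed.

Lemma dot_eq0 x : (forall y, dot y x = 0) -> x = 0.
Proof.
move=> h; have := h x; rewrite dotxx => /complexI /eqP.
by rewrite sqrf_eq0 => /eqP/nrm0_eq0.
Qed.

Lemma dot_inj x y : (forall z, dot z x = dot z y) -> x = y.
Proof.
move=> h; apply/eqP; rewrite -subr_eq0; apply/eqP/dot_eq0 => z.
by rewrite dotBr h subrr.
Qed.

Lemma dot_injl x y : (forall z, dot x z = dot y z) -> x = y.
Proof. by move=> h; apply: dot_inj => z; rewrite dotC h -dotC. Qed.

(* Riesz representation for a bounded linear functional defined on a subspace
   that need not be closed; the functional is given by its graph, so that
   well-definedness is a consequence of the bound. *)
Lemma riesz_graph (G : H -> C -> Prop) (c : R) : 0 <= c ->
  G 0 0 ->
  (forall a x y l m, G x l -> G y m -> G (a *: x + y) (a * l + m)) ->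
  (forall x l, G x l -> nrm l <= c * nrm x) ->
  exists g, [/\ forall x l, G x l -> l = dot x g,
    forall e : R, 0 < e -> exists2 x, (exists l, G x l) & nrm (x - g) < e
    & nrm g <= c].
Proof.
move=> c0 G0 GD Gc.
(* At a pair (x, <x,g>) this is |x - g|^2 - |g|^2, so the representing vector is the limit of a
   minimizing sequence in the graph. *)
pose J (p : H * C) : R := nrm p.1 ^+ 2 - 2 * complex.Re p.2.
pose S := [set J p | p in [set p : H * C | G p.1 p.2]].
have lb : lbound S (- c ^+ 2).
  move=> _ [[x l] /= Gxl <-]; rewrite /J /=.
  have := Gc _ _ Gxl; have := Re_le_nrm l; have := sqr_ge0 (nrm x - c).
  rewrite sqrrB; lra.
have S0 : S !=set0 by exists (J (0, 0)), (0, 0).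
have hS : has_inf S by split => //; exists (- c ^+ 2).
have near_inf (n : nat) : exists p : H * C, G p.1 p.2 /\ J p < inf S + n.+1%:R^-1.
  have [||r [p Gp <-] hr] := @inf_adherent _ S (n.+1%:R^-1); first by rewrite invr_gt0.
    by [].
  by exists p.
have [p hp] := choice near_inf.
have Jinf q : G q.1 q.2 -> inf S <= J q.
  by move=> Gq; apply: ge_inf; [exists (- c ^+ 2) | exists q].
(* Parallelogram identity: the midpoint of two near minimizers is in the graph and cannot go below
   the infimum. *)
have close m n : nrm ((p m).1 - (p n).1) ^+ 2 <= 2 * (m.+1%:R^-1 + n.+1%:R^-1).
  have [Gm Jm] := hp m; have [Gn Jn] := hp n.
  have Gmn : G (2^-1 *: ((p m).1 + (p n).1)) (2^-1 * ((p m).2 + (p n).2)).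
    have := GD 1 _ _ _ _ Gm Gn; rewrite scale1r mul1r => Gmn.
    by have := GD 2^-1 _ _ _ _ Gmn G0; rewrite !addr0.
  have := Jinf (_, _) Gmn; move: Jm Jn; rewrite /J /=.
  have -> : (2^-1 : C) = (2^-1 : R)%:C%C by rewrite fmorphV rmorph_nat.
  rewrite nrmZ nrmR ger0_norm ?invr_ge0 // exprMn nrm2B nrm2D ReRM ReD.
  have -> : (2^-1 : R) ^+ 2 = 4^-1 by rewrite exprVn -natrX.
  move: (m.+1%:R^-1) (n.+1%:R^-1) => rm rn; lra.
have [g hg] : exists l, forall e : R, 0 < e -> exists N, forall n, (N <= n)%N ->
    nrm ((p n).1 - l) < e.
  apply: nrm_complete => e e0.
  have [N hN] := @inv_nat_lt R (e ^+ 2 / 4) ltac:(by rewrite divr_gt0 // exprn_gt0).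
  exists N => m n Nm Nn.
  rewrite -(@ltr_pXn2r _ 2) ?nnegrE ?nrm_ge0 ?(ltW e0) //.
  apply: le_lt_trans (close _ _) _.
  have := hN _ Nm; have := hN _ Nn.
  move: (m.+1%:R^-1) (n.+1%:R^-1) => rm rn; lra.
(* First-order optimality in the direction [y]. Applied to - y it gives equality of real parts, and
   to - i y equality of imaginary parts. *)
have main y m : G y m -> complex.Re m <= complex.Re (dot y g).
  move=> Gym.
  have step (t : R) : 0 < t -> 0 <= 2 * (complex.Re (dot y g) - complex.Re m)
       + t * nrm y ^+ 2.
    move=> t0; apply: (@le_eps _ _ _ (2 * nrm y + t^-1)).
      by rewrite addr_ge0 ?mulr_ge0 ?nrm_ge0 // invr_ge0 ltW.
    move=> e e0; have [N1 hN1] := hg _ e0; have [N2 hN2] := inv_nat_lt e0.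
    pose n := maxn N1 N2; have [Gn Jn] := hp n.
    have Gt := GD t%:C%C _ _ _ _ Gym Gn.
    have := Jinf (_, _) Gt; move: Jn; rewrite /J /= (addrC (_ *: y)) nrm2D dotZr conjRC.
    rewrite !ReRM ReD !ReRM nrmZ nrmR exprMn real_normK ?num_real //.
    have h1 : complex.Re (dot (p n).1 y) <= complex.Re (dot y g) + nrm y * e.
      rewrite (dotC y) ReJ -lerBlDl -ReN -ReD -dotBl (le_trans (Re_le_nrm _)) //.
      rewrite (le_trans (dot_CS _ _)) // mulrC ler_wpM2l ?nrm_ge0 //.
      by rewrite ltW // hN1 // leq_maxl.
    have h2 : n.+1%:R^-1 < e by apply: hN2; rewrite leq_maxr.
    move: (n.+1%:R^-1) h2 => rn h2 h3 h4.
    rewrite -(@ler_pM2l _ t) // mulr0.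
    have -> : t * (2 * (complex.Re (dot y g) - complex.Re m) + t * nrm y ^+ 2 +
      (2 * nrm y + t^-1) * e) = t * 2 * (complex.Re (dot y g) + nrm y * e)
      - t * 2 * complex.Re m + t ^+ 2 * nrm y ^+ 2 + e by field; rewrite gt_eqF.
    have := ler_wpM2l (ltW (mulr_gt0 t0 (@ltr0Sn R 1))) h1; lra.
  rewrite -subr_ge0 -(@pmulr_rge0 _ 2) //.
  apply: (@le_eps _ _ _ (nrm y ^+ 2)); first by rewrite exprn_ge0 ?nrm_ge0.
  by move=> e /step; rewrite [e * _]mulrC.
have mainN y m : G y m -> complex.Re m = complex.Re (dot y g).
  move=> Gym; apply/eqP; rewrite eq_le main //=.
  have := GD (-1) _ _ _ _ Gym G0; rewrite scaleN1r mulN1r !addr0 => /main.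
  by rewrite dotNl !ReN lerN2.
have rep y m : G y m -> m = dot y g.
  move=> Gym; apply: eq_ReIm; first exact: mainN.
  have := GD (- 'i%C) _ _ _ _ Gym G0; rewrite !addr0 => /mainN.
  by rewrite dotZl !ReM !ReN !ImN /= oppr0 !mul0r !sub0r !mulN1r !opprK.
have dens e : 0 < e -> exists2 x, (exists l, G x l) & nrm (x - g) < e.
  move=> e0; have [N hN] := hg _ e0; exists (p N).1; last exact: hN.
  by exists (p N).2; case: (hp N).
exists g; split => //.
(* Testing the representation on elements of the graph close to [g] gives |g|^2 <= c |g|. *)
rewrite leNgt; apply/negP => cg.
have g0 : 0 < nrm g by apply: le_lt_trans cg.
have : nrm g ^+ 2 <= c * nrm g.
  apply: (@le_eps _ _ _ (nrm g + c)); first by rewrite addr_ge0 ?nrm_ge0.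
  move=> e e0; have [x [l Gxl] hx] := dens _ e0.
  have h1 : nrm g ^+ 2 = complex.Re (dot g g) by rewrite dotxx.
  have h2 := rep _ _ Gxl; have h3 := Gc _ _ Gxl.
  have : nrm g ^+ 2 <= nrm l + nrm g * e.
    rewrite h1 h2 -{1}(subrK x g) dotDl ReD addrC lerD ?Re_le_nrm //.
    rewrite (le_trans (Re_le_nrm _)) // (le_trans (dot_CS _ _)) // mulrC.
    by rewrite ler_wpM2l ?nrm_ge0 // nrmC ltW.
  have h4 : nrm x <= nrm g + e.
    by rewrite -(subrK g x) addrC (le_trans (nrmD _ _)) // lerD2l ltW.
  have := ler_wpM2l c0 h4; lra.
by rewrite expr2 ler_pM2r // leNgt cg.
Qed.

End Hilbert.

(* Linear identities between vectors are ring identities between the scalars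
   obtained by pairing them with an arbitrary vector. *)
Ltac vector_ring normE :=
  apply: (dot_injl normE) => ?;
  rewrite ?(dotBl, dotDl, dotNl, dotZl, dot0l); ring.

(** * Bounded operators and their adjoints *)

Section Operators.
Context {R : realType} {H : completeNormedModType R[i]}.
Variable dot : {dot H for Num.conj}.
Hypothesis normE : forall x : H, `|x| ^+ 2 = dot x x.
Local Notation C := R[i].
Implicit Types (x y z : H) (a b : C) (S T : H -> H).

Lemma bounded_opP T : bounded_op T <->
  linear T /\ exists2 M : R, 0 <= M & forall x, nrm (T x) <= M * nrm x.
Proof.
split=> [[linT contT]|[linT [M M0 hM]]]; split => //.
  have T0 : T 0 = 0 by have := linT (-1) 0 0; rewrite scaler0 addr0 scaleN1r addNr.
  have TZ a x : T (a *: x) = a *: T x by have := linT a x 0; rewrite T0 !addr0.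
  have := contT 0; rewrite /continuous_at T0 => /cvgrPdist_lt /(_ 1 ltr01).
  move=> /nbhs_ballP[e /= e0]; rewrite -ball_normE => he.
  have er : e = (complex.Re e)%:C%C by apply: ge0c_Re; exact: ltW.
  move: (complex.Re e) er => r er; subst e.
  rewrite ltcR in e0.
  exists (2 / r) => [|x]; first by rewrite divr_ge0 // ltW.
  have [x0|x0] := eqVneq (nrm x) 0.
    by rewrite (nrm0_eq0 x0) T0 !nrm0 mulr0.
  have nx : 0 < nrm x by rewrite lt_neqAle eq_sym x0 nrm_ge0.
  (* The rescaled vector has norm r / 2, inside the ball that [T] sends into the unit ball. *)
  have := he ((r / (2 * nrm x))%:C%C *: x).
  rewrite /ball_/= !sub0r !normrN TZ !nrmE !nrmZ nrmR !ltcR.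
  have r2 : 0 < r / (2 * nrm x) by rewrite divr_gt0 // mulr_gt0.
  rewrite gtr0_norm //.
  have -> : r / (2 * nrm x) * nrm x = r / 2 by field; rewrite gt_eqF.
  have -> : r / (2 * nrm x) * nrm (T x) = nrm (T x) / (2 / r * nrm x).
    by field; rewrite !gt_eqF.
  move=> h; have := h ltac:(lra); rewrite ltr_pdivrMr ?mulr_gt0 ?invr_gt0 //.
  by rewrite mul1r => /ltW.
move=> x; apply/cvgrPdist_lt => e e0.
have er : e = (complex.Re e)%:C%C by apply: ge0c_Re; exact: ltW.
move: (complex.Re e) er => r er; subst e; rewrite ltcR in e0.
apply/nbhs_ballP; exists (r / (M + 1))%:C%C => /=.
  by rewrite ltcR divr_gt0 // ltr_wpDl.
move=> y; rewrite -ball_normE /ball_/= !nrmE !ltcR => xy.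
have TB : T x - T y = T (x - y).
  by have := linT (-1) y x; rewrite !scaleN1r [- y + _]addrC [- T y + _]addrC.
rewrite TB (le_lt_trans (hM _)) //.
move: xy; rewrite ltr_pdivlMr ?ltr_wpDl //.
have := nrm_ge0 (x - y); lra.
Qed.

Lemma bop_linear T : bounded_op T -> linear T. Proof. by case. Qed.

Lemma bop0 T : bounded_op T -> T 0 = 0.
Proof.
by case=> linT _; have := linT (-1) 0 0; rewrite scaler0 addr0 scaleN1r addNr.
Qed.
Lemma bopZ T a x : bounded_op T -> T (a *: x) = a *: T x.
Proof. by move=> hT; have := (bop_linear hT) a x 0; rewrite (bop0 hT) !addr0. Qed.
Lemma bopD T x y : bounded_op T -> T (x + y) = T x + T y.
Proof. by case=> linT _; have := linT 1 x y; rewrite !scale1r. Qed.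
Lemma bopN T x : bounded_op T -> T (- x) = - T x.
Proof. by move=> hT; rewrite -scaleN1r (bopZ _ _ hT) scaleN1r. Qed.
Lemma bopB T x y : bounded_op T -> T (x - y) = T x - T y.
Proof. by move=> hT; rewrite (bopD _ _ hT) (bopN _ hT). Qed.
Lemma bop_sum T (I : Type) (s : seq I) (P : pred I) (F : I -> H) : bounded_op T ->
  T (\sum_(i <- s | P i) F i) = \sum_(i <- s | P i) T (F i).
Proof.
by move=> hT; elim/big_rec2 : _ => [|i u v _ <-]; rewrite ?(bop0 hT) ?(bopD _ _ hT).
Qed.

Lemma bounded_op_id : bounded_op (@id H).
Proof. by split => //; move=> x; exact: cvg_id. Qed.

Lemma bounded_op_lin a S T : bounded_op S -> bounded_op T ->
  bounded_op (fun x => a *: S x + T x).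
Proof.
move=> /bounded_opP[lS [M M0 hM]] /bounded_opP[lT [N N0 hN]].
apply/bounded_opP; split.
  move=> c x y; rewrite lS lT !scalerDr !scalerA (mulrC c) !addrA; congr (_ + _).
  by rewrite -!addrA; congr (_ + _); rewrite addrC.
exists (nrm a * M + N); first by rewrite addr_ge0 // mulr_ge0 // nrm_ge0.
move=> x; rewrite (le_trans (nrmD _ _)) // nrmZ mulrDl lerD // -mulrA.
by rewrite ler_wpM2l // nrm_ge0.
Qed.

Lemma bounded_op_comp S T : bounded_op S -> bounded_op T -> bounded_op (S \o T).
Proof.
move=> /bounded_opP[lS [M M0 hM]] /bounded_opP[lT [N N0 hN]].
apply/bounded_opP; split; first by move=> c x y /=; rewrite lT lS.
exists (M * N); first exact: mulr_ge0.
by move=> x /=; rewrite (le_trans (hM _)) // -mulrA ler_wpM2l.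
Qed.

Lemma adjoint_sym S T : adjoint dot S T -> adjoint dot T S.
Proof. by move=> h x y; rewrite (dotC dot) -h (dotC dot) conjCK. Qed.

Lemma adjoint_id : adjoint dot id id. Proof. by []. Qed.

Lemma adjoint_lin a S S' T T' : adjoint dot S S' -> adjoint dot T T' ->
  adjoint dot (fun x => a *: S x + T x) (fun x => a^* *: S' x + T' x).
Proof. by move=> hS hT x y; rewrite dotDl dotDr dotZl dotZr conjCK hS hT. Qed.

Lemma adjoint_comp S S' T T' : adjoint dot S S' -> adjoint dot T T' ->
  adjoint dot (S \o T) (T' \o S').
Proof. by move=> hS hT x y /=; rewrite hS hT. Qed.

Lemma adjoint_uniq S T T' : adjoint dot S T -> adjoint dot S T' -> T = T'.
Proof.
by move=> h h'; apply/funext => x; apply: (dot_inj normE) => z; rewrite -h h'.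
Qed.

Lemma adjoint_bound S T (M : R) : 0 <= M -> (forall x, nrm (S x) <= M * nrm x) ->
  adjoint dot S T -> forall x, nrm (T x) <= M * nrm x.
Proof.
move=> M0 hM hT x; have [->|x0] := eqVneq (T x) 0.
  by rewrite nrm0 mulr_ge0 // nrm_ge0.
have n0 : 0 < nrm (T x).
  by rewrite lt_neqAle nrm_ge0 andbT eq_sym; apply: contra_neq x0 => /nrm0_eq0.
rewrite -(ler_pM2l n0) -expr2.
have -> : nrm (T x) ^+ 2 = complex.Re (dot (T x) (T x)) by rewrite (dotxx normE).
rewrite -hT (le_trans (Re_le_nrm _)) // (le_trans (dot_CS normE _ _)) //.
by rewrite mulrCA mulrA ler_wpM2r ?nrm_ge0.
Qed.

Lemma adjoint_linear S T : adjoint dot S T -> linear T.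
Proof.
move=> hT a x y; apply: (dot_inj normE) => z.
by rewrite -hT !dotDr !dotZr !hT.
Qed.

Lemma riesz (f : H -> C) (c : R) : 0 <= c ->
  (forall a x y, f (a *: x + y) = a * f x + f y) ->
  (forall x, nrm (f x) <= c * nrm x) -> exists g, forall x, f x = dot x g.
Proof.
move=> c0 lf hf.
have f0 : f 0 = 0.
  by have := lf (-1) 0 0; rewrite scaler0 addr0 mulN1r addNr.
have [||||g [hg _ _]] := @riesz_graph _ _ dot normE (fun x l => l = f x) c => //.
  by move=> a x y l m -> ->.
  by move=> x l ->.
by exists g => x; apply: hg.
Qed.

Lemma adjoint_exists T : bounded_op T ->
  exists2 T', bounded_op T' & adjoint dot T T'.
Proof.
move=> /bounded_opP[lT [M M0 hM]].
have /choice[T' hT'] : forall y, exists g, forall x, dot (T x) y = dot x g.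
  move=> y.
  apply: (@riesz _ (M * nrm y)); first by rewrite mulr_ge0 ?nrm_ge0.
    by move=> a u v; rewrite lT dotDl dotZl.
  move=> x; rewrite (le_trans (dot_CS normE _ _)) // mulrAC ler_wpM2r ?nrm_ge0 //.
have adj : adjoint dot T T' by move=> x y; exact: hT'.
exists T' => //; apply/bounded_opP; split; first exact: adjoint_linear adj.
by exists M => //; exact: adjoint_bound adj.
Qed.

(** Riesz applied to the restriction of <., x> to [G] yields a limit [g] of elements of [G] with x -
    g orthogonal to [G], hence x = g. *)
Lemma orth_dense (G : set H) :
  G 0 -> (forall a x y, G x -> G y -> G (a *: x + y)) ->
  (forall x, (forall y, G y -> dot y x = 0) -> x = 0) ->
  forall x (e : R), 0 < e -> exists2 y, G y & nrm (y - x) < e.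
Proof.
move=> G0 GD G1 x e e0.
have [|||y l [_ ->]|g [hg dg _]] :=
    @riesz_graph _ _ dot normE (fun y l => G y /\ l = dot y x) (nrm x).
- exact: nrm_ge0.
- by rewrite dot0l.
- by move=> a u v l m [Gu ->] [Gv ->]; split; [exact: GD | rewrite dotDl dotZl].
- by rewrite mulrC; exact: dot_CS.
have -> : x = g.
  apply/eqP; rewrite -subr_eq0; apply/eqP/G1 => y Gy.
  by rewrite dotBr -(hg y (dot y x)) // subrr.
by have [y [l [Gy _]] hy] := dg _ e0; exists y.
Qed.

Lemma bounded_op_Cstar : unital_Cstar_subalgebra dot (@bounded_op R H).
Proof.
split=> [|T hT _ //]; split => //; first exact: bounded_op_id.
- by move=> a S T; exact: bounded_op_lin.
- by move=> S T; exact: bounded_op_comp.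
Qed.

End Operators.

(** * C*-algebras of operators and positive functionals *)

Section CstarAlgebra.
Context {R : realType} {H : completeNormedModType R[i]}.
Variable dot : {dot H for Num.conj}.
Hypothesis normE : forall x : H, `|x| ^+ 2 = dot x x.
Local Notation C := R[i].
Variable A : set (H -> H).
Hypothesis AC : unital_Cstar_subalgebra dot A.
Implicit Types (x y z : H) (a b : C) (S T : H -> H).

Lemma alg_bounded T : A T -> bounded_op T.
Proof. by case: AC => [[h _ _ _ _] _]; apply: h. Qed.
Lemma alg_id : A id.
Proof. by case: AC => [[]]. Qed.
Lemma alg_lin a S T : A S -> A T -> A (fun x => a *: S x + T x).
Proof. by case: AC => [[_ _ h _ _] _]; apply: h. Qed.
Lemma alg_comp S T : A S -> A T -> A (S \o T).
Proof. by case: AC => [[_ _ _ h _] _]; apply: h. Qed.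
(** The closure clause speaks of bounded adjoints; any adjoint is bounded, since it coincides with
    the one obtained from Riesz. *)
Lemma alg_adjoint S S' : A S -> adjoint dot S S' -> A S'.
Proof.
move=> AS hS; have [S2 bS2 hS2] := adjoint_exists normE (alg_bounded AS).
rewrite (adjoint_uniq normE hS hS2).
by case: AC => [[_ _ _ _ h] _]; apply: (h S).
Qed.
Lemma alg_adjointP S : A S -> exists2 S', A S' & adjoint dot S S'.
Proof.
move=> AS; have [S' _ hS] := adjoint_exists normE (alg_bounded AS).
by exists S' => //; exact: alg_adjoint hS.
Qed.
Lemma alg_closed T : bounded_op T ->
  (forall e : R, 0 < e -> exists2 S, A S & forall x, nrm (T x - S x) <= e * nrm x) ->
  A T.
Proof.
case: AC => _ h bT hT; apply: h => // e /hT[S AS hS]; exists S => // x.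
by rewrite !nrmE -rmorphM lecR.
Qed.
Lemma alg_zero : A (fun=> 0).
Proof.
have := alg_lin (-1) alg_id alg_id.
by congr A; apply/funext => x; rewrite scaleN1r addNr.
Qed.
Lemma alg_scale a T : A T -> A (fun x => a *: T x).
Proof.
move=> AT; have := alg_lin a AT alg_zero.
by congr A; apply/funext => x; rewrite addr0.
Qed.
Lemma alg_add S T : A S -> A T -> A (fun x => S x + T x).
Proof.
move=> AS AT; have := alg_lin 1 AS AT.
by congr A; apply/funext => x; rewrite scale1r.
Qed.
Lemma alg_sub S T : A S -> A T -> A (fun x => S x - T x).
Proof.
move=> AS AT; have := alg_lin (-1) AT AS.
by congr A; apply/funext => x; rewrite scaleN1r addrC.
Qed.
Lemma alg_sum (I : Type) (s : seq I) (T : I -> H -> H) :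
  (forall i, A (T i)) -> A (fun x => \sum_(i <- s) T i x).
Proof.
move=> hT; elim: s => [|i s ih].
  by have := alg_zero; congr A; apply/funext => x; rewrite big_nil.
by have := alg_add (hT i) ih; congr A; apply/funext => x; rewrite big_cons.
Qed.

(** The rate is proportional to |x|, so the pointwise limit is a limit in operator norm and stays in
    the closed algebra. *)
Lemma alg_geometric (T : nat -> H -> H) (c q : R) : 0 <= q < 1 ->
  (forall n, A (T n)) ->
  (forall n x, nrm (T n.+1 x - T n x) <= c * nrm x * q ^+ n) ->
  exists2 L, A L & forall n x, nrm (T n x - L x) <= c * nrm x / (1 - q) * q ^+ n.
Proof.
move=> q01 AT hT.
have /choice[L hL] : forall x, exists l, forall n,
    nrm (T n x - l) <= c * nrm x / (1 - q) * q ^+ n.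
  by move=> x; exact: geometric_cauchy (hT ^~ x).
exists L => //.
have /andP[q0 q1] := q01.
have lim0 (y : H) (k : R) : (forall n, nrm y <= k * q ^+ n) -> y = 0.
  move=> hy; apply: nrm0_eq0; apply/eqP; rewrite eq_le nrm_ge0 andbT.
  have k0 : 0 <= k by have := hy 0; rewrite expr0 mulr1; apply: le_trans (nrm_ge0 _).
  apply: (@le_eps _ _ _ k) => // e e0; rewrite add0r.
  have [N hN] := exp_lt_eps q01 e0.
  by rewrite (le_trans (hy N)) // ler_wpM2l // ltW // hN.
have bL : bounded_op L.
  apply/(bounded_opP); split.
    move=> a x y; apply/eqP; rewrite -subr_eq0; apply/eqP.
    apply: (@lim0 _ ((c * nrm (a *: x + y) + nrm a * (c * nrm x) + c * nrm y) / (1 - q))).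
    move=> n.
    have := alg_bounded (AT n) => bT.
    have -> : L (a *: x + y) - (a *: L x + L y) =
        - (T n (a *: x + y) - L (a *: x + y)) + (a *: (T n x - L x) + (T n y - L y)).
      by rewrite (bopD _ _ bT) (bopZ _ _ bT); vector_ring normE.
    apply: le_trans (nrmD _ _) _; rewrite nrmN.
    apply: le_trans (lerD (hL _ n) (nrmD _ _)) _; rewrite nrmZ.
    apply: le_trans (lerD (lexx _) (lerD (ler_wpM2l (nrm_ge0 _) (hL x n)) (hL y n))) _.
    by rewrite le_eqVlt; apply/orP; left; apply/eqP; ring.
  have [_ [M M0 hM]] := (bounded_opP _).1 (alg_bounded (AT 0)).
  exists (M + `|c / (1 - q)|); first by rewrite addr_ge0.
  move=> x; rewrite -(subKr (T 0 x) (L x)) (le_trans (nrmB _ _)) // mulrDl lerD //.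
  apply: le_trans (hL _ 0) _; rewrite expr0 mulr1 mulrAC.
  by rewrite ler_wpM2r ?nrm_ge0 // ler_norm.
apply: alg_closed => // e e0.
have : 0 < e / (`|c / (1 - q)| + 1) by rewrite divr_gt0 // ltr_wpDl.
move=> /(exp_lt_eps q01)[N hN]; exists (T N) => // x.
rewrite nrmC (le_trans (hL _ _)) //.
have -> : c * nrm x / (1 - q) * q ^+ N = c / (1 - q) * q ^+ N * nrm x by ring.
rewrite ler_wpM2r ?nrm_ge0 //.
have := hN N (leqnn _); rewrite ltr_pdivlMr ?ltr_wpDl // => h.
have qN0 := exprn_ge0 N q0.
rewrite (le_trans (ler_wpM2r qN0 (ler_norm _))) // mulrC ltW //.
by rewrite (le_lt_trans _ h) // mulrDr mulr1 lerDl.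
Qed.

Lemma neumann T (q : R) : A T -> 0 <= q < 1 -> (forall x, nrm (T x) <= q * nrm x) ->
  exists2 L, A L & (forall x, L x - T (L x) = x) /\ (forall x, L (x - T x) = x).
Proof.
move=> AT q01 hT.
have /andP[q0 q1] := q01.
have bT := alg_bounded AT.
pose S := fix S n := if n is m.+1 then fun x : H => x + T (S m x) else fun=> 0.
have AS n : A (S n).
  elim: n => [|n ih]; first exact: alg_zero.
  exact: (alg_add alg_id (alg_comp AT ih)).
have dS n x : nrm (S n.+1 x - S n x) <= 1 * nrm x * q ^+ n.
  elim: n => [|n ih] /=.
    by rewrite (bop0 bT) addr0 subr0 mul1r expr0 mulr1.
  rewrite opprD addrACA subrr add0r -(bopB _ _ bT) (le_trans (hT _)) // exprS.
  by rewrite mulrCA ler_wpM2l.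
have [L AL hL] := alg_geometric q01 AS dS.
have eqL x : L x - T (L x) = x.
  apply/eqP; rewrite -subr_eq0; apply/eqP/nrm0_eq0/eqP; rewrite eq_le nrm_ge0 andbT.
  apply: (@le_eps _ _ _ (2 * (nrm x / (1 - q)))).
    by rewrite mulr_ge0 // divr_ge0 ?nrm_ge0 // subr_ge0 ltW.
  move=> e e0; have [N hN] := exp_lt_eps q01 e0.
  have h1 := hL N x; have h2 := hL N.+1 x; have h3 := hN N (leqnn _).
  have -> : L x - T (L x) - x = T (S N x - L x) - (S N.+1 x - L x).
    by rewrite (bopB _ _ bT) /=; vector_ring normE.
  have h4 := hT (S N x - L x).
  apply: le_trans (nrmB _ _) _; rewrite add0r.
  have h5 : 0 <= nrm x / (1 - q) by rewrite divr_ge0 ?nrm_ge0 // subr_ge0 ltW.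
  move: h1 h2; rewrite !mul1r exprS => h1 h2.
  have h6 := exprn_ge0 N q0; have h7 := nrm_ge0 (S N x - L x).
  move: (nrm x / (1 - q)) (q ^+ N) h1 h2 h3 h5 h6 h7 h4 => k qN.
  move: (nrm (S N x - L x)) (nrm (S N.+1 x - L x)) (nrm (T (S N x - L x))) => u v w.
  move=> h1 h2 h3 h5 h6 h7 h4.
  have : v <= k * qN by apply: le_trans h2 _; rewrite ler_wpM2l // ler_piMl // ltW.
  have : w <= k * qN by apply: le_trans h4 (le_trans _ h1); rewrite ler_piMl // ltW.
  have : k * qN <= k * e by rewrite ler_wpM2l // ltW.
  lra.
exists L => //; split => // x.
(* The defect [d] of the left inverse satisfies d = T d, hence |d| <= q |d| and d = 0; commutation
   of [L] with [T] is not invoked. *)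
apply/eqP; rewrite -subr_eq0; apply/eqP; set d := _ - x.
have dT : d = T d.
  rewrite /d (bopB _ _ bT); have := eqL (x - T x).
  set w := L _ => hw; apply/eqP; rewrite -subr_eq0 -(subrr (x - T x)) -{1}hw.
  by apply/eqP; vector_ring normE.
apply/nrm0_eq0/eqP; rewrite eq_le nrm_ge0 andbT.
have := hT d; rewrite -dT; have := nrm_ge0 d; nra.
Qed.

End CstarAlgebra.

(** * Positive operators and positive functionals *)

Section PositiveFunctional.
Context {R : realType} {H : completeNormedModType R[i]}.
Variable dot : {dot H for Num.conj}.
Hypothesis normE : forall x : H, `|x| ^+ 2 = dot x x.
Local Notation C := R[i].
Variable A : set (H -> H).
Hypothesis AC : unital_Cstar_subalgebra dot A.
Implicit Types (x y z : H) (a b : C) (S T : H -> H).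

Let AB T : A T -> bounded_op T := @alg_bounded _ _ _ _ AC T.

Definition posop T := forall x, 0 <= dot (T x) x.

(** Polarization: the form at x + a y is real for a = 1 and for a = i. *)
Lemma posop_selfadj T : bounded_op T -> posop T -> adjoint dot T T.
Proof.
move=> bT pT x y.
have key a : complex.Im (a^* * dot (T x) y + a * dot (T y) x) = 0.
  have := pT (x + a *: y); rewrite (bopD _ _ bT) (bopZ _ _ bT).
  rewrite !dotDl !dotDr !dotZl !dotZr => /ger0_Im.
  have := ger0_Im (pT x); have := ger0_Im (pT y).
  have -> : a * (a^* * dot (T y) y) = (nrm a ^+ 2)%:C%C * dot (T y) y.
    by rewrite mulrA nrm_sqrC.
  rewrite !ImD ImRM => -> ->; lra.
have := key 1; have := key 'i%C; rewrite (dotC dot x).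
move: (dot _ _) (dot _ _) => u v; rewrite !ImD !ImM !ReJ !ImJ /= => h1 h2.
apply: eq_ReIm; rewrite ?ReJ ?ImJ; lra.
Qed.

Lemma selfadj_real T x : adjoint dot T T -> dot (T x) x = (complex.Re (dot (T x) x))%:C%C.
Proof.
move=> hT; apply: eq_ReIm => //=; have : dot (T x) x = (dot (T x) x)^*.
  by rewrite {1}hT -dotC.
by move/(congr1 (@complex.Im R)); rewrite ImJ; lra.
Qed.

Lemma posop_CS T x y : bounded_op T -> posop T ->
  nrm (dot (T x) y) ^+ 2 <= complex.Re (dot (T x) x) * complex.Re (dot (T y) y).
Proof.
move=> bT pT; have saT := posop_selfadj bT pT.
apply: hermitian_disc => [|a].
  by have := pT y; rewrite ge0cE => /andP[].
have := pT (x + a^* *: y); rewrite (bopD _ _ bT) (bopZ _ _ bT).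
rewrite !dotDl !dotDr !dotZl !dotZr conjCK ge0cE => /andP[_].
have -> : a^* * (a * dot (T y) y) = (nrm a ^+ 2)%:C%C * dot (T y) y.
  by rewrite mulrA [a^* * a]mulrC nrm_sqrC.
have -> : dot (T y) x = (dot (T x) y)^* by rewrite saT (dotC dot).
rewrite -rmorphM !ReD ReJ ReRM; lra.
Qed.

(** Cauchy-Schwarz for the form of [T], applied to x and T x, gives |T x|^4 <= (q |x|^2) (q |T
    x|^2). *)
Lemma posop_bound T (q : R) : bounded_op T -> posop T -> 0 <= q ->
  (forall x, complex.Re (dot (T x) x) <= q * nrm x ^+ 2) ->
  forall x, nrm (T x) <= q * nrm x.
Proof.
move=> bT pT q0 hq x.
have := posop_CS x (T x) bT pT; rewrite (dotxx normE) nrmR ger0_norm ?sqr_ge0 //.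
have [-> _|n0] := eqVneq (nrm (T x)) 0; first by rewrite mulr_ge0 // nrm_ge0.
have {}n0 : 0 < nrm (T x) by rewrite lt_neqAle eq_sym n0 nrm_ge0.
have h1 := hq x; have h2 := hq (T x).
have p1 : 0 <= complex.Re (dot (T x) x) by have := pT x; rewrite ge0cE => /andP[].
have p2 : 0 <= complex.Re (dot (T (T x)) (T x)).
  by have := pT (T x); rewrite ge0cE => /andP[].
move=> /le_trans /(_ (ler_pM p1 p2 h1 h2)).
have -> : q * nrm x ^+ 2 * (q * nrm (T x) ^+ 2) = (q * nrm x) ^+ 2 * nrm (T x) ^+ 2 by ring.
rewrite [X in X <= _]expr2 ler_pM2r ?exprn_gt0 // ler_pXn2r ?nnegrE ?nrm_ge0 //.
by rewrite mulr_ge0 // nrm_ge0.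
Qed.

(* [id - Y] is a square root of [id - X]; [Y] is the fixed point of Y = (X + Y^2) / 2. *)
Lemma sqrt_one_minus X (q : R) : A X -> adjoint dot X X -> 0 <= q < 1 ->
  (forall x, nrm (X x) <= q * nrm x) ->
  exists Y, [/\ A Y, adjoint dot Y Y & forall x, x - Y x - Y (x - Y x) = x - X x].
Proof.
move=> AX saX /andP[q0 q1] hX.
(* The smaller root of r^2 - 2 r + q = 0: from |X| <= q and |Y| <= r the iteration gives |(X + Y^2)
   / 2| <= (q + r^2) / 2 = r. *)
pose r := 1 - Num.sqrt (1 - q).
have s0 : 0 < Num.sqrt (1 - q) by rewrite sqrtr_gt0 subr_gt0.
have s2 : Num.sqrt (1 - q) ^+ 2 = 1 - q by rewrite sqr_sqrtr // subr_ge0 ltW.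
have s1 : Num.sqrt (1 - q) <= 1.
  by rewrite -(@ler_pXn2r _ 2) ?nnegrE ?(ltW s0) // s2 expr1n gerBl.
have r1 : r < 1 by rewrite /r; lra.
have r0 : 0 <= r by rewrite /r; lra.
have r2 : q + r ^+ 2 = 2 * r by rewrite /r; move: s2; nra.
pose Y := fix Y n := if n is m.+1 then fun x : H => (2^-1 : C) *: (X x + Y m (Y m x)) else fun=> 0.
have half : nrm (2^-1 : C) = 2^-1.
  have -> : (2^-1 : C) = (2^-1 : R)%:C%C by rewrite fmorphV rmorph_nat.
  by rewrite nrmR ger0_norm.
have AY n : A (Y n).
  elim: n => [|n ih]; first exact: (alg_zero AC).
  exact: (alg_scale AC _ (alg_add AC AX (alg_comp AC ih ih))).
have adjD S T : adjoint dot S S -> adjoint dot T T -> adjoint dot (fun x => S x + T x) (fun x => S x + T x).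
  by move=> hS hT x y; rewrite dotDl dotDr hS hT.
have saY n : adjoint dot (Y n) (Y n).
  elim: n => [|n ih] x y /=; first by rewrite dot0l dot0r.
  have h2 : (2^-1 : C)^* = 2^-1 by rewrite rmorphV /= ?unitfE ?pnatr_eq0 // rmorph_nat.
  by rewrite dotZl dotZr h2 dotDl dotDr saX ih ih.
have bY n x : nrm (Y n x) <= r * nrm x.
  elim: n x => [|n ih] x /=; first by rewrite nrm0 mulr_ge0 // nrm_ge0.
  rewrite nrmZ half.
  have h1 := nrmD (X x) (Y n (Y n x)); have h2 := hX x; have h3 := ih x.
  have h4 := ih (Y n x); have h5 := ler_wpM2l r0 h3.
  have h6 : (q + r ^+ 2) * nrm x = 2 * r * nrm x by rewrite r2.
  move: h6; rewrite mulrDl expr2; lra.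
have dY n x : nrm (Y n.+1 x - Y n x) <= 1 * nrm x * r ^+ n.
  elim: n x => [|n ih] x.
    rewrite /= subr0 addr0 nrmZ half expr0 mulr1 mul1r.
    have := hX x; have := nrm_ge0 x; nra.
  (* This splitting of the difference of squares does not use commutation of the iterates; each of
     its two terms is at most r^(n + 1) |x|. *)
  have -> : Y n.+2 x - Y n.+1 x = (2^-1 : C) *:
      (Y n.+1 (Y n.+1 x - Y n x) + (Y n.+1 (Y n x) - Y n (Y n x))).
    rewrite -[Y n.+2 x]/(2^-1 *: (X x + Y n.+1 (Y n.+1 x))).
    rewrite -[X in _ - X = _]/(2^-1 *: (X x + Y n (Y n x))).
    move: (Y n.+1) (AY n.+1) => Z AZ.
    by rewrite (bopB _ _ (AB AZ)); vector_ring normE.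
  rewrite nrmZ half.
  have h1 := nrmD (Y n.+1 (Y n.+1 x - Y n x)) (Y n.+1 (Y n x) - Y n (Y n x)).
  have h2 := bY n.+1 (Y n.+1 x - Y n x).
  have h3 := ih (Y n x); have h4 := ih x; have h5 := bY n x.
  have h6 := ler_wpM2l r0 h4.
  have h7 := ler_wpM2r (exprn_ge0 n r0) h5.
  rewrite exprS; move: h1 h2 h3 h6 h7; rewrite !mul1r.
  move: (r ^+ n) => rn; lra.
have [L AL hL] := alg_geometric normE AC (introT andP (conj r0 r1)) AY dY.
have lim0 (y : H) (k : R) : 0 <= k -> (forall n, nrm y <= k * r ^+ n) -> y = 0.
  move=> k0 hy; apply: nrm0_eq0; apply/eqP; rewrite eq_le nrm_ge0 andbT.
  apply: (@le_eps _ _ _ k) => // e e0; rewrite add0r.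
  have [N hN] := exp_lt_eps (introT andP (conj r0 r1)) e0.
  by rewrite (le_trans (hy N)) // ler_wpM2l // ltW // hN.
have r1' : 0 <= (1 - r)^-1 by rewrite invr_ge0 subr_ge0 ltW.
exists L; split => //.
  move=> x y; apply/eqP; rewrite -subr_eq0; apply/eqP.
  apply: nrm0_eq0; apply/eqP; rewrite eq_le nrm_ge0 andbT.
  apply: (@le_eps _ _ _ (2 * (nrm x * nrm y / (1 - r)))).
    by rewrite !mulr_ge0 ?nrm_ge0.
  move=> e e0; rewrite add0r.
  have [N hN] := exp_lt_eps (introT andP (conj r0 r1)) e0.
  have -> : dot (L x) y - dot x (L y) = - dot (Y N x - L x) y + dot x (Y N y - L y).
    by rewrite dotBl dotBr saY; ring.
  rewrite (le_trans (nrmD _ _)) // nrmN.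
  apply: le_trans (lerD (dot_CS normE _ _) (dot_CS normE _ _)) _.
  apply: le_trans (lerD (ler_wpM2r (nrm_ge0 _) (hL N x)) (ler_wpM2l (nrm_ge0 _) (hL N y))) _.
  rewrite !mul1r.
  have -> : nrm x / (1 - r) * r ^+ N * nrm y + nrm x * (nrm y / (1 - r) * r ^+ N) =
     2 * (nrm x * nrm y / (1 - r)) * r ^+ N by ring.
  rewrite ler_wpM2l ?mulr_ge0 ?nrm_ge0 //.
  by rewrite ltW // hN.
move=> x.
have bL := AB AL.
have [_ [M M0 hM]] := (bounded_opP _).1 bL.
have : L x - (2^-1 : C) *: (X x + L (L x)) = 0.
  apply: (@lim0 _ (nrm x / (1 - r) * (3 + M))).
    by rewrite !mulr_ge0 ?nrm_ge0 // addr_ge0.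
  move=> n.
  have -> : L x - (2^-1 : C) *: (X x + L (L x)) = - (Y n.+1 x - L x) +
      (2^-1 : C) *: ((Y n (Y n x) - L (Y n x)) + L (Y n x - L x)).
    by rewrite (bopB _ _ bL) /=; vector_ring normE.
  have h1 := hL n.+1 x; have h2 := hL n (Y n x); have h3 := hM (Y n x - L x).
  have h4 := hL n x; have h5 := bY n x.
  rewrite (le_trans (nrmD _ _)) // nrmN nrmZ half.
  have h6 := nrmD (Y n (Y n x) - L (Y n x)) (L (Y n x - L x)).
  have h7 := ler_wpM2l M0 h4.
  have h8 : nrm (Y n x) <= nrm x by rewrite (le_trans h5) // ler_piMl ?nrm_ge0 // ltW.
  have rn0 := exprn_ge0 n r0.
  have h9 : nrm (Y n x) / (1 - r) * r ^+ n <= nrm x / (1 - r) * r ^+ n.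
    by rewrite !ler_wpM2r.
  have h10 : nrm x / (1 - r) * r ^+ n.+1 <= nrm x / (1 - r) * r ^+ n.
    by rewrite ler_wpM2l ?mulr_ge0 ?nrm_ge0 // exprS ler_piMl // ltW.
  have h11 : 0 <= nrm x / (1 - r) * r ^+ n by rewrite !mulr_ge0 ?nrm_ge0.
  have h12 := mulr_ge0 M0 h11.
  move: h1 h2 h3 h4 h6 h7; rewrite !mul1r => h1 h2 h3 h4 h6 h7.
  have -> : nrm x / (1 - r) * (3 + M) * r ^+ n =
    3 * (nrm x / (1 - r) * r ^+ n) + M * (nrm x / (1 - r) * r ^+ n) by ring.
  lra.
move=> /eqP; rewrite subr_eq0 => /eqP hLx.
have hLx2 : L x + L x = X x + L (L x).
  rewrite {1 2}hLx; apply: (dot_injl normE) => w; by rewrite !(dotDl, dotZl); field.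
rewrite (bopB _ _ bL) -addrA; congr (x + _).
rewrite opprB addrCA; apply/eqP; rewrite -subr_eq0 opprK.
have -> : L (L x) + (- L x - L x) + X x = (X x + L (L x)) - (L x + L x) by vector_ring normE.
by rewrite hLx2 subrr.
Qed.

Variable rho : (H -> H) -> C.
Hypothesis rhoP : positive_functional dot A rho.

Lemma rho_lin a S T : A S -> A T -> rho (fun x => a *: S x + T x) = a * rho S + rho T.
Proof. by move=> AS AT; case: rhoP => h _; apply: h. Qed.
Lemma rho_zero : rho (fun=> 0) = 0.
Proof.
have := rho_lin (-1) (alg_id AC) (alg_id AC); rewrite mulN1r addNr => <-.
by congr rho; apply/funext => x; rewrite scaleN1r addNr.
Qed.
Lemma rho_scale a T : A T -> rho (fun x => a *: T x) = a * rho T.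
Proof.
move=> AT; have := rho_lin a AT (alg_zero AC); rewrite rho_zero addr0 => <-.
by congr rho; apply/funext => x; rewrite addr0.
Qed.
Lemma rho_add S T : A S -> A T -> rho (fun x => S x + T x) = rho S + rho T.
Proof.
move=> AS AT; have := rho_lin 1 AS AT; rewrite mul1r => <-.
by congr rho; apply/funext => x; rewrite scale1r.
Qed.
Lemma rho_sub S T : A S -> A T -> rho (fun x => S x - T x) = rho S - rho T.
Proof.
move=> AS AT; have := rho_lin (-1) AT AS; rewrite mulN1r addrC => <-.
by congr rho; apply/funext => x; rewrite scaleN1r addrC.
Qed.
Lemma rho_sum (I : Type) (s : seq I) (T : I -> H -> H) :
  (forall i, A (T i)) -> rho (fun x => \sum_(i <- s) T i x) = \sum_(i <- s) rho (T i).
Proof.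
move=> hT; elim: s => [|i s ih].
  by rewrite big_nil -[RHS]rho_zero; congr rho; apply/funext => x; rewrite big_nil.
rewrite big_cons -ih -rho_add //; last exact: (alg_sum AC).
by congr rho; apply/funext => x; rewrite big_cons.
Qed.

Lemma rho_sq S S' : A S -> adjoint dot S S' -> 0 <= rho (S' \o S).
Proof.
by move=> AS hS; case: rhoP => _; apply => //; exact: (alg_adjoint normE AC AS hS).
Qed.

Lemma rho_id : 0 <= rho id.
Proof. exact: (rho_sq (alg_id AC) (@adjoint_id _ _ dot)). Qed.

(** Positivity of [rho] is assumed on squares only. For e > 0 a positive multiple of T + e is 1 - X
    with |X| < 1, hence the square of a self-adjoint element of the algebra, and rho T + e rho 1 >=
    0; then e tends to 0. The shift by e keeps the norm of X strictly below 1, as the square root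
    requires. *)
Lemma rho_ge0 T : A T -> posop T -> 0 <= rho T.
Proof.
move=> AT pT; have bT := AB AT; have saT := posop_selfadj bT pT.
have [_ [M M0 hM]] := (bounded_opP _).1 bT.
have key (e : R) : 0 < e -> 0 <= rho T + e%:C%C * rho id.
  move=> e0; pose c := (M + e)^-1.
  have Me : 0 < M + e by rewrite ltr_wpDl.
  have c0 : 0 < c by rewrite invr_gt0.
  have cE : c * (M + e) = 1 by rewrite mulVf // gt_eqF.
  pose X x := x - c%:C%C *: (T x + e%:C%C *: x).
  have ATe : A (fun x => T x + e%:C%C *: x).
    exact: (alg_add AC AT (alg_scale AC _ (alg_id AC))).
  have AX : A X by exact: (alg_sub AC (alg_id AC) (alg_scale AC _ ATe)).
  have dX x : dot (X x) x = (nrm x ^+ 2 - c * (complex.Re (dot (T x) x) + e * nrm x ^+ 2))%:C%C.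
    rewrite /X dotBl dotZl dotDl dotZl (dotxx normE) {1}(ge0c_Re (pT x)).
    by rewrite -!rmorphM -rmorphD -rmorphM -rmorphB.
  have TM x : complex.Re (dot (T x) x) <= M * nrm x ^+ 2.
    rewrite (le_trans (Re_le_nrm _)) // (le_trans (dot_CS normE _ _)) // expr2 mulrA.
    by rewrite ler_wpM2r ?nrm_ge0.
  have pX : posop X.
    move=> x; rewrite dX ler0c subr_ge0 -[leRHS]mul1r -cE -mulrA ler_pM2l //.
    by rewrite mulrDl lerD2r.
  have q01 : 0 <= 1 - c * e < 1.
    rewrite subr_ge0 -cE ler_pM2l // lerDr M0 /= gtrBl mulr_gt0 //.
  have hX : forall x, nrm (X x) <= (1 - c * e) * nrm x.
    apply: posop_bound => //; [exact: AB | by case/andP: q01 |].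
    move=> x; rewrite dX /= mulrBl mul1r lerB // -mulrA ler_pM2l // lerDr.
    by have := pT x; rewrite ge0cE => /andP[].
  have [Y [AY saY hY]] := sqrt_one_minus AX (posop_selfadj (AB AX) pX) q01 hX.
  have AZ : A (fun x => x - Y x) by exact: (alg_sub AC (alg_id AC) AY).
  have saZ : adjoint dot (fun x => x - Y x) (fun x => x - Y x).
    by move=> x y; rewrite dotBl dotBr saY.
  have := rho_sq AZ saZ.
  have -> : (fun x => x - Y x) \o (fun x => x - Y x) = (fun x => c%:C%C *: (T x + e%:C%C *: x)).
    by apply/funext => x /=; rewrite hY /X subKr.
  rewrite rho_scale // rho_add //; last exact: (alg_scale AC _ (alg_id AC)).
  rewrite (rho_scale _ (alg_id AC)) pmulr_rge0 // ltcR //.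
have r1 := rho_id; have i1 := ger0_Im r1.
rewrite ge0cE; apply/andP; split.
  have := ger0_Im (key 1 ltr01); rewrite ImD ImRM i1 mulr0 addr0 => -> //.
rewrite -[leRHS]addr0.
apply: (@le_eps _ _ _ (complex.Re (rho id))).
  by move: r1; rewrite ge0cE => /andP[].
move=> e /key; rewrite ge0cE => /andP[_]; rewrite ReD ReRM; lra.
Qed.

Lemma rho_id_real : rho id = (complex.Re (rho id))%:C%C.
Proof. exact: ge0c_Re rho_id. Qed.

(** Both M - T and M + T are positive. *)
Lemma rho_selfadj_bound T (M : R) : A T -> adjoint dot T T -> 0 <= M ->
  (forall x, nrm (T x) <= M * nrm x) ->
  complex.Im (rho T) = 0 /\ `|complex.Re (rho T)| <= M * complex.Re (rho id).
Proof.
move=> AT saT M0 hM.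
have AM : A (fun x => M%:C%C *: x) by exact: (alg_scale AC _ (alg_id AC)).
have TM x : `|complex.Re (dot (T x) x)| <= M * nrm x ^+ 2.
  rewrite (le_trans (absRe_le_nrm _)) // (le_trans (dot_CS normE _ _)) // expr2 mulrA.
  by rewrite ler_wpM2r ?nrm_ge0.
have h1 : 0 <= rho (fun x => M%:C%C *: x - T x).
  apply: rho_ge0; first exact: (alg_sub AC).
  move=> x; rewrite dotBl dotZl (dotxx normE) (selfadj_real _ saT) -rmorphM -rmorphB.
  by rewrite ler0c subr_ge0 (le_trans (ler_norm _)).
have h2 : 0 <= rho (fun x => M%:C%C *: x + T x).
  apply: rho_ge0; first exact: (alg_add AC).
  move=> x; rewrite dotDl dotZl (dotxx normE) (selfadj_real _ saT) -rmorphM -rmorphD.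
  by rewrite ler0c -[X in _ + X]opprK subr_ge0 (le_trans (ler_norm _)) // normrN.
move: h1 h2; rewrite (rho_sub AM AT) (rho_add AM AT) (rho_scale _ (alg_id AC)).
rewrite rho_id_real -rmorphM !ge0cE !ReD !ImD ReN ImN /= add0r => /andP[/eqP h1 h2] /andP[_ h3].
split; first by lra.
by rewrite ler_norml; apply/andP; split; lra.
Qed.

(** Cartesian decomposition; a bound on [T] passes to both parts because the adjoint satisfies the
    same one. *)
Lemma rho_ReIm T T' : A T -> adjoint dot T T' ->
  exists U V, [/\ A U /\ A V, adjoint dot U U /\ adjoint dot V V,
    (forall x, T x = U x + 'i%C *: V x), (forall x, T' x = U x - 'i%C *: V x)
    & forall M : R, 0 <= M -> (forall x, nrm (T x) <= M * nrm x) ->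
        (forall x, nrm (U x) <= M * nrm x) /\ (forall x, nrm (V x) <= M * nrm x)].
Proof.
move=> AT hT; have AT' := alg_adjoint normE AC AT hT.
have hT' := adjoint_sym hT.
have h2 : (2^-1 : C) = (2^-1 : R)%:C%C by rewrite fmorphV rmorph_nat.
pose h : C := 2^-1.
have half : nrm h = 2^-1 by rewrite /h h2 nrmR ger0_norm.
have hJ : h^* = h by rewrite /h h2 conjRC.
have iJ : (- 'i%C * h)^* = 'i%C * h.
  by apply: eq_ReIm; rewrite ?ReJ ?ImJ !(ReM, ImM) /h h2 /=; ring.
have ii : ('i%C : C) * 'i%C = -1 by rewrite -expr2 sqr_i.
exists (fun x => h *: (T x + T' x)), (fun x => (- 'i%C * h) *: (T x - T' x)); split.
- split; apply: (alg_scale AC); [exact: (alg_add AC) | exact: (alg_sub AC)].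
- split; first by move=> x y; rewrite dotZl dotZr hJ dotDl dotDr hT hT' addrC.
  move=> x y; rewrite dotZl dotZr iJ dotBl dotBr hT hT'; ring.
- move=> x; rewrite scalerA mulrA mulrN ii opprK mul1r /h.
  by apply: (dot_injl normE) => w; rewrite !(dotBl, dotDl, dotNl, dotZl); field.
- move=> x; rewrite scalerA mulrA mulrN ii opprK mul1r /h.
  by apply: (dot_injl normE) => w; rewrite !(dotBl, dotDl, dotNl, dotZl); field.
move=> M M0 hM; have hM' := adjoint_bound normE M0 hM hT.
split => x; rewrite nrmZ ?nrmM ?nrmN ?nrm_i ?mul1r half.
  by have := nrmD (T x) (T' x); have := hM x; have := hM' x; lra.
by have := nrmB (T x) (T' x); have := hM x; have := hM' x; lra.
Qed.

(** Continuity is a consequence of positivity. The factor 2 comes from treating the two self-adjoint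
    parts separately. *)
Lemma rho_bound T (M : R) : A T -> 0 <= M -> (forall x, nrm (T x) <= M * nrm x) ->
  nrm (rho T) <= 2 * complex.Re (rho id) * M.
Proof.
move=> AT M0 hM; have [T' _ hT] := alg_adjointP normE AC AT.
have [U [V [[AU AV] [saU saV] TE _ UV]]] := rho_ReIm AT hT.
have [hU hV] := UV M M0 hM.
have [iU bU] := rho_selfadj_bound AU saU M0 hU.
have [iV bV] := rho_selfadj_bound AV saV M0 hV.
have -> : T = (fun x => U x + 'i%C *: V x) by apply/funext.
rewrite rho_add ?rho_scale //; last exact: (alg_scale AC).
rewrite (le_trans (nrmD _ _)) // nrmM nrm_i mul1r.
have := nrm_le_ReIm (rho U); have := nrm_le_ReIm (rho V); rewrite iU iV normr0; lra.
Qed.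

Lemma rho_adjoint T T' : A T -> adjoint dot T T' -> rho T' = (rho T)^*.
Proof.
move=> AT hT.
have [U [V [[AU AV] [saU saV] TE TE' _]]] := rho_ReIm AT hT.
have bnd S : A S -> adjoint dot S S -> complex.Im (rho S) = 0.
  move=> AS saS; have [_ [M M0 hM]] := (bounded_opP _).1 (AB AS).
  by case: (rho_selfadj_bound AS saS M0 hM).
have iU := bnd U AU saU; have iV := bnd V AV saV.
have -> : T = (fun x => U x + 'i%C *: V x) by apply/funext.
have -> : T' = (fun x => U x - 'i%C *: V x) by apply/funext.
have AiV : A (fun x => 'i%C *: V x) by exact: (alg_scale AC).
rewrite (rho_sub AU AiV) (rho_add AU AiV) rho_scale //.
by apply: eq_ReIm; rewrite !(ReJ, ImJ, ReD, ImD, ReN, ImN, ReM, ImM) /= ?iU ?iV; lra.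
Qed.

(* Cauchy-Schwarz for the form (S, T) |-> rho (T^* S). *)
Lemma rho_null S T T' : A S -> A T -> adjoint dot T T' -> rho (T' \o T) = 0 ->
  rho (S \o T) = 0.
Proof.
move=> AS AT hT rT; have AT' := alg_adjoint normE AC AT hT.
have [S' AS' hS] := alg_adjointP normE AC AS.
have hS' := adjoint_sym hS.
apply: nrm0_eq0; apply/eqP; rewrite -sqrf_eq0 eq_le sqr_ge0 andbT.
(* The quadratic coefficient in the discriminant bound is rho (T' T) = 0, which forces rho (S T) =
   0. *)
rewrite -(mulr0 (complex.Re (rho (S \o S')))).
apply: hermitian_disc => // a; rewrite mulr0 addr0.
have := rho_sq (alg_lin AC a AT AS') (adjoint_lin a hT hS').
set F := _ \o _.
have -> : F = (fun x => a^* *: (a *: T' (T x) + T' (S' x)) + (a *: S (T x) + S (S' x))).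
  apply/funext => x; rewrite /F /=.
  by rewrite (bopD _ _ (AB AT')) (bopZ _ _ (AB AT')) (bopD _ _ (AB AS)) (bopZ _ _ (AB AS)).
have h1 := alg_comp AC AT' AT; have h2 := alg_comp AC AT' AS'.
have h3 := alg_comp AC AS AT; have h4 := alg_comp AC AS AS'.
rewrite (rho_lin _ (alg_lin AC a h1 h2) (alg_lin AC a h3 h4)).
rewrite (rho_lin _ h1 h2) (rho_lin _ h3 h4) rT mulr0 add0r.
have -> : rho (T' \o S') = (rho (S \o T))^*.
  by apply: rho_adjoint h3 _; exact: adjoint_comp.
rewrite ge0cE => /andP[_]; rewrite -rmorphM !ReD ReJ; lra.
Qed.

End PositiveFunctional.

(** * Cauchy-Schwarz inequalities for finite sums *)

Section FiniteCS.
Context {R : realType}.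
Local Notation C := R[i].

Lemma cs_sum (I : finType) (x y : I -> C) :
  nrm (\sum_i x i * y i) ^+ 2 <= (\sum_i nrm (x i) ^+ 2) * (\sum_i nrm (y i) ^+ 2).
Proof.
rewrite mulrC; apply: hermitian_disc => [|a].
  by apply: sumr_ge0 => i _; exact: sqr_ge0.
have : 0 <= \sum_i nrm (a * x i + (y i)^*) ^+ 2.
  by apply: sumr_ge0 => i _; exact: sqr_ge0.
congr (0 <= _); rewrite mulr_sumr [complex.Re _](big_morph _ (@ReD R) (erefl : complex.Re 0 = 0)).
rewrite !mulr_sumr -!big_split /=; apply: eq_bigr => i _.
rewrite -!exprMn -nrmM !nrm_sqr !ReD !ImD !ReM !ImM ReJ ImJ; ring.
Qed.

Lemma cs_real (I : finType) (x y : I -> R) :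
  (\sum_i x i * y i) ^+ 2 <= (\sum_i x i ^+ 2) * (\sum_i y i ^+ 2).
Proof.
have := cs_sum (fun i => (x i)%:C%C) (fun i => (y i)%:C%C).
have -> : \sum_i (x i)%:C%C * (y i)%:C%C = (\sum_i x i * y i)%:C%C :> C.
  by rewrite rmorph_sum; apply: eq_bigr => i _; rewrite rmorphM.
have E (w : I -> R) : \sum_i nrm ((w i)%:C%C : C) ^+ 2 = \sum_i w i ^+ 2.
  by apply: eq_bigr => i _; rewrite nrmR real_normK ?num_real.
by rewrite !E nrmR real_normK ?num_real.
Qed.

Lemma cs_vector (V : normedModType C) (I : finType) (a : I -> C) (v : I -> V) :
  nrm (\sum_i a i *: v i) ^+ 2 <= (\sum_i nrm (a i) ^+ 2) * (\sum_i nrm (v i) ^+ 2).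
Proof.
apply: le_trans (cs_real _ _); rewrite ler_pXn2r ?nnegrE ?nrm_ge0 //; last first.
  by apply: sumr_ge0 => i _; rewrite mulr_ge0 ?nrm_ge0.
apply: le_trans (nrm_sum _ _ _) _.
by apply: ler_sum => i _; rewrite nrmZ.
Qed.

End FiniteCS.

(** * Multipliers of the Drury-Arveson space *)

Section BallGeometry.
Context {R : realType} {d : nat}.
Local Notation C := R[i].
Implicit Types z w : 'rV[C]_d.

Definition bnorm z : R := Num.sqrt (\sum_j nrm (z 0 j) ^+ 2).

(** [mulz z] multiplies by w -> bilin z w, which is linear in both arguments: pairings without
    conjugate come with the resolvent, Hermitian ones with the reproducing kernel. *)
Definition bilin z w : C := \sum_j z 0 j * w 0 j.

Lemma bnorm_ge0 z : 0 <= bnorm z. Proof. exact: sqrtr_ge0. Qed.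

Lemma bnorm2 z : bnorm z ^+ 2 = \sum_j nrm (z 0 j) ^+ 2.
Proof. by rewrite sqr_sqrtr //; apply: sumr_ge0 => i _; exact: sqr_ge0. Qed.

Lemma hermE z w : herm z w = bilin z (map_mx Num.conj w).
Proof. by apply: eq_bigr => j _; rewrite mxE. Qed.

Lemma hermzz z : herm z z = (bnorm z ^+ 2)%:C%C.
Proof. by rewrite bnorm2 rmorph_sum; apply: eq_bigr => j _; rewrite nrm_sqrC. Qed.

Lemma hermC z w : herm z w = (herm w z)^*.
Proof.
by rewrite rmorph_sum; apply: eq_bigr => j _; rewrite rmorphM /= conjCK mulrC.
Qed.

Lemma bnorm_conj z : bnorm (map_mx Num.conj z) = bnorm z.
Proof.
by congr Num.sqrt; apply: eq_bigr => j _; rewrite mxE nrm_conj.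
Qed.

Lemma unit_ballP z : unit_ball z <-> bnorm z < 1.
Proof.
rewrite /unit_ball /= hermzz (_ : (1 : C) = 1%:C%C) // ltcR.
by rewrite expr_lt1 // bnorm_ge0.
Qed.

Lemma bilin_le z w : nrm (bilin z w) <= bnorm z * bnorm w.
Proof.
rewrite -(@ler_pXn2r _ 2) ?nnegrE ?nrm_ge0 ?mulr_ge0 ?bnorm_ge0 //.
by rewrite exprMn !bnorm2; exact: cs_sum.
Qed.

Lemma herm_le z w : nrm (herm z w) <= bnorm z * bnorm w.
Proof. by rewrite hermE (le_trans (bilin_le _ _)) // bnorm_conj. Qed.

Lemma bilin_lt1 z w : unit_ball z -> unit_ball w -> nrm (bilin z w) < 1.
Proof.
move=> /unit_ballP hz /unit_ballP hw; apply: le_lt_trans (bilin_le _ _) _.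
by rewrite mulr_ilt1 ?bnorm_ge0.
Qed.

Lemma herm_lt1 z w : unit_ball z -> unit_ball w -> nrm (herm z w) < 1.
Proof.
move=> /unit_ballP hz /unit_ballP hw; apply: le_lt_trans (herm_le _ _) _.
by rewrite mulr_ilt1 ?bnorm_ge0.
Qed.

Lemma one_sub_neq0 (a : C) : nrm a < 1 -> 1 - a != 0.
Proof.
by move=> a1; apply/eqP => /eqP; rewrite subr_eq0 => /eqP a0; move: a1; rewrite -a0 nrm1 ltxx.
Qed.

Lemma unit_ball0 : unit_ball (0 : 'rV[C]_d).
Proof.
apply/unit_ballP; rewrite /bnorm big1 ?sqrtr0 // => j _.
by rewrite mxE nrm0 expr0n.
Qed.

End BallGeometry.

Section DruryArvesonTheory.
Context {R : realType} {d : nat}.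
Local Notation C := R[i].
Local Notation B := (set_type (@unit_ball R d)).
Variable H : rkhs (@da_kernel R d).
Local Notation dot := (rkhs_dot H).
Local Notation normE := (rkhs_normE (r := H)).
Local Notation ev := (@rkhs_eval _ _ _ H).
Local Notation ker := (@rkhs_ker _ _ _ H).
Local Notation shift := (@Defs.shift _ _ H).
Implicit Types (f x y : H) (z w : 'rV[C]_d) (u v : B).

Lemma valB u : unit_ball (val u).
Proof. by have := valP u; rewrite inE. Qed.

Lemma evE f u : ev f u = dot f (ker u).
Proof. exact: rkhs_reproducing. Qed.

Lemma evP (f g : H) : (forall u, ev f u = ev g u) -> f = g.
Proof. by move=> h; apply: (@rkhs_eval_inj _ _ _ H); apply/funext. Qed.

Lemma evD f g u : ev (f + g) u = ev f u + ev g u.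
Proof. by rewrite !evE dotDl. Qed.
Lemma evB f g u : ev (f - g) u = ev f u - ev g u.
Proof. by rewrite !evE dotBl. Qed.
Lemma evZ a f u : ev (a *: f) u = a * ev f u.
Proof. by rewrite !evE dotZl. Qed.
Lemma ev_sum (I : Type) (s : seq I) (F : I -> H) u :
  ev (\sum_(i <- s) F i) u = \sum_(i <- s) ev (F i) u.
Proof. by rewrite evE dot_suml; apply: eq_bigr => i _; rewrite evE. Qed.

Lemma dot_ker u v : dot (ker u) (ker v) = (1 - herm (val v) (val u))^-1.
Proof. by rewrite -evE rkhs_kerE. Qed.

Lemma herm_neq0 u v : 1 - herm (val u) (val v) != 0.
Proof. by apply/one_sub_neq0/herm_lt1; exact: valB. Qed.

(** Combinations are kept as lists, since kernel vectors are not known to be independent and a map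
    prescribed on them is not visibly well defined. With g = 1 this is the combination itself; with
    g(u) the conjugate of u_j it is its image under the adjoint of the shift. *)
Definition kcomb (g : B -> C) (s : seq (C * B)) : H :=
  \sum_(p <- s) (p.1 * g p.2) *: ker p.2.

Lemma kcomb_lin (g : B -> C) (a : C) (s t : seq (C * B)) :
  kcomb g ([seq (a * p.1, p.2) | p <- s] ++ t) = a *: kcomb g s + kcomb g t.
Proof.
rewrite /kcomb big_cat big_map scaler_sumr; congr (_ + _).
by apply: eq_bigr => p _; rewrite scalerA mulrA.
Qed.

Local Notation span := (kcomb (fun=> 1)).

Lemma span_ker u : span [:: (1, u)] = ker u.
Proof. by rewrite /kcomb big_seq1 mulr1 scale1r. Qed.

Lemma span_dense x (e : R) : 0 < e -> exists s, nrm (span s - x) < e.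
Proof.
move=> e0.
have [||| y [s _ <-] hs] := @orth_dense _ _ dot normE (range span) _ _ _ x _ e0.
- by exists [::]; rewrite // /kcomb big_nil.
- move=> a _ _ [s _ <-] [t _ <-]; exists ([seq (a * p.1, p.2) | p <- s] ++ t) => //.
  exact: kcomb_lin.
- move=> f hf; apply: evP => u; rewrite !evE dot0l (dotC dot) hf ?rmorph0 //.
  by exists [:: (1, u)] => //; exact: span_ker.
by exists s.
Qed.

Lemma dense_Re_ge0 T : bounded_op T ->
  (forall s, 0 <= complex.Re (dot (T (span s)) (span s))) ->
  forall x, 0 <= complex.Re (dot (T x) x).
Proof.
move=> bT hT x; have [_ [M M0 hM]] := (bounded_opP _).1 bT.
apply: (@le_eps _ _ _ (M * (2 * nrm x + 1))).
  by rewrite mulr_ge0 // addr_ge0 // mulr_ge0 // nrm_ge0.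
move=> e e0.
(* The minimum with 1 bounds |y| by |x| + 1, so that the total error is linear in [e]. *)
have e1 : 0 < Num.min e 1 by rewrite lt_min e0 /=.
have [s] := span_dense x e1; rewrite lt_min => /andP[hs hs1].
set y := span s in hs hs1; have hy : 0 <= _ := hT s.
have yx : nrm y <= nrm x + 1.
  by rewrite -(subrK x y) addrC (le_trans (nrmD _ _)) // lerD2l ltW.
have E : dot (T y) y = dot (T x) x + (dot (T (y - x)) y + dot (T x) (y - x)).
  by rewrite (bopB _ _ bT) dotBl dotBr; ring.
have h1 : nrm (dot (T (y - x)) y) <= M * nrm (y - x) * nrm y.
  rewrite (le_trans (dot_CS normE _ _)) // ler_wpM2r ?nrm_ge0 //.
have h2 : nrm (dot (T x) (y - x)) <= M * nrm x * nrm (y - x).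
  rewrite (le_trans (dot_CS normE _ _)) // ler_wpM2r ?nrm_ge0 //.
have h3 : nrm (y - x) * nrm y <= e * (nrm x + 1).
  by rewrite ler_pM ?nrm_ge0 // ltW.
have h4 : nrm x * nrm (y - x) <= nrm x * e by rewrite ler_wpM2l ?nrm_ge0 // ltW.
have h5 := ler_wpM2l M0 h3; have h6 := ler_wpM2l M0 h4.
have h7 := Re_le_nrm (dot (T (y - x)) y); have h8 := Re_le_nrm (dot (T x) (y - x)).
move: hy; rewrite -/y E !ReD; lra.
Qed.

Lemma dot_kcomb (g : B -> C) (s : seq (C * B)) (h : B -> C) (t : seq (C * B)) : dot (kcomb g s) (kcomb h t) =
  \sum_(p <- s) \sum_(q <- t) p.1 * q.1^* *
     (g p.2 * (h q.2)^* / (1 - herm (val q.2) (val p.2))).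
Proof.
rewrite dot_suml; apply: eq_bigr => p _; rewrite dot_sumr; apply: eq_bigr => q _.
by rewrite dotZl dotZr dot_ker rmorphM /=; ring.
Qed.

(** The identity (1 - <z,w>) / (1 - <z,w>) = 1 summed against the coefficients. It says that 1 -
    sum_j S_j S_j^* is the projection onto the constants, the last sum being the value of the
    combination at the origin. *)
Lemma kcomb_row s :
  \sum_(j < d) nrm (kcomb (fun u => (val u 0 j)^*) s) ^+ 2 =
  nrm (span s) ^+ 2 - nrm (\sum_(p <- s) p.1) ^+ 2.
Proof.
apply: (@complexI R); rewrite rmorph_sum rmorphB /= -nrm_sqrC -(dotxx normE).
under eq_bigr do rewrite -(dotxx normE) dot_kcomb.
rewrite dot_kcomb exchange_big /= rmorph_sum /= mulr_suml -sumrB.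
apply: eq_bigr => p _; rewrite exchange_big /= mulr_sumr -sumrB.
apply: eq_bigr => q _; rewrite -mulr_sumr -mulr_suml.
have -> : \sum_(j < d) (val p.2 0 j)^* * (val q.2 0 j)^*^* = herm (val q.2) (val p.2).
  by apply: eq_bigr => j _; rewrite conjCK mulrC.
rewrite rmorph1 mulr1.
by have := herm_neq0 q.2 p.2; move: (herm _ _) => a ha; field.
Qed.

(** The adjoint of multiplication by z_j must send each kernel vector k_u to (u_j)^* k_u. Pairing
    the images of combinations with [f] is a functional bounded by |f|, thanks to [kcomb_row], and
    its Riesz vector is z_j f. *)
Lemma shift_exists (j : 'I_d) f : exists2 g,
  (forall u, ev g u = val u 0 j * ev f u) & nrm g <= nrm f.
Proof.
pose G x l := exists2 s, x = span s & l = dot (kcomb (fun u => (val u 0 j)^*) s) f.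
have [||||g [hg _ bg]] := @riesz_graph _ _ dot normE G (nrm f).
- exact: nrm_ge0.
- by exists [::]; rewrite /kcomb big_nil // dot0l.
- move=> a _ _ _ _ [s -> ->] [t -> ->].
  exists ([seq (a * p.1, p.2) | p <- s] ++ t); first by rewrite kcomb_lin.
  by rewrite kcomb_lin dotDl dotZl.
- move=> _ _ [s -> ->]; rewrite mulrC (le_trans (dot_CS normE _ _)) //.
  rewrite ler_wpM2r ?nrm_ge0 // -(@ler_pXn2r _ 2) ?nnegrE ?nrm_ge0 //.
  apply: (@le_trans _ _ (\sum_(j < d) nrm (kcomb (fun u => (val u 0 j)^*) s) ^+ 2)).
    by rewrite (bigD1 j) //= lerDl sumr_ge0 // => i _; exact: sqr_ge0.
  by rewrite kcomb_row gerBl sqr_ge0.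
exists g => // u.
have := hg (ker u) _ (ex_intro2 _ _ [:: (1, u)] (esym (span_ker u)) erefl).
rewrite /kcomb big_seq1 /= mul1r dotZl !evE [dot g _](dotC dot) => <-.
by rewrite rmorphM /= conjCK -dotC.
Qed.

Lemma shiftE j f u : ev (shift j f) u = val u 0 j * ev f u.
Proof.
have [g hg _] := shift_exists j f.
by have := @xgetPex _ 0 [set g : H | forall z : B, ev g z = val z 0 j * ev f z] (ex_intro _ g hg); apply.
Qed.

Lemma shift_le j f : nrm (shift j f) <= nrm f.
Proof.
have [g hg bg] := shift_exists j f.
by suff -> : shift j f = g by []; apply: evP => u; rewrite shiftE hg.
Qed.

Lemma shift_bounded j : bounded_op (shift j).
Proof.
apply/bounded_opP; split; last by exists 1 => // x; rewrite mul1r shift_le.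
by move=> a f g; apply: evP => u; rewrite !(shiftE, evD, evZ); ring.
Qed.

Definition coshift j : H -> H := projT1 (cid2 (adjoint_exists normE (shift_bounded j))).

Lemma coshift_bounded j : bounded_op (coshift j).
Proof. by rewrite /coshift; case: cid2. Qed.

Lemma coshift_adjoint j : adjoint dot (shift j) (coshift j).
Proof. by rewrite /coshift; case: cid2. Qed.

Lemma coshift_ker j u : coshift j (ker u) = (val u 0 j)^* *: ker u.
Proof.
apply: (dot_inj normE) => x.
by rewrite -coshift_adjoint -evE shiftE dotZr conjCK evE.
Qed.

Lemma coshift_span j s : coshift j (span s) = kcomb (fun u => (val u 0 j)^*) s.
Proof.
rewrite /kcomb (bop_sum _ _ _ (coshift_bounded j)); apply: eq_bigr => p _.
by rewrite (bopZ _ _ (coshift_bounded j)) coshift_ker scalerA mulr1.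
Qed.

Lemma sum_bounded (I : Type) (s : seq I) (T : I -> H -> H) :
  (forall i, bounded_op (T i)) -> bounded_op (fun x => \sum_(i <- s) T i x).
Proof. by move=> h; exact: (alg_sum (bounded_op_Cstar dot)).
Qed.

Lemma row_contraction x : \sum_(j < d) nrm (coshift j x) ^+ 2 <= nrm x ^+ 2.
Proof.
pose T y := y - \sum_(j < d) shift j (coshift j y).
have bT : bounded_op T.
  apply: (alg_sub (bounded_op_Cstar dot) (@bounded_op_id _ _)).
  apply: sum_bounded => j; apply: (@bounded_op_comp _ _ (shift j) (coshift j)).
    exact: shift_bounded.
  exact: coshift_bounded.
have TE y : complex.Re (dot (T y) y) = nrm y ^+ 2 - \sum_(j < d) nrm (coshift j y) ^+ 2.
  rewrite /T dotBl dot_suml ReD ReN (dotxx normE); congr (_ - _).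
  rewrite [LHS](big_morph _ (@ReD R) (erefl : complex.Re 0 = 0)); apply: eq_bigr => j _.
  by rewrite coshift_adjoint (dotxx normE).
rewrite -subr_ge0 -TE; apply: dense_Re_ge0 => // s; rewrite TE.
by under eq_bigr do rewrite coshift_span; rewrite kcomb_row subKr sqr_ge0.
Qed.

Definition mulz z y : H := \sum_j z 0 j *: shift j y.

Definition comulz z y : H := \sum_j (z 0 j)^* *: coshift j y.

Lemma comulz_adjoint z : adjoint dot (mulz z) (comulz z).
Proof.
move=> x y; rewrite dot_suml dot_sumr; apply: eq_bigr => j _.
by rewrite dotZl dotZr conjCK coshift_adjoint.
Qed.

Lemma comulz_le z x : nrm (comulz z x) <= bnorm z * nrm x.
Proof.
rewrite -(@ler_pXn2r _ 2) ?nnegrE ?mulr_ge0 ?nrm_ge0 ?bnorm_ge0 // exprMn.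
apply: le_trans (cs_vector _ _) _.
under eq_bigr do rewrite nrm_conj.
by rewrite -bnorm2 ler_wpM2l ?sqr_ge0 // row_contraction.
Qed.

Lemma mulz_le z x : nrm (mulz z x) <= bnorm z * nrm x.
Proof.
apply: (adjoint_bound normE (bnorm_ge0 z) (comulz_le z)).
exact: adjoint_sym (comulz_adjoint z).
Qed.

Lemma ev_mulz z f u : ev (mulz z f) u = bilin z (val u) * ev f u.
Proof.
rewrite ev_sum /bilin mulr_suml; apply: eq_bigr => j _.
by rewrite evZ shiftE mulrA.
Qed.

Lemma toeplitz_Cstar : unital_Cstar_subalgebra dot (toeplitz_algebra H).
Proof.
split=> [|T bT hT]; last first.
  move=> A hA; case: (hA) => -[_ closedA] _; apply: closedA => // e e0.
  by have [S AS hS] := hT e e0; exists S => //; apply: AS.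
split.
- move=> T; apply; split; first exact: (bounded_op_Cstar dot).
  by move=> _ [j ->]; exact: shift_bounded.
- by move=> A [hA _]; exact: (alg_id hA).
- by move=> a S T hS hT A AG; apply: (alg_lin AG.1); [exact: hS | exact: hT].
- by move=> S T hS hT A AG; apply: (alg_comp AG.1); [exact: hS | exact: hT].
- move=> S S' hS _ hSS' A AG; apply: (alg_adjoint normE AG.1 _ hSS'); exact: hS.
Qed.

Lemma toeplitz_shift j : toeplitz_algebra H (shift j).
Proof. by move=> A [_ AG]; apply: AG; exists j. Qed.

Lemma toeplitz_mulz z : toeplitz_algebra H (mulz z).
Proof.
apply: (alg_sum toeplitz_Cstar) => j; apply: (alg_scale toeplitz_Cstar).
exact: toeplitz_shift.
Qed.

Definition res z : H -> H := op_inv (fun y => y - \sum_j z 0 j *: shift j y).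

Lemma herglotz_opE z : herglotz_op H z = (fun x => 2 *: res z x - x).
Proof. by []. Qed.

Lemma resP z : unit_ball z -> [/\ toeplitz_algebra H (res z),
   forall x, res z x - mulz z (res z x) = x & forall x, res z (x - mulz z x) = x].
Proof.
move=> /unit_ballP z1.
have [L AL [h1 h2]] := neumann normE toeplitz_Cstar (toeplitz_mulz z)
  (introT andP (conj (bnorm_ge0 z) z1)) (mulz_le z).
suff -> : res z = L by [].
(* [op_inv] picks a preimage by choice; the left inverse [h2] shows that it is unique, equal to
   [L y]. *)
apply/funext => y; rewrite /res /op_inv.
case: xgetP => [x _ /= hx|/(_ (L y))]; first by rewrite -(h2 x) -hx.
by case; exact: h1.
Qed.

Lemma ev_res z f u : unit_ball z -> ev (res z f) u = ev f u / (1 - bilin z (val u)).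
Proof.
move=> hz; have [_ h _] := resP hz.
rewrite -{2}(h f) evB ev_mulz.
have : 1 - bilin z (val u) != 0 by apply/one_sub_neq0/bilin_lt1 => //; exact: valB.
by move: (bilin _ _) (ev _ _) => a b ha; field.
Qed.

Lemma res_le z x : unit_ball z -> nrm (res z x) <= nrm x / (1 - bnorm z).
Proof.
move=> hz; have [_ h _] := resP hz; move/unit_ballP : hz => hz.
rewrite ler_pdivlMr ?subr_gt0 //.
have : nrm (res z x) <= nrm x + nrm (mulz z (res z x)).
  by rewrite -{1}(subrK (mulz z (res z x)) (res z x)) h nrmD.
have := mulz_le z (res z x); lra.
Qed.

Lemma toeplitz_herglotz z : unit_ball z -> toeplitz_algebra H (herglotz_op H z).
Proof.
move=> hz; rewrite herglotz_opE; have [A _ _] := resP hz.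
exact: (alg_sub toeplitz_Cstar (alg_scale toeplitz_Cstar _ A) (alg_id toeplitz_Cstar)).
Qed.

End DruryArvesonTheory.

(** * Positive kernels and the Fock space *)

Section PsdKernels.
Context {R : realType} {X : Type}.
Local Notation C := R[i].
Implicit Types K L : X -> X -> C.

Lemma psd_seq K (l : seq (C * X)) : psd_kernel K ->
  0 <= \sum_(p <- l) \sum_(q <- l) p.1 * q.1^* * K p.2 q.2.
Proof.
move=> hK; have := hK (size l) (fun i => (tnth (in_tuple l) i).2)
  (fun i => (tnth (in_tuple l) i).1).
congr (0 <= _); rewrite [RHS]big_tnth; apply: eq_bigr => i _.
by rewrite [RHS]big_tnth.
Qed.

Lemma psd_gram (S : Type) (s : seq S) (F : X -> S -> C) :
  psd_kernel (fun x y => \sum_(t <- s) F x t * (F y t)^*).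
Proof.
move=> n x a.
have -> : \sum_i \sum_j a i * (a j)^* * (\sum_(t <- s) F (x i) t * (F (x j) t)^*) =
    \sum_(t <- s) (\sum_i a i * F (x i) t) * (\sum_i a i * F (x i) t)^*.
  under [RHS]eq_bigr do rewrite rmorph_sum big_distrlr /=.
  rewrite [RHS]exchange_big /=; apply: eq_bigr => i _.
  rewrite [RHS]exchange_big /=; apply: eq_bigr => j _.
  by rewrite mulr_sumr; apply: eq_bigr => t _; rewrite rmorphM /=; ring.
by apply: sumr_ge0 => t _; exact: mulcJ_ge0.
Qed.

Lemma psd_add K L : psd_kernel K -> psd_kernel L -> psd_kernel (fun x y => K x y + L x y).
Proof.
move=> hK hL n x a; have := addr_ge0 (hK n x a) (hL n x a).
congr (0 <= _); rewrite -big_split; apply: eq_bigr => i _.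
by rewrite -big_split; apply: eq_bigr => j _; rewrite mulrDr.
Qed.

Lemma psd_conj K (g : X -> C) : psd_kernel K ->
  psd_kernel (fun x y => g x * (g y)^* * K x y).
Proof.
move=> hK n x a; have := hK n x (fun i => a i * g (x i)).
congr (0 <= _); apply: eq_bigr => i _; apply: eq_bigr => j _.
by rewrite rmorphM /=; ring.
Qed.

Lemma psd_limit (KN : nat -> X -> X -> C) K :
  (forall N, psd_kernel (KN N)) ->
  (forall x y (e : R), 0 < e -> \forall N \near \oo, nrm (KN N x y - K x y) < e) ->
  psd_kernel K.
Proof.
move=> hN hlim n x a.
pose q (L : X -> X -> C) := \sum_i \sum_j a i * (a j)^* * L (x i) (x j).
pose M : R := \sum_i \sum_j nrm (a i) * nrm (a j).
have M0 : 0 <= M by apply: sumr_ge0 => i _; apply: sumr_ge0 => j _; rewrite mulr_ge0 ?nrm_ge0.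
have key (e : R) : 0 < e -> exists N, nrm (q (KN N) - q K) <= M * e.
  move=> e0.
  have : \forall N \near \oo, forall p : 'I_n * 'I_n,
      nrm (KN N (x p.1) (x p.2) - K (x p.1) (x p.2)) < e.
    by apply: filter_forall => p; exact: hlim.
  move=> [N _ hNN]; exists N; have {}hNN := hNN N (leqnn N).
  rewrite /q -sumrB; apply: le_trans (nrm_sum _ _ _) _; rewrite mulr_suml.
  apply: ler_sum => i _; rewrite -sumrB; apply: le_trans (nrm_sum _ _ _) _.
  rewrite mulr_suml; apply: ler_sum => j _.
  rewrite -mulrBr !nrmM nrm_conj ler_wpM2l ?mulr_ge0 ?nrm_ge0 //.
  by apply/ltW/(hNN (i, j)).
rewrite -/(q K) ge0cE; apply/andP; split.
  rewrite -normr_eq0 eq_le normr_ge0 andbT.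
  apply: (@le_eps _ _ _ M) => // e e0; have [N h] := key e e0.
  have := absIm_le_nrm (q (KN N) - q K).
  rewrite ImD ImN (ger0_Im (hN N n x a)) sub0r normrN; lra.
apply: (@le_eps _ _ _ M) => // e e0; have [N h] := key e e0.
have := Re_le_nrm (q (KN N) - q K); rewrite ReD ReN.
by have := hN N n x a; rewrite ge0cE => /andP[_]; rewrite -/(q _); lra.
Qed.

End PsdKernels.

Section GeometricDecay.
Context {R : realType}.
Local Notation C := R[i].

Definition geo (s : R) (u : nat -> C) := exists2 c : R, 0 <= c & forall n, nrm (u n) <= c * s ^+ n.

Lemma geoD (s : R) (u v : nat -> C) : geo s u -> geo s v -> geo s (fun n => u n + v n).
Proof.
move=> [c c0 hc] [d d0 hd]; exists (c + d); first exact: addr_ge0.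
by move=> n; rewrite (le_trans (nrmD _ _)) // mulrDl lerD.
Qed.

Lemma geoZ (s : R) (k : C) (u : nat -> C) : geo s u -> geo s (fun n => k * u n).
Proof.
move=> [c c0 hc]; exists (nrm k * c); first by rewrite mulr_ge0 ?nrm_ge0.
by move=> n; rewrite nrmM -mulrA ler_wpM2l ?nrm_ge0.
Qed.

(** The strict inequality r < s makes d / (s - r) meaningful; with equal rates a factor n could
    appear. *)
Lemma geo_rec (r s : R) (k : C) (u x : nat -> C) : nrm k <= r -> r < s -> geo s x ->
  (forall n, u n.+1 = k * u n + x n) -> geo s u.
Proof.
move=> kr rs [d d0 hd] hu.
have r0 : 0 <= r by apply: le_trans (nrm_ge0 k) kr.
have s0 : 0 < s by apply: le_lt_trans r0 rs.
exists (nrm (u 0) + d / (s - r)).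
  by rewrite addr_ge0 ?nrm_ge0 // divr_ge0 // subr_ge0 ltW.
elim=> [|n ih]; first by rewrite expr0 mulr1 lerDl divr_ge0 // subr_ge0 ltW.
rewrite hu (le_trans (nrmD _ _)) // nrmM.
have h1 : nrm k * nrm (u n) <= r * ((nrm (u 0) + d / (s - r)) * s ^+ n).
  by rewrite ler_pM ?nrm_ge0.
apply: le_trans (lerD h1 (hd n)) _.
have -> : r * ((nrm (u 0) + d / (s - r)) * s ^+ n) + d * s ^+ n =
  (r * nrm (u 0) + d / (s - r) * s) * s ^+ n by field; lra.
rewrite exprS mulrA ler_wpM2r ?exprn_ge0 ?(ltW s0) // mulrDl lerD2r.
by rewrite [_ * s]mulrC ler_wpM2r ?nrm_ge0 ?(ltW rs).
Qed.

Lemma geo_pow (s : R) (b : C) : nrm b <= s -> geo s (fun n => b ^+ n).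
Proof.
by move=> bs; exists 1 => // n; rewrite mul1r nrmX lerXn2r ?nnegrE ?nrm_ge0 // (le_trans (nrm_ge0 b)).
Qed.

Lemma geo_lim (s : R) (u : nat -> C) : 0 <= s < 1 -> geo s u ->
  forall e, 0 < e -> \forall N \near \oo, nrm (u N) < e.
Proof.
move=> s01 [c c0 hc] e e0.
have : 0 < e / (c + 1) by rewrite divr_gt0 // ltr_wpDl.
move=> /(exp_lt_eps s01)[N hN]; exists N => // n /= Nn.
apply: le_lt_trans (hc n) _; have := hN n Nn; rewrite ltr_pdivlMr ?ltr_wpDl //.
have /andP[s0 _] := s01; have := exprn_ge0 n s0; move: (s ^+ n) => t; nra.
Qed.

End GeometricDecay.

(** * Gram kernels in the full Fock space *)

Section Fock.
Context {R : realType} {d : nat}.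
Local Notation C := R[i].
Local Notation B := (set_type (@unit_ball R d)).
Implicit Types (z w : 'rV[C]_d).

Fixpoint words (n : nat) : seq (seq 'I_d) :=
  if n is m.+1 then [seq i :: s | i <- enum 'I_d, s <- words m] else [:: [::]].

Lemma words0 (V : zmodType) (F : seq 'I_d -> V) : \sum_(s <- words 0) F s = F [::].
Proof. by rewrite big_seq1. Qed.

Lemma wordsS n (V : zmodType) (F : seq 'I_d -> V) :
  \sum_(s <- words n.+1) F s = \sum_(i < d) \sum_(s <- words n) F (i :: s).
Proof. by rewrite /= big_allpairs_dep big_enum. Qed.

Definition monom z (s : seq 'I_d) : C := \prod_(i <- s) z 0 i.

Lemma words_herm n z w :
  \sum_(s <- words n) monom z s * (monom w s)^* = herm z w ^+ n.
Proof.
elim: n => [|n ih]; first by rewrite words0 /monom !big_nil rmorph1 mulr1.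
rewrite wordsS exprS -ih /herm mulr_suml; apply: eq_bigr => i _.
rewrite mulr_sumr; apply: eq_bigr => s _.
by rewrite /monom !big_cons rmorphM /=; ring.
Qed.

(* The coefficients of [\sum_(m, n) z^{(x) m} (x) (conj u)^{(x) n}] in the full Fock space. *)
Fixpoint fock z (u : 'rV[C]_d) (s : seq 'I_d) : C :=
  if s is i :: t then (monom u s)^* + z 0 i * fock z u t else 1.

Lemma fock_gram_psd N : psd_kernel (fun p q : B * B =>
  \sum_(n < N) \sum_(s <- words n)
    fock (val p.1) (val p.2) s * (fock (val q.1) (val q.2) s)^*).
Proof.
elim: N => [|N ih].
  by move=> n x a; rewrite big1 // => i _; rewrite big1 // => j _; rewrite big_ord0 mulr0.
have := psd_add ih (psd_gram (words N) (fun (p : B * B) s => fock (val p.1) (val p.2) s)).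
by congr psd_kernel; apply/funext => p; apply/funext => q; rewrite big_ord_recr.
Qed.

Lemma fock_psd : psd_kernel (fun p q : B * B =>
  ((1 - bilin (val p.1) (val q.2))^-1 + (1 - (bilin (val q.1) (val p.2))^*)^-1 - 1) /
  ((1 - herm (val p.1) (val q.1)) * (1 - herm (val q.2) (val p.2)))).
Proof.
apply: psd_limit fock_gram_psd _ => -[[z hz] [u hu]] [[w hw] [v hv]] /=.
move: hz hu hw hv; rewrite !inE => hz hu hw hv.
have ha := bilin_lt1 hz hv; have hc := bilin_lt1 hw hu.
have hA := herm_lt1 hz hw; have hb := herm_lt1 hv hu.
rewrite -nrm_conj in hc.
(* Removing the first letter of the words of length n + 1 turns the level sums into a triangular
   system of linear recursions, with ratios bilin z v for X, the conjugate of bilin w u for Y and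
   herm z w for G, all of modulus below 1. *)
pose X n := \sum_(s <- words n) fock z u s * monom v s.
pose Y n := \sum_(s <- words n) (monom u s)^* * (fock w v s)^*.
pose G n := \sum_(s <- words n) fock z u s * (fock w v s)^*.
pose P n := \sum_(s <- words n) (monom u s)^* * monom v s.
have PE n : P n = herm v u ^+ n.
  by rewrite -words_herm; apply: eq_bigr => s _; rewrite mulrC.
have XS n : X n.+1 = bilin z v * X n + herm v u ^+ n.+1.
  rewrite -PE /X /P !wordsS /bilin mulr_suml -big_split; apply: eq_bigr => i _ /=.
  rewrite mulr_sumr -big_split; apply: eq_bigr => s _ /=.
  by rewrite /monom !big_cons; ring.
have YS n : Y n.+1 = (bilin w u)^* * Y n + herm v u ^+ n.+1.
  rewrite -PE /Y /P !wordsS /bilin rmorph_sum mulr_suml -big_split; apply: eq_bigr => i _ /=.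
  rewrite mulr_sumr -big_split; apply: eq_bigr => s _ /=.
  by rewrite /monom !big_cons !(rmorphD, rmorphM) /= !conjCK; ring.
have GS n : G n.+1 = herm z w * G n +
    (herm v u ^+ n.+1 + (bilin z v * X n + (bilin w u)^* * Y n)).
  rewrite -PE /G /X /Y /P !wordsS /bilin /herm rmorph_sum !mulr_suml -!big_split.
  apply: eq_bigr => i _ /=.
  rewrite !mulr_sumr -!big_split; apply: eq_bigr => s _ /=.
  by rewrite /monom !big_cons !(rmorphD, rmorphM) /= !conjCK; ring.
move: (bilin z v) (bilin w u)^* (herm z w) (herm v u) ha hc hA hb XS YS GS => a c h b ha hc hA hb XS YS GS.
pose r := Num.max (Num.max (nrm a) (nrm c)) (Num.max (nrm h) (nrm b)).
have ar : nrm a <= r by rewrite !le_max lexx.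
have cr : nrm c <= r by rewrite !le_max lexx !orbT.
have hr : nrm h <= r by rewrite !le_max lexx !orbT.
have br : nrm b <= r by rewrite !le_max lexx !orbT.
have r1 : r < 1 by rewrite !gt_max ha hc hA hb.
have r0 : 0 <= r by apply: le_trans ar; exact: nrm_ge0.
pose s := (r + 1) / 2.
have rs : r < s by rewrite /s; lra.
have s01 : 0 <= s < 1 by apply/andP; split; rewrite /s; lra.
have gb : geo s (fun n => b ^+ n) by apply: geo_pow; rewrite (le_trans br) // ltW.
have gb1 : geo s (fun n => b ^+ n.+1).
  have [k k0 hk] := geoZ b gb; exists k => // n; rewrite exprS; exact: hk.
have gX : geo s X by exact: geo_rec ar rs gb1 XS.
have gY : geo s Y by exact: geo_rec cr rs gb1 YS.
have gG : geo s G.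
  by apply: geo_rec hr rs _ GS; apply: geoD gb1 _; apply: geoD; exact: geoZ.
have a1 := one_sub_neq0 ha; have c1 := one_sub_neq0 hc.
have h1 := one_sub_neq0 hA; have b1 := one_sub_neq0 hb.
(* Closed form of the remainder as a combination of N-th terms, obtained by summing the three
   recursions; it tends to 0 with these terms. *)
have E N : \sum_(n < N) G n - ((1 - a)^-1 + (1 - c)^-1 - 1) / ((1 - h) * (1 - b)) =
   - (1 - h)^-1 * G N + (- (a / ((1 - a) * (1 - h))) * X N + (- (c / ((1 - c) * (1 - h))) * Y N
    + - (b * ((1 - a)^-1 + (1 - c)^-1 - 1) / ((1 - h) * (1 - b))) * b ^+ N)).
  elim: N => [|N ih].
    rewrite big_ord0 expr0 /G /X /Y !words0 /monom !big_nil !rmorph1 !mulr1.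
    by field; rewrite a1 c1 h1 b1.
  rewrite big_ord_recr /= addrAC ih GS XS YS exprS.
  by field; rewrite a1 c1 h1 b1.
move=> e e0.
have := geo_lim s01 (geoD (geoZ (- (1 - h)^-1) gG) (geoD (geoZ (- (a / ((1 - a) * (1 - h)))) gX)
  (geoD (geoZ (- (c / ((1 - c) * (1 - h)))) gY)
   (geoZ (- (b * ((1 - a)^-1 + (1 - c)^-1 - 1) / ((1 - h) * (1 - b)))) gb)))) e0.
by apply: filterS => N; rewrite -E.
Qed.

End Fock.

(** * Complex differentiability from a quadratic remainder *)

Section Differentiability.
Context {R : realType}.
Local Notation C := R[i].

Lemma differentiable_of_quadratic (V : normedModType C) (f L : V -> C) (x : V) (K c r : R) :
  linear L -> (forall h, nrm (L h) <= K * nrm h) -> 0 <= K -> 0 <= c -> 0 < r ->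
  (forall h, nrm h < r -> nrm (f (h + x) - f x - L h) <= c * nrm h ^+ 2) ->
  differentiable f x.
Proof.
move=> linL bL K0 c0 r0 hf.
pose g : {linear V -> C} := HB.pack L (GRing.isLinear.Build _ _ _ _ L linL).
have cg : continuous g.
  move=> y; apply/cvgrPdist_lt => e e0.
  have er : e = (complex.Re e)%:C%C by apply: ge0c_Re; exact: ltW.
  move: (complex.Re e) er => t er; subst e; rewrite ltcR in e0.
  apply/nbhs_ballP; exists (t / (K + 1))%:C%C => /=.
    by rewrite ltcR divr_gt0 // ltr_wpDl.
  move=> z; rewrite -ball_normE /ball_/= -[L y]/(g y) -[L z]/(g z) -raddfB !nrmE !ltcR => yz.
  rewrite (le_lt_trans (bL _)) //.
  move: yz; rewrite ltr_pdivlMr ?ltr_wpDl //.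
  have := nrm_ge0 (y - z); lra.
have E : f \o shift x = cst (f x) + g +o_ 0 id.
  apply/eqaddoP => e e0.
  have er : e = (complex.Re e)%:C%C by apply: ge0c_Re; exact: ltW.
  move: (complex.Re e) er => t er; subst e; rewrite ltcR in e0.
  apply/nbhs_ballP; exists (Num.min r (t / (c + 1)))%:C%C => /=.
    by rewrite ltcR lt_min r0 divr_gt0 // ltr_wpDl.
  move=> h; rewrite -ball_normE /ball_/= sub0r normrN nrmE ltcR lt_min => /andP[hr ht].
  rewrite !nrmE -rmorphM lecR.
  have -> : (f \o shift x - (cst (f x) + g)) h = f (h + x) - f x - L h.
    by rewrite -[LHS]/(f (h + x) - (f x + L h)) opprD addrA.
  rewrite (le_trans (hf h hr)) // expr2 mulrA ler_wpM2r ?nrm_ge0 //.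
  move: ht; rewrite ltr_pdivlMr ?ltr_wpDl //; have := nrm_ge0 h; lra.
apply/diff_locallyP; have -> := diff_unique cg E; split => //.
Qed.

End Differentiability.

Section BallNorm.
Context {R : realType} {d : nat}.
Local Notation C := R[i].
Implicit Types (z w : 'rV[C]_d).

Lemma bnormD z w : bnorm (z + w) <= bnorm z + bnorm w.
Proof.
rewrite -(@ler_pXn2r _ 2) ?nnegrE ?addr_ge0 ?bnorm_ge0 //.
rewrite sqrrD !bnorm2.
have h1 : \sum_j nrm ((z + w) 0 j) ^+ 2 <= \sum_j (nrm (z 0 j) ^+ 2 + nrm (w 0 j) ^+ 2
    + 2 * (nrm (z 0 j) * nrm (w 0 j))).
  apply: ler_sum => j _; rewrite mxE.
  have := nrmD (z 0 j) (w 0 j); have := nrm_ge0 (z 0 j + w 0 j); nra.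
apply: le_trans h1 _; rewrite big_split /= -mulr_sumr big_split /= [leRHS]addrAC lerD2l.
rewrite -[X in _ <= X]mulr_natl ler_wpM2l //.
rewrite -(@ler_pXn2r _ 2) ?nnegrE ?mulr_ge0 ?bnorm_ge0 //.
  by rewrite exprMn !bnorm2; exact: cs_real.
by apply: sumr_ge0 => i _; rewrite mulr_ge0 ?nrm_ge0.
Qed.

Lemma nrm_coord z j : nrm (z 0 j) <= nrm z.
Proof.
rewrite -lecR -!nrmE [`|z|]mx_normE -[leLHS]nngE num_le.
exact: (le_bigmax _ (fun i : 'I_1 * 'I_d => `|z i.1 i.2|%:nng) (0, j)).
Qed.

Lemma bnorm_le_nrm z : bnorm z <= Num.sqrt d%:R * nrm z.
Proof.
rewrite -(@ler_pXn2r _ 2) ?nnegrE ?bnorm_ge0 ?mulr_ge0 ?sqrtr_ge0 ?nrm_ge0 //.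
rewrite bnorm2 exprMn sqr_sqrtr ?ler0n //.
apply: le_trans (_ : \sum_(j < d) nrm z ^+ 2 <= _).
  by apply: ler_sum => j _; rewrite ler_pXn2r ?nnegrE ?nrm_ge0 ?nrm_coord.
by rewrite sumr_const card_ord mulr_natl.
Qed.

End BallNorm.

(** * From R+ to S+ and O+ *)

Section RplusSplus.
Context {R : realType} {d : nat}.
Local Notation C := R[i].
Local Notation B := (set_type (@unit_ball R d)).
Variable H : rkhs (@da_kernel R d).
Local Notation dot := (rkhs_dot H).
Local Notation normE := (rkhs_normE (r := H)).
Local Notation ev := (@rkhs_eval _ _ _ H).
Local Notation ker := (@rkhs_ker _ _ _ H).
Local Notation T_d := (toeplitz_algebra H).
Local Notation TC := (toeplitz_Cstar H).
Variable rho : (H -> H) -> C.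
Hypothesis rhoP : positive_functional dot T_d rho.

Let f z := rho (herglotz_op H z).

(** Second-order resolvent expansion. Evaluation at u turns [res z] into division by 1 - bilin z u
    and [mulz h] into multiplication, so it becomes an identity of rational functions. *)
Lemma herglotz_diff z h : unit_ball z -> unit_ball (h + z) -> forall x,
  herglotz_op H (h + z) x = herglotz_op H z x + 2 *: (res z (mulz h (res z x))
     + res (h + z) (mulz h (res z (mulz h (res z x))))).
Proof.
move=> hz hzh x; apply: evP => u; rewrite !herglotz_opE.
rewrite !(evB, evD, evZ, ev_res, ev_mulz) //.
have := one_sub_neq0 (bilin_lt1 hz (valB u)).
have := one_sub_neq0 (bilin_lt1 hzh (valB u)).
have -> : bilin (h + z) (val u) = bilin h (val u) + bilin z (val u).
  by rewrite /bilin -big_split; apply: eq_bigr => j _; rewrite mxE mulrDl.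
move: (bilin _ _) (bilin _ _) => a b h1 h2; field.
by rewrite h1 h2.
Qed.

Lemma mulz_lin a h k (x : H) : mulz (a *: h + k) x = a *: mulz h x + mulz k x.
Proof.
rewrite /mulz scaler_sumr -big_split; apply: eq_bigr => j _.
by rewrite !mxE scalerDl scalerA.
Qed.

(** The derivative at z is h -> 2 rho (RMR h). As [rho] is bounded for the operator norm, the
    remainder given by [herglotz_diff] is quadratic in h. *)
Lemma rho_herglotz_holomorphic (g : 'rV[C]_d -> C) (t : C) :
  (forall z, unit_ball z -> g z = f z + t) -> holomorphic g.
Proof.
move=> gE z hz; have [Az _ _] := resP H hz.
have z1 : bnorm z < 1 by apply/unit_ballP.
have bA T : T_d T -> bounded_op T := @alg_bounded _ _ _ _ TC T.
pose RMR h (x : H) := res z (mulz h (res z x)).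
have ARMR (h : 'rV[C]_d) : T_d (RMR h).
  exact: (alg_comp TC Az (alg_comp TC (toeplitz_mulz h) Az)).
pose L h := 2 * rho (RMR h).
have r0 := rho_id normE TC rhoP.
have rr0 : 0 <= complex.Re (rho id) by move: r0; rewrite ge0cE => /andP[].
set k := (1 - bnorm z)^-1.
have k0 : 0 <= k by rewrite invr_ge0 subr_ge0 ltW.
set D := Num.sqrt d%:R : R.
have D0 : 0 <= D by exact: sqrtr_ge0.
have n2 : nrm (2 : C) = 2 by exact: nrm_nat.
have resk (x : H) : nrm (res z x) <= k * nrm x by rewrite mulrC; exact: res_le.
have mulk (h : 'rV[C]_d) (x : H) : nrm (mulz h x) <= D * nrm h * nrm x.
  by rewrite (le_trans (mulz_le _ _)) // ler_wpM2r ?nrm_ge0 //; exact: bnorm_le_nrm.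
have bRMR (h : 'rV[C]_d) (x : H) : nrm (RMR h x) <= k * (D * nrm h) * k * nrm x.
  rewrite /RMR (le_trans (resk _)) // -!mulrA ler_wpM2l //.
  by rewrite (le_trans (mulk _ _)) // -mulrA ler_wpM2l // ler_wpM2l ?nrm_ge0.
apply: (@differentiable_of_quadratic _ _ g L z (2 * (2 * complex.Re (rho id) * (k * D * k)))
  (2 * (2 * complex.Re (rho id) * (2 * k * D * k * D * k))) ((1 - bnorm z) / (2 * (D + 1)))).
- move=> a h k'; rewrite /L.
  have -> : RMR (a *: h + k') = (fun x => a *: RMR h x + RMR k' x).
    apply/funext => x; rewrite /RMR mulz_lin (bopD _ _ (bA _ Az)).
    by rewrite (bopZ _ _ (bA _ Az)).
  by rewrite (rho_lin rhoP) // mulrDr mulrCA.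
- move=> h; rewrite /L nrmM n2 -mulrA ler_wpM2l // -[leRHS]mulrA.
  have -> : k * D * k * nrm h = k * (D * nrm h) * k by ring.
  by apply: (rho_bound normE TC rhoP); rewrite ?mulr_ge0 ?nrm_ge0.
- by rewrite !mulr_ge0.
- by rewrite !mulr_ge0.
- by rewrite divr_gt0 ?subr_gt0 // mulr_gt0 // ltr_wpDl.
move=> h hh.
(* This radius keeps 1 - |h + z| at least (1 - |z|) / 2, so the resolvent at h + z is bounded by 2
   k. *)
have bh : bnorm h <= (1 - bnorm z) / 2.
  rewrite (le_trans (bnorm_le_nrm h)) //.
  move: hh; rewrite ltr_pdivlMr; last by rewrite mulr_gt0 // ltr_wpDl.
  have := nrm_ge0 h; rewrite -/D; lra.
have bzh : bnorm (h + z) <= (1 + bnorm z) / 2.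
  by have := bnormD h z; lra.
have hzh : unit_ball (h + z) by apply/unit_ballP; lra.
have [Azh _ _] := resP H hzh.
pose Rem (x : H) := res (h + z) (mulz h (RMR h x)).
have ARem : T_d Rem.
  exact: (alg_comp TC Azh (alg_comp TC (toeplitz_mulz h) (ARMR h))).
have Hz := @toeplitz_herglotz _ _ H _ hz.
have -> : g (h + z) - g z - L h = 2 * rho Rem.
  rewrite !gE //; have -> : f (h + z) = f z + 2 * (rho (RMR h) + rho Rem).
    rewrite /f -(rho_add rhoP) // -(rho_scale TC rhoP); last exact: (alg_add TC).
    rewrite -(rho_add rhoP) //; last exact: (alg_scale TC _ (alg_add TC (ARMR h) ARem)).
    by congr rho; apply/funext => x; exact: herglotz_diff.
  by rewrite /L; ring.
rewrite nrmM n2 -mulrA ler_wpM2l //.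
have -> : 2 * complex.Re (rho id) * (2 * k * D * k * D * k) * nrm h ^+ 2 =
   2 * complex.Re (rho id) * (2 * k * (D * nrm h * (k * (D * nrm h) * k))) by ring.
apply: (rho_bound normE TC rhoP) => //; first by rewrite !mulr_ge0 ?nrm_ge0.
move=> x; rewrite /Rem (le_trans (res_le _ hzh)) // mulrC.
have hk : (1 - bnorm (h + z))^-1 <= 2 * k.
  have -> : 2 * k = ((1 - bnorm z) / 2)^-1 by rewrite invf_div.
  rewrite lef_pV2 ?posrE; lra.
rewrite -!mulrA [2 * (k * _)]mulrA ler_pM ?nrm_ge0 ?invr_ge0 ?subr_ge0 //.
  by apply/ltW/unit_ballP.
rewrite (le_trans (mulk _ _)) // -mulrA ler_wpM2l // ler_wpM2l ?nrm_ge0 //.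
by have := bRMR h x; rewrite -!mulrA.
Qed.

(** The density argument only gives inequalities for real parts; applied to i T and to - i T it also
    shows that the form is real. *)
Lemma dense_posop T : bounded_op T ->
  (forall s, 0 <= dot (T (kcomb H (fun=> 1) s)) (kcomb H (fun=> 1) s)) -> posop dot T.
Proof.
move=> bT hT x.
have bZ a : bounded_op (fun y => a *: T y).
  exact: (alg_scale (bounded_op_Cstar dot) a bT).
have Re0 : 0 <= complex.Re (dot (T x) x).
  by apply: dense_Re_ge0 => // s; have := hT s; rewrite ge0cE => /andP[].
have key a : complex.Re a = 0 -> 0 <= complex.Re (a * dot (T x) x).
  move=> a0; rewrite -dotZl; apply: (dense_Re_ge0 (bZ a)) => s.
  by rewrite dotZl ReM a0 (ger0_Im (hT s)) mulr0 mul0r subr0.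
have := key 'i%C erefl; have := key (- 'i%C) (oppr0 _).
rewrite !ReM !ReN !ImN /= => h1 h2.
by rewrite ge0cE Re0 andbT; apply/eqP; lra.
Qed.

Lemma dot_herglotz z s : unit_ball z ->
  dot (herglotz_op H z (kcomb H (fun=> 1) s)) (kcomb H (fun=> 1) s) =
  \sum_(p <- s) \sum_(q <- s) p.1 * q.1^* *
    ((2 / (1 - bilin z (val q.2)) - 1) / (1 - herm (val q.2) (val p.2))).
Proof.
move=> hz; have bH := alg_bounded TC (@toeplitz_herglotz _ _ H _ hz).
rewrite {1}/kcomb (bop_sum _ _ _ bH) dot_suml; apply: eq_bigr => p _.
rewrite /kcomb dot_sumr; apply: eq_bigr => q _.
rewrite (bopZ _ _ bH) dotZl dotZr -evE herglotz_opE evB evZ ev_res // evE dot_ker !mulr1.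
by ring.
Qed.

Lemma rho_herglotz_psd : psd_kernel (fun z w : B =>
  (f (val z) + (f (val w))^*) / (1 - herm (val z) (val w))).
Proof.
move=> n z c.
have AH i := @toeplitz_herglotz _ _ H _ (valB (z i)).
have /choice[Ha] : forall i, exists T, T_d T /\ adjoint dot (herglotz_op H (val (z i))) T.
  by move=> i; have [T AT hT] := alg_adjointP normE TC (AH i); exists T.
move=> hHa; have AHa i := (hHa i).1; have adj i := (hHa i).2.
pose k i j := c i * (c j)^* / (1 - herm (val (z i)) (val (z j))).
pose Q i j x := k i j *: (herglotz_op H (val (z i)) x + Ha j x).
have AQ i j : T_d (Q i j) by exact: (alg_scale TC _ (alg_add TC (AH i) (AHa j))).
have AS i : T_d (fun x => \sum_j Q i j x) by exact: (alg_sum TC).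
have -> : \sum_i \sum_j c i * (c j)^* *
    ((f (val (z i)) + (f (val (z j)))^*) / (1 - herm (val (z i)) (val (z j))))
    = rho (fun x => \sum_i \sum_j Q i j x).
  rewrite (rho_sum TC rhoP) //; apply: eq_bigr => i _.
  rewrite (rho_sum TC rhoP) //; apply: eq_bigr => j _.
  rewrite (rho_scale TC rhoP) ?(rho_add rhoP (AH i) (AHa j)) //; last exact: (alg_add TC).
  by rewrite (rho_adjoint normE TC rhoP (AH j) (adj j)) /k /f; ring.
apply: (rho_ge0 normE TC rhoP); first exact: (alg_sum TC).
apply: dense_posop; first by apply: (alg_bounded TC); exact: (alg_sum TC).
move=> s.
(* The kernel of [fock_psd] is tested at the pairs made of a point z_i and a point of the
   combination [s], with product coefficients. The factor 2 in the next line is that of H + H^* = 2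
   (res + res^* - 1). *)
pose l := [seq (c i * p.1, (z i, p.2)) | i <- enum 'I_n, p <- s].
have := mulr_ge0 (ler0n C 2) (psd_seq l (@fock_psd R d)).
congr (0 <= _).
rewrite dot_suml /l big_allpairs_dep big_enum mulr_sumr /=; apply: eq_bigr => i _.
rewrite dot_suml; apply: esym.
under [LHS]eq_bigr do rewrite dotZl dotDl.
transitivity (\sum_(j < n) k i j *
   (\sum_(p <- s) \sum_(q <- s) p.1 * q.1^* *
    ((2 / (1 - bilin (val (z i)) (val q.2)) - 1) / (1 - herm (val q.2) (val p.2))) +
   \sum_(p <- s) \sum_(q <- s) p.1 * q.1^* *
    ((2 / (1 - bilin (val (z j)) (val p.2))^* - 1) / (1 - herm (val q.2) (val p.2))))); last first.
  apply: esym; rewrite mulr_sumr.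
  under eq_bigr do rewrite big_allpairs_dep big_enum /= mulr_sumr.
  rewrite exchange_big /=; apply: eq_bigr => j _.
  rewrite -big_split mulr_sumr; apply: eq_bigr => p _.
  rewrite -big_split !mulr_sumr; apply: eq_bigr => q _ /=.
  have h1 := one_sub_neq0 (bilin_lt1 (valB (z i)) (valB q.2)).
  have h2 : 1 - (bilin (val (z j)) (val p.2))^* != 0.
    by apply: one_sub_neq0; rewrite nrm_conj; apply: bilin_lt1; exact: valB.
  have h3 := herm_neq0 q.2 p.2; have h4 := herm_neq0 (z i) (z j).
  rewrite /k !rmorphM rmorphB rmorph1 /=; field.
  by rewrite h1 h2 h3 h4.
apply: eq_bigr => j _; congr (_ * (_ + _)).
  by rewrite dot_herglotz //; exact: valB.
rewrite (adjoint_sym (adj j)) (dotC dot) dot_herglotz ?rmorph_sum; last exact: valB.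
under [LHS]eq_bigr do rewrite rmorph_sum.
rewrite [LHS]exchange_big /=; apply: eq_bigr => p _; apply: eq_bigr => q _.
rewrite !rmorphM /= conjCK.
rewrite !(rmorphB, rmorphM, fmorphV, rmorph1, rmorph_nat) /= -(hermC (val q.2)).
by ring.
Qed.

End RplusSplus.

Lemma Rplus_sub_Splus (R : realType) (d : nat) : Rplus R d `<=` Splus R d.
Proof.
move=> f [H [rho [t [rhoP fE]]]]; split.
  apply: (@rho_herglotz_holomorphic _ _ H rho rhoP f (0 +i* t)%C) => z hz; exact: fE.
move=> n z c; have := rho_herglotz_psd rhoP z c.
congr (0 <= _); apply: eq_bigr => i _; apply: eq_bigr => j _; congr (_ * (_ / _)).
rewrite !fE; [|exact: valB|exact: valB].
by apply: eq_ReIm; rewrite !(ReD, ImD, ReJ, ImJ) /=; ring.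
Qed.

Lemma Splus_sub_Oplus (R : realType) (d : nat) : Splus R d `<=` Oplus R d.
Proof.
move=> f [hol psd]; split => // z hz.
have zB : z \in @unit_ball R d by rewrite inE.
have := psd 1 (fun=> SigSub zB : set_type (@unit_ball R d)) (fun=> 1).
rewrite !big_ord1 rmorph1 !mul1r /=.
have -> : f z + (f z)^* = (2 * complex.Re (f z))%:C%C.
  by apply: eq_ReIm; rewrite !(ReD, ImD, ReJ, ImJ) /=; ring.
rewrite hermzz -[1 - _]/(1%:C%C - _) -rmorphB -fmorphV -rmorphM ler0c.
rewrite pmulr_lge0 ?pmulr_rge0 // invr_gt0 subr_gt0.
by rewrite expr_lt1 ?bnorm_ge0 //; apply/unit_ballP.
Qed.

(** * A model of the Drury-Arveson space *)

Section ComplexLimits.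
Context {R : realType}.
Local Notation C := R[i].
Implicit Types (u v : nat -> C) (k l : C).

Definition ccvg u l := (complex.Re (u n) @[n --> \oo] --> complex.Re l) /\
                       (complex.Im (u n) @[n --> \oo] --> complex.Im l).

Definition clim u : C := (limn (fun n => complex.Re (u n)) +i* limn (fun n => complex.Im (u n)))%C.

Lemma ccvg_clim u l : ccvg u l -> clim u = l.
Proof. by case: l => a b [h1 h2]; apply: eq_ReIm; apply/cvg_lim. Qed.

Lemma ccvgD u v k l : ccvg u k -> ccvg v l -> ccvg (fun n => u n + v n) (k + l).
Proof.
move=> [h1 h2] [h3 h4]; split.
  by under eq_fun do rewrite ReD; rewrite ReD; exact: cvgD.
by under eq_fun do rewrite ImD; rewrite ImD; exact: cvgD.
Qed.

Lemma ccvgM u v k l : ccvg u k -> ccvg v l -> ccvg (fun n => u n * v n) (k * l).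
Proof.
move=> [h1 h2] [h3 h4]; split.
  by under eq_fun do rewrite ReM; rewrite ReM; apply: cvgB; exact: cvgM.
by under eq_fun do rewrite ImM; rewrite ImM; apply: cvgD; exact: cvgM.
Qed.

Lemma ccvg_cst k : ccvg (fun=> k) k.
Proof. by split; exact: cvg_cst. Qed.

Lemma ccvgJ u k : ccvg u k -> ccvg (fun n => (u n)^*) k^*.
Proof.
move=> [h1 h2]; split.
  by under eq_fun do rewrite ReJ; rewrite ReJ.
by under eq_fun do rewrite ImJ; rewrite ImJ; exact: cvgN.
Qed.

Lemma ccvg_eps u l : (forall e : R, 0 < e -> \forall n \near \oo, nrm (u n - l) < e) ->
  ccvg u l.
Proof.
move=> h; split; apply/cvgrPdist_lt => e e0; move: (h e e0); apply: filterS => n hn.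
  by apply: le_lt_trans hn; rewrite distrC -ReN -ReD; exact: absRe_le_nrm.
by apply: le_lt_trans hn; rewrite distrC -ImN -ImD; exact: absIm_le_nrm.
Qed.

(** Both t and x + t are nondecreasing and bounded above, and x is the difference of the two. *)
Lemma dominated_cvg (x t : nat -> R) (M : R) :
  (forall n, `|x n.+1 - x n| <= t n.+1 - t n) -> (forall n, t n <= M) ->
  cvgn x.
Proof.
move=> hx ht.
have nt : nondecreasing_seq t.
  by apply/nondecreasing_seqP => n; rewrite -subr_ge0; apply: le_trans (hx n).
have ct : cvgn t by apply: nondecreasing_is_cvgn => //; exists M => _ [n _ <-].
have x0 n : `|x n - x 0| <= t n - t 0.
  elim: n => [|n ih]; first by rewrite !subrr normr0.
  rewrite -(subrK (x n) (x n.+1)) -addrA (le_trans (ler_normD _ _)) //.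
  by rewrite -(subrK (t n) (t n.+1)) -[leRHS]addrA lerD.
have cxt : cvgn (fun n => x n + t n).
  apply: nondecreasing_is_cvgn.
    apply/nondecreasing_seqP => n; have := hx n; rewrite ler_norml => /andP[h _]; lra.
  exists (x 0 - t 0 + M + M) => _ [n _ <-].
  have := x0 n; rewrite ler_norml => /andP[_ h]; have := ht n; lra.
have -> : x = (fun n => (x n + t n) - t n) by apply/funext => n; rewrite addrK.
exact: is_cvgB.
Qed.

Lemma dominated_ccvg u (t : nat -> R) (M : R) :
  (forall n, nrm (u n.+1 - u n) <= t n.+1 - t n) -> (forall n, t n <= M) ->
  ccvg u (clim u).
Proof.
move=> hu ht; split; apply: (@dominated_cvg _ t M) => // n;
  apply: le_trans (hu n); rewrite -?ReN -?ReD -?ImN -?ImD.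
  exact: absRe_le_nrm.
exact: absIm_le_nrm.
Qed.

End ComplexLimits.

(** * Square-summable families, summed along finite levels *)

Section SquareSummable.
Context {R : realType} {I : eqType}.
Local Notation C := R[i].
Variable L : nat -> seq I.
Hypothesis cover : forall i, exists n, i \in L n.
Implicit Types (x y z : I -> C).

Definition psum x y N : C := \sum_(n < N) \sum_(i <- L n) x i * (y i)^*.
Definition psq x N : R := \sum_(n < N) \sum_(i <- L n) nrm (x i) ^+ 2.
Definition l2 x := exists M, forall N, psq x N <= M.
Definition l2dot x y := clim (psum x y).

Lemma psum_psq x N : psum x x N = (psq x N)%:C%C.
Proof.
rewrite rmorph_sum; apply: eq_bigr => n _; rewrite rmorph_sum.
by apply: eq_bigr => i _; rewrite nrm_sqrC.
Qed.

(** The increments are dominated by those of psq x + psq y, since |x_i y_i| <= |x_i|^2 + |y_i|^2. *)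
Lemma l2_cvg x y : l2 x -> l2 y -> ccvg (psum x y) (l2dot x y).
Proof.
move=> [M hM] [K hK].
apply: (@dominated_ccvg _ _ (fun N => psq x N + psq y N) (M + K)) => [N|N]; last exact: lerD.
rewrite /psum /psq !big_ord_recr /= addrAC subrr add0r opprD addrACA.
rewrite [_ + _ - _]addrAC subrr add0r [_ + _ - _]addrAC subrr add0r -big_split /=.
apply: le_trans (nrm_sum _ _ _) _; apply: ler_sum => i _.
rewrite nrmM nrm_conj; have := sqr_ge0 (nrm (x i) - nrm (y i)).
have := mulr_ge0 (nrm_ge0 (x i)) (nrm_ge0 (y i)); rewrite sqrrB; lra.
Qed.

Lemma psum_lin a x y z N : psum (a *: x + y) z N = a * psum x z N + psum y z N.
Proof.
rewrite mulr_sumr -big_split; apply: eq_bigr => n _; rewrite mulr_sumr -big_split.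
apply: eq_bigr => i _ /=.
have -> : (a *: x + y) i = a * x i + y i by [].
by ring.
Qed.

Lemma psumC x y N : psum x y N = (psum y x N)^*.
Proof.
rewrite rmorph_sum; apply: eq_bigr => n _; rewrite rmorph_sum; apply: eq_bigr => i _.
by rewrite rmorphM /= conjCK mulrC.
Qed.

Lemma l2_lin a x y : l2 x -> l2 y -> l2 (a *: x + y).
Proof.
move=> [M hM] [K hK]; exists (2 * (nrm a ^+ 2 * M + K)) => N.
have M0 : 0 <= M by have := hM 0; rewrite /psq big_ord0.
apply: (@le_trans _ _ (2 * (nrm a ^+ 2 * psq x N + psq y N))); last first.
  by rewrite ler_wpM2l // lerD // ler_wpM2l // exprn_ge0 // nrm_ge0.
rewrite /psq [nrm a ^+ 2 * _]mulr_sumr -big_split mulr_sumr; apply: ler_sum => n _.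
rewrite [nrm a ^+ 2 * _]mulr_sumr -big_split mulr_sumr; apply: ler_sum => i _ /=.
have -> : (a *: x + y) i = a * x i + y i by [].
have := nrmD (a * x i) (y i); have := nrm_ge0 (a * x i + y i).
have := sqr_ge0 (nrm (a * x i) - nrm (y i)).
rewrite -exprMn -nrmM; move: (nrm (a * x i)) (nrm (y i)) (nrm _) => p q r; nra.
Qed.

Lemma l2_0 : l2 0.
Proof.
exists 0 => N; rewrite /psq big1 // => n _; rewrite big1 // => i _.
by rewrite nrm0 expr0n.
Qed.

Lemma l2dot_lin a x y z : l2 x -> l2 y -> l2 z ->
  l2dot (a *: x + y) z = a * l2dot x z + l2dot y z.
Proof.
move=> hx hy hz; apply: ccvg_clim.
have := ccvgD (ccvgM (ccvg_cst a) (l2_cvg hx hz)) (l2_cvg hy hz).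
by under eq_fun do rewrite -psum_lin.
Qed.

Lemma l2dotC x y : l2 x -> l2 y -> l2dot x y = (l2dot y x)^*.
Proof.
move=> hx hy; apply: ccvg_clim; have := ccvgJ (l2_cvg hy hx).
by under eq_fun do rewrite -psumC.
Qed.

Lemma l2dot_cvg x : l2 x -> psq x N @[N --> \oo] --> complex.Re (l2dot x x).
Proof.
by move=> hx; have [h _] := l2_cvg hx hx; under eq_fun do rewrite -[psq x _]/(complex.Re (psq x _)%:C%C) -psum_psq.
Qed.

Lemma psq_le x N : l2 x -> psq x N <= complex.Re (l2dot x x).
Proof.
move=> hx; have := l2dot_cvg hx => /cvg_lim <- //.
apply: nondecreasing_cvgn_le; last by apply/cvg_ex; exists (complex.Re (l2dot x x)); exact: l2dot_cvg.
apply/nondecreasing_seqP => n; rewrite /psq big_ord_recr lerDl sumr_ge0 // => i _.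
exact: sqr_ge0.
Qed.

Lemma l2dot_le x (M : R) : l2 x -> (forall N, psq x N <= M) -> complex.Re (l2dot x x) <= M.
Proof.
move=> hx hM; apply: (cvgr_to_le (l2dot_cvg hx)).
by apply: nearW.
Qed.

Lemma l2dot_ge0 x : l2 x -> 0 <= l2dot x x.
Proof.
move=> hx; rewrite ge0cE; apply/andP; split.
  by have := congr1 (@complex.Im R) (l2dotC hx hx); rewrite ImJ => h; apply/eqP; lra.
by have := psq_le 0 hx; rewrite /psq big_ord0.
Qed.

Lemma l2_coord x i : l2 x -> nrm (x i) ^+ 2 <= complex.Re (l2dot x x).
Proof.
move=> hx; have [n iL] := cover i; apply: le_trans (psq_le n.+1 hx).
rewrite /psq big_ord_recr /= (big_rem i) //=.
rewrite addrCA lerDl addr_ge0 //.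
  by apply: sumr_ge0 => j _; apply: sumr_ge0 => k _; exact: sqr_ge0.
by apply: sumr_ge0 => k _; exact: sqr_ge0.
Qed.

Lemma l2dot_eq0 x : l2 x -> complex.Re (l2dot x x) = 0 -> x = 0.
Proof.
move=> hx x0; apply/funext => i; apply: nrm0_eq0; apply/eqP.
by rewrite -sqrf_eq0 eq_le sqr_ge0 andbT -x0 l2_coord.
Qed.

Lemma l2dot_linr a x y z : l2 x -> l2 y -> l2 z ->
  l2dot z (a *: x + y) = a^* * l2dot z x + l2dot z y.
Proof.
move=> hx hy hz; rewrite (l2dotC hz (l2_lin a hx hy)) l2dot_lin //.
by rewrite rmorphD rmorphM /= (l2dotC hz hx) (l2dotC hz hy).
Qed.

Lemma l2_CS x y : l2 x -> l2 y ->
  nrm (l2dot x y) ^+ 2 <= complex.Re (l2dot x x) * complex.Re (l2dot y y).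
Proof.
move=> hx hy; rewrite mulrC; apply: hermitian_disc => [|a].
  by have := l2dot_ge0 hx; rewrite ge0cE => /andP[].
have hxy := l2_lin a hx hy.
have := l2dot_ge0 hxy; rewrite ge0cE => /andP[_].
rewrite l2dot_lin // !l2dot_linr // (l2dotC hy hx).
have -> : a * (a^* * l2dot x x + l2dot x y) = (nrm a ^+ 2)%:C%C * l2dot x x + a * l2dot x y.
  by rewrite mulrDr mulrA nrm_sqrC.
rewrite -rmorphM !ReD ReJ ReRM; lra.
Qed.

End SquareSummable.

(** * The Drury-Arveson space inside the full Fock space *)

Section Model.
Context {R : realType} {d : nat}.
Local Notation C := R[i].
Local Notation word := (seq 'I_d).
Local Notation L := (@words d).
Implicit Types (z w : 'rV[C]_d).

Lemma words_cover (s : word) : exists n, s \in L n.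
Proof.
exists (size s); elim: s => [|i s ih] /=; first by rewrite inE.
by apply/allpairsP; exists (i, s); rewrite mem_enum.
Qed.

(** With the conjugate, pairing [feature w] with [feature z] gives the sum of the powers of <z,w>,
    which is the kernel at (z, w). *)
Definition feature z : word -> C := fun s => (monom z s)^*.

Lemma psum_feature w z N : psum L (feature w) (feature z) N = \sum_(n < N) herm z w ^+ n.
Proof.
apply: eq_bigr => n _; rewrite -words_herm; apply: eq_bigr => s _.
by rewrite /feature conjCK mulrC.
Qed.

Lemma geometric_sum (a : C) N : nrm a < 1 ->
  \sum_(n < N) a ^+ n - (1 - a)^-1 = - (1 - a)^-1 * a ^+ N.
Proof.
move=> a1; have h := one_sub_neq0 a1.
elim: N => [|N ih]; first by rewrite big_ord0 expr0 sub0r mulr1.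
by rewrite big_ord_recr /= addrAC ih exprS; field.
Qed.

Lemma geometric_cvg (a : C) : nrm a < 1 -> ccvg (fun N => \sum_(n < N) a ^+ n) (1 - a)^-1.
Proof.
move=> a1; apply: ccvg_eps => e e0.
under eq_near do rewrite geometric_sum //.
apply: (@geo_lim _ (nrm a)) => //; first by rewrite nrm_ge0.
by apply: geoZ; exact: geo_pow.
Qed.

Lemma l2_feature z : unit_ball z -> l2 L (feature z).
Proof.
move=> hz; have h := herm_lt1 hz hz; move: (h); rewrite hermzz nrmR ger0_norm ?sqr_ge0 // => b1.
exists (1 - bnorm z ^+ 2)^-1 => N.
have := congr1 (@complex.Re R) (psum_psq L (feature z) N).
rewrite /= psum_feature => <-.
have -> : \sum_(n < N) herm z z ^+ n = (\sum_(n < N) herm z z ^+ n - (1 - herm z z)^-1) + (1 - herm z z)^-1.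
  by rewrite subrK.
rewrite geometric_sum // hermzz -[1 - _]/(1%:C%C - _) -rmorphB -fmorphV -rmorphXn.
rewrite -rmorphN -rmorphM -rmorphD /= gerDr mulNr oppr_le0 mulr_ge0 //.
  by rewrite invr_ge0 subr_ge0 ltW.
by rewrite exprn_ge0 // sqr_ge0.
Qed.

Lemma l2dot_feature w z : unit_ball w -> unit_ball z ->
  l2dot L (feature w) (feature z) = (1 - herm z w)^-1.
Proof.
move=> hw hz; apply: ccvg_clim; have := geometric_cvg (herm_lt1 hz hw).
by under eq_fun do rewrite -psum_feature.
Qed.

Definition l2_null y := l2 L y /\ forall z, unit_ball z -> l2dot L y (feature z) = 0.

(* The orthogonal complement of the vectors invisible to evaluation, so that
   evaluation becomes injective. *)
Definition in_da : pred (word -> C) :=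
  fun x => `[< l2 L x /\ forall y, l2_null y -> l2dot L x y = 0 >].

Lemma in_da_submod : submod_closed in_da.
Proof.
split.
  apply/asboolP; split => [|y [hy _]]; first exact: l2_0.
  have h0 := @l2_0 R word L.
  have := l2dot_lin (-1) h0 h0 hy; rewrite scaler0 addr0 mulN1r addNr; exact.
move=> a x y /asboolP[hx ox] /asboolP[hy oy]; apply/asboolP; split; first exact: l2_lin.
by move=> v nv; have [hv _] := nv; rewrite l2dot_lin // ox // oy // mulr0 addr0.
Qed.

HB.instance Definition _ := GRing.isSubmodClosed.Build C (word -> C) in_da in_da_submod.

Definition da_space := {x : word -> C | in_da x}.
HB.instance Definition _ := SubChoice.on da_space.
HB.instance Definition _ := [SubChoice_isSubLmodule of da_space by <:].

Lemma da_l2 (x : da_space) : l2 L (val x).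
Proof. by have /asboolP[] := valP x. Qed.

Definition da_dot (x y : da_space) : C := l2dot L (val x) (val y).

Definition da_norm (x : da_space) : R := Num.sqrt (complex.Re (da_dot x x)).

Lemma da_dot_real x : da_dot x x = (complex.Re (da_dot x x))%:C%C.
Proof. exact/ge0c_Re/l2dot_ge0/da_l2. Qed.

Lemma da_dot_Re_ge0 x : 0 <= complex.Re (da_dot x x).
Proof. by have := l2dot_ge0 (da_l2 x); rewrite ge0cE => /andP[]. Qed.

Lemma da_norm2 x : da_norm x ^+ 2 = complex.Re (da_dot x x).
Proof. by rewrite sqr_sqrtr ?da_dot_Re_ge0. Qed.

Lemma da_dot_lin a (x y v : da_space) : da_dot (a *: x + y) v = a * da_dot x v + da_dot y v.
Proof. by rewrite /da_dot -l2dot_lin //; exact: da_l2. Qed.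

Lemma da_dot_linr a (x y v : da_space) : da_dot v (a *: x + y) = a^* * da_dot v x + da_dot v y.
Proof. by rewrite /da_dot -l2dot_linr //; exact: da_l2. Qed.

Lemma da_dotC (x y : da_space) : da_dot x y = (da_dot y x)^*.
Proof. by rewrite /da_dot l2dotC //; exact: da_l2. Qed.

Lemma da_CS x y : nrm (da_dot x y) <= da_norm x * da_norm y.
Proof.
rewrite -(@ler_pXn2r _ 2) ?nnegrE ?nrm_ge0 ?mulr_ge0 ?sqrtr_ge0 // exprMn !da_norm2.
by apply: l2_CS; exact: da_l2.
Qed.

Lemma da_normD (x y : da_space) : (da_norm (x + y))%:C%C <= (da_norm x)%:C%C + (da_norm y)%:C%C :> C.
Proof.
rewrite -rmorphD lecR -(@ler_pXn2r _ 2) ?nnegrE ?addr_ge0 ?sqrtr_ge0 // sqrrD !da_norm2.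
have := da_dot_lin 1 x y (x + y); rewrite scale1r mul1r => ->.
have := da_dot_linr 1 x y x; have := da_dot_linr 1 x y y; rewrite scale1r rmorph1 !mul1r => -> ->.
rewrite !ReD (da_dotC y x) ReJ; have := le_trans (Re_le_nrm _) (da_CS x y).
rewrite -mulr_natr; lra.
Qed.

Lemma da_normZ a (x : da_space) : (da_norm (a *: x))%:C%C = `|a| * (da_norm x)%:C%C :> C.
Proof.
rewrite nrmE -rmorphM; congr (_%:C%C).
apply/eqP; rewrite -(@eqrXn2 _ 2) ?mulr_ge0 ?sqrtr_ge0 ?nrm_ge0 // exprMn !da_norm2.
have d0 (v : da_space) : da_dot 0 v = 0.
  by have := da_dot_lin (-1) 0 0 v; rewrite scaler0 addr0 mulN1r addNr.
have d0r (v : da_space) : da_dot v 0 = 0 by rewrite da_dotC d0 rmorph0.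
have := da_dot_lin a x 0 (a *: x); rewrite !addr0 d0 addr0 => ->.
have := da_dot_linr a x 0 x; rewrite !addr0 d0r addr0 => ->.
by rewrite mulrA nrm_sqrC ReRM.
Qed.

Lemma da_norm_eq0 (x : da_space) : (da_norm x)%:C%C = 0 :> C -> x = 0.
Proof.
move=> /complexI x0; apply: val_inj; apply: (l2dot_eq0 words_cover (da_l2 x)).
by rewrite -/(da_dot x x) -da_norm2 x0 expr0n.
Qed.

HB.instance Definition _ := Lmodule_isNormed.Build C da_space da_normD da_normZ da_norm_eq0.

Lemma da_nrm (x : da_space) : nrm x = da_norm x.
Proof. by []. Qed.

Lemma da_coord (x : da_space) s : nrm (val x s) <= nrm x.
Proof.
rewrite -(@ler_pXn2r _ 2) ?nnegrE ?nrm_ge0 // da_nrm da_norm2.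
by apply: l2_coord; [exact: words_cover | exact: da_l2].
Qed.

(** Coordinates converge along the filter because each of them is 1-Lipschitz. Finite partial sums
    then pass to the limit and bound |x - l| by the diameter of a small set of the filter, uniformly
    in N; orthogonality to the null vectors survives by Cauchy-Schwarz. *)
Lemma da_complete (F : set_system da_space) : ProperFilter F -> cauchy F -> cvg F.
Proof.
move=> FF /cauchy_ballP Fc.
have FcE (e : R) : 0 < e -> exists2 A, F A & forall x y, A x -> A y -> nrm (x - y) <= e.
  move=> e0; have := Fc e%:C%C; rewrite ltcR => /(_ e0)[[A1 A2] /= [FA1 FA2] hA].
  exists (A1 `&` A2); first exact: filterI.
  move=> x y [xA _] [_ yA]; have := hA (x, y) (conj xA yA).
  by rewrite -ball_normE /ball_/= nrmE ltcR => /ltW.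
have lim_coord (g : C -> R) s : (forall a b, `|g a - g b| <= nrm (a - b)) ->
    cvg ((fun x : da_space => g (val x s)) @ F).
  move=> hg; apply: cauchy_cvg; apply/cauchy_ballP => e e0.
  have [A FA hA] := FcE (e / 2) ltac:(exact: divr_gt0).
  pose G := (fun x : da_space => g (val x s)) @` A.
  have FG : F ((fun x : da_space => g (val x s)) @^-1` G).
    by apply: filterS FA => x Ax; exists x.
  exists (G, G); first by split; exact: FG.
  move=> [_ _] [[x Ax <-] [y Ay <-]] /=.
  rewrite /ball/=; apply: le_lt_trans (hg _ _) _.
  have := da_coord (x - y) s => /le_trans; apply: (fun H => le_lt_trans (H _ (hA _ _ Ax Ay)) _); lra.
have Re1 (a b : C) : `|complex.Re a - complex.Re b| <= nrm (a - b).
  by rewrite -ReN -ReD absRe_le_nrm.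
have Im1 (a b : C) : `|complex.Im a - complex.Im b| <= nrm (a - b).
  by rewrite -ImN -ImD absIm_le_nrm.
have cRe s := lim_coord (@complex.Re R) s Re1.
have cIm s := lim_coord (@complex.Im R) s Im1.
pose l (s : word) : C := (lim ((fun x : da_space => complex.Re (val x s)) @ F) +i*
                 lim ((fun x : da_space => complex.Im (val x s)) @ F))%C.
have near_l (e : R) A : F A -> (forall x y, A x -> A y -> nrm (x - y) <= e) ->
    forall x, A x -> forall N, psq L (val x - l) N <= e ^+ 2.
  move=> FA hA x Ax N.
  have cv : psq L (val x - val y) N @[y --> F] --> psq L (val x - l) N.
    rewrite /psq; apply: cvg_big => [|n _]; first exact: add_continuous.
    apply: cvg_big => [|s _]; first exact: add_continuous.
    under eq_fun do rewrite nrm_sqr; rewrite nrm_sqr.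
    apply: cvgD; rewrite expr2; under eq_fun do rewrite expr2.
      apply: cvgM.
        under eq_fun do rewrite ReD ReN; rewrite ReD ReN.
        by apply: cvgB; [exact: cvg_cst | exact: cRe].
      under eq_fun do rewrite ReD ReN; rewrite ReD ReN.
      by apply: cvgB; [exact: cvg_cst | exact: cRe].
    apply: cvgM.
      under eq_fun do rewrite ImD ImN; rewrite ImD ImN.
      by apply: cvgB; [exact: cvg_cst | exact: cIm].
    under eq_fun do rewrite ImD ImN; rewrite ImD ImN.
    by apply: cvgB; [exact: cvg_cst | exact: cIm].
  apply: (cvgr_to_le cv); apply: filterS FA => y Ay.
  have := psq_le N (da_l2 (x - y)); rewrite -/(da_dot (x - y) (x - y)) -da_norm2 => /le_trans; apply.
  by rewrite ler_pXn2r ?nnegrE ?sqrtr_ge0 ?(le_trans _ (hA _ _ Ax Ay)) ?nrm_ge0 //; exact: hA.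
have l2d x (e : R) A : F A -> (forall x y, A x -> A y -> nrm (x - y) <= e) -> A x ->
    l2 L (val x - l).
  by move=> FA hA Ax; exists (e ^+ 2) => N; exact: (near_l e A).
have l2l : l2 L l.
  have [A FA hA] := FcE 1 ltr01; have [x Ax] := filter_ex FA.
  have := l2_lin (-1) (l2d x 1 A FA hA Ax) (da_l2 x).
  by congr l2; rewrite scaleN1r opprB subrK.
have lP : in_da l.
  apply/asboolP; split => // y ny; have [hy _] := ny.
  apply: nrm0_eq0; apply/eqP; rewrite eq_le nrm_ge0 andbT.
  apply: (@le_eps _ _ _ (Num.sqrt (complex.Re (l2dot L y y)))); first exact: sqrtr_ge0.
  move=> e e0; rewrite add0r.
  have [A FA hA] := FcE e e0; have [x Ax] := filter_ex FA.
  have hd := l2d x e A FA hA Ax.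
  have -> : l2dot L l y = - l2dot L (val x - l) y.
    have -> : l = -1 *: (val x - l) + val x by rewrite scaleN1r opprB subrK.
    rewrite {1}l2dot_lin //; last exact: da_l2.
    have /asboolP[_ ->] := valP x => //.
    by rewrite addr0 mulN1r scaleN1r opprB subrK.
  rewrite nrmN -(@ler_pXn2r _ 2) ?nnegrE ?nrm_ge0 ?mulr_ge0 ?sqrtr_ge0 ?(ltW e0) //.
  apply: le_trans (l2_CS hd hy) _; rewrite exprMn sqr_sqrtr; last first.
    by have := l2dot_ge0 hy; rewrite ge0cE => /andP[].
  rewrite mulrC ler_wpM2l //; first by have := l2dot_ge0 hy; rewrite ge0cE => /andP[].
  by apply: l2dot_le => //; exact: (near_l e A FA hA x Ax).
apply/cvg_ex; exists (exist _ l lP : da_space).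
apply/cvgrPdist_le => e e0.
have er : e = (complex.Re e)%:C%C by apply: ge0c_Re; exact: ltW.
move: (complex.Re e) er => t er; subst e; rewrite ltcR in e0.
have [A FA hA] := FcE t e0; move: (FA); apply: filterS => x Ax.
rewrite nrmE lecR nrmC -(@ler_pXn2r _ 2) ?nnegrE ?nrm_ge0 ?(ltW e0) //.
rewrite da_nrm da_norm2; apply: l2dot_le; first exact: da_l2.
exact: (near_l t A FA hA x Ax).
Qed.

HB.instance Definition _ := Uniform_isComplete.Build da_space da_complete.

Lemma da_bilinear : bilinear_for ( *%R) (Num.conj \; *%R) da_dot.
Proof.
split=> [y a x v|x a y v] /=; first exact: da_dot_lin.
exact: da_dot_linr.
Qed.

HB.instance Definition _ :=
  bilinear_isBilinear.Build C da_space da_space C ( *%R) (Num.conj \; *%R) da_dot da_bilinear.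

Lemma da_hermitian (x y : da_space) : da_dot x y = (-1) ^+ false * Num.conj (da_dot y x).
Proof. by rewrite expr0 mul1r da_dotC. Qed.

HB.instance Definition _ := isHermitianSesquilinear.Build C da_space false Num.conj da_dot da_hermitian.

Lemma da_dot_gt0 (x : da_space) : x != 0 -> 0 < da_dot x x.
Proof.
move=> x0; rewrite da_dot_real ltcR -da_norm2 exprn_gt0 // lt_neqAle sqrtr_ge0 andbT eq_sym.
by apply: contra_neq x0 => n0; apply: da_norm_eq0; rewrite n0.
Qed.

HB.instance Definition _ := isDotProduct.Build C da_space da_dot da_dot_gt0.

Definition da_form : {dot da_space for Num.conj} := da_dot.

Lemma da_normE (x : da_space) : `|x| ^+ 2 = da_form x x.
Proof. by rewrite nrmE -rmorphXn /= da_nrm da_norm2 -da_dot_real. Qed.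

Local Notation B := (set_type (@unit_ball R d)).

Definition da_eval (x : da_space) (u : B) : C := l2dot L (val x) (feature (val u)).

Lemma feature_in (u : B) : in_da (feature (val u)).
Proof.
have hf := l2_feature (valB u).
apply/asboolP; split => // y [hy ny]; rewrite l2dotC // ny ?rmorph0 //; exact: valB.
Qed.

Definition da_ker (u : B) : da_space := exist _ (feature (val u)) (feature_in u).

Lemma da_eval_linear a (x y : da_space) u : da_eval (a *: x + y) u = a * da_eval x u + da_eval y u.
Proof. exact: (da_dot_lin a x y (da_ker u)). Qed.

Lemma da_eval_inj : injective da_eval.
Proof.
move=> x y xy; apply/eqP; rewrite -subr_eq0; apply/eqP/val_inj.
apply: (l2dot_eq0 words_cover (da_l2 (x - y))).
have /asboolP[_ ->] // := valP (x - y).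
split; first exact: da_l2.
move=> z hz; have zB : z \in @unit_ball R d by rewrite inE.
have := da_eval_linear (-1) y x (SigSub zB).
rewrite scaleN1r addrC mulN1r /da_eval /= => ->.
by have := congr1 (fun f => f (SigSub zB)) xy; rewrite /da_eval /= => ->; rewrite addNr.
Qed.

Lemma da_kerE (u v : B) : da_eval (da_ker u) v = da_kernel v u.
Proof. by rewrite /da_eval l2dot_feature //; exact: valB. Qed.

(** [Rplus] asks for some model of the space, so a function of M+ can be placed in it only once a
    model exists. Positivity of [da_kernel] is also read off this one. *)
Definition drury_arveson : rkhs (@da_kernel R d) :=
  Rkhs da_normE da_eval_linear da_eval_inj da_kerE (fun f u => erefl).

End Model.

(** * From M+ to R+ *)

Section UltraLimit.
Context {R : realType}.

Lemma ultrafilter_nat : exists U : set_system nat, UltraFilter U /\ \oo `<=` U.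
Proof. exact: ultraFilterLemma. Qed.

(** A limit along an ultrafilter exists for every bounded sequence and is linear in it, while the
    averages that define [rho_mu] need not converge for a general operator. *)
Definition ultra : set_system nat := projT1 (cid ultrafilter_nat).

#[local] Instance ultra_ultrafilter : UltraFilter ultra.
Proof. by rewrite /ultra; case: cid => U []. Qed.

Lemma ultra_oo : \oo `<=` ultra.
Proof. by rewrite /ultra; case: cid => U []. Qed.

Definition ulim (x : nat -> R) : R := lim (x @ ultra).

Lemma ulim_cvg (x : nat -> R) (M : R) : (forall n, `|x n| <= M) -> x @ ultra --> ulim x.
Proof.
move=> hx; have [|l [_ hl]] := @segment_compact R (- M) M (x @ ultra) _.
  apply: (@filterS _ ultra _ setT) => [n _ /=|]; last exact: filterT.
  by rewrite in_itv /= -ler_norml.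
apply/cvg_ex; exists l => V Vl.
(* Compactness gives a cluster point l; an ultrafilter containing the complement of a neighbourhood
   of l could not cluster there. *)
have [//|UV] := in_ultra_setVsetC (x @^-1` V) ultra_ultrafilter.
by have [r []] := hl (~` V) V UV Vl.
Qed.

Lemma ulim_eq (x : nat -> R) (l : R) : x @ \oo --> l -> ulim x = l.
Proof.
move=> h; apply: cvg_lim => //; apply: cvg_trans h; apply: cvg_app.
exact: ultra_oo.
Qed.

Lemma ulim_lin (a b : R) (x y z : nat -> R) (M N K : R) :
  (forall n, `|x n| <= M) -> (forall n, `|y n| <= N) -> (forall n, `|z n| <= K) ->
  ulim (fun n => a * x n + b * y n + z n) = a * ulim x + b * ulim y + ulim z.
Proof.
move=> hx hy hz; apply: cvg_lim => //.
apply: cvgD (ulim_cvg hz); apply: cvgD; apply: cvgM; try exact: cvg_cst.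
  exact: ulim_cvg hx.
exact: ulim_cvg hy.
Qed.

Lemma ulim_ge0 (x : nat -> R) (M : R) : (forall n, `|x n| <= M) -> (forall n, 0 <= x n) ->
  0 <= ulim x.
Proof. by move=> hx x0; apply: (cvgr_to_ge (ulim_cvg hx)); apply: nearW. Qed.

Lemma ulim_cst (c : R) : ulim (fun=> c) = c.
Proof. by apply: ulim_eq; exact: cvg_cst. Qed.

End UltraLimit.

(** * Integration over the sphere *)

Section SphereMeasure.
Context {R : realType} {d : nat}.
Local Notation C := R[i].
Local Notation S := (@unit_sphere R d : set (borel_space R d)).
Implicit Types (z w : 'rV[C]_d).

Lemma unit_sphereP z : S z <-> bnorm z = 1.
Proof.
rewrite /unit_sphere /= hermzz; split=> [|->]; last by rewrite expr1n.
move/(congr1 (@complex.Re R)) => /= h; apply/eqP.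
by rewrite -(@eqrXn2 _ 2) ?bnorm_ge0 // expr1n h.
Qed.

Lemma open_eps (O : set 'rV[C]_d) :
  (forall x, O x -> exists2 e : R, 0 < e & forall y, bnorm (x - y) < e -> O y) -> open O.
Proof.
move=> hO; rewrite openE => x /hO[e e0 he]; apply/nbhs_ballP.
exists (e / (Num.sqrt d%:R + 1))%:C%C => /=.
  by rewrite ltcR divr_gt0 // ltr_wpDl // sqrtr_ge0.
move=> y; rewrite -ball_normE /ball_/= nrmE ltcR ltr_pdivlMr ?ltr_wpDl ?sqrtr_ge0 // => xy.
apply: he; apply: le_lt_trans (bnorm_le_nrm _) _; apply: le_lt_trans xy.
by rewrite mulrDr mulr1 mulrC lerDl nrm_ge0.
Qed.

Lemma open_measurable_borel (O : set 'rV[C]_d) : open O ->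
  measurable (O : set (borel_space R d)).
Proof. by move=> oO; exact: sub_sigma_algebra. Qed.

Lemma bnormB_le z w : `|bnorm z - bnorm w| <= bnorm (z - w).
Proof.
have bN (x : 'rV[C]_d) : bnorm (- x) = bnorm x.
  by congr Num.sqrt; apply: eq_bigr => j _; rewrite mxE nrmN.
rewrite ler_norml; apply/andP; split.
  by rewrite lerNl opprB lerBlDr; rewrite -{1}(subrK z w) -(bN (z - w)) opprB bnormD.
by rewrite lerBlDr; rewrite -{1}(subrK w z) bnormD.
Qed.

Lemma sphere_measurable : measurable (S : set (borel_space R d)).
Proof.
have -> : S = ~` ([set z | bnorm z < 1] `|` [set z | 1 < bnorm z]).
  apply/seteqP; split=> z.
    by move=> /unit_sphereP h [] /=; rewrite h ltxx.
  move=> h; apply/unit_sphereP; apply/eqP; rewrite eq_le.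
  by apply/andP; split; rewrite leNgt; apply/negP => h'; apply: h; [right | left].
apply: measurableC; apply: measurableU; apply: open_measurable_borel; apply: open_eps => z /= hz.
  exists (1 - bnorm z); first by rewrite subr_gt0.
  by move=> y hy; have := bnormB_le z y; rewrite ler_norml => /andP[]; lra.
exists (bnorm z - 1); first by rewrite subr_gt0.
by move=> y hy; have := bnormB_le z y; rewrite ler_norml => /andP[]; lra.
Qed.

(** Continuity on the open ball of radius r > 1 makes each superlevel set the trace on the sphere of
    an open set of C^d, hence Borel. The integrands below need not be continuous farther out. *)
Lemma measurable_sphere (r : R) (g : borel_space R d -> R) : 1 < r ->
  (forall x, bnorm x < r -> forall e : R, 0 < e -> exists2 t : R, 0 < t &
     forall y, bnorm y < r -> bnorm (x - y) < t -> `|g x - g y| < e) ->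
  measurable_fun S g.
Proof.
move=> r1 hg; apply: (measurability _ (measurable_realfun.RGenOInfty.measurableE R)) => //.
move=> _ [_ [a ->] <-].
rewrite (_ : S `&` g @^-1` _ = S `&` [set x | bnorm x < r /\ a < g x]); last first.
  apply/seteqP; split=> x /= [Sx]; rewrite in_itv /= andbT.
    by move=> ax; split => //; split => //; have /unit_sphereP -> := Sx.
  by case.
apply: measurableI; first exact: sphere_measurable.
apply: open_measurable_borel; apply: open_eps => x /= [xr ax].
have [t t0 ht] := hg x xr (g x - a) ltac:(by rewrite subr_gt0).
exists (Num.min t (r - bnorm x)); first by rewrite lt_min t0 subr_gt0.
move=> y; rewrite lt_min => /andP[h1 h2].
have yr : bnorm y < r by have := bnormB_le x y; rewrite ler_norml => /andP[]; lra.
split => //; have := ht y yr h1; rewrite ltr_norml => /andP[]; lra.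
Qed.

Variable mu : {finite_measure set (borel_space R d) -> \bar R}.

Lemma sphere_integrable (g : borel_space R d -> R) (M : R) : measurable_fun S g ->
  (forall x, S x -> `|g x| <= M) -> mu.-integrable S (EFin \o g).
Proof.
move=> mg bg; apply: measurable_bounded_integrable => //.
- exact: sphere_measurable.
- by rewrite ltey_eq fin_num_measure //; exact: sphere_measurable.
exists M; split; first exact: num_real.
by move=> k Mk x Sx; apply: le_trans (ltW Mk); exact: bg.
Qed.

Definition mass : R := fine (mu S).

Lemma sphere_integral_le (g : borel_space R d -> R) (M : R) : measurable_fun S g ->
  (forall x, S x -> `|g x| <= M) -> `|Rintegral mu S g| <= M * mass.
Proof.
move=> mg bg; have ig := sphere_integrable mg bg.
apply: le_trans (le_normr_Rintegral sphere_measurable ig) _.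
rewrite -(Rintegral_cst mu sphere_measurable M); apply: le_Rintegral => //.
- exact: sphere_measurable.
- have mg' : measurable_fun S (fun x => `|g x|) by exact: measurableT_comp.
  by apply: (sphere_integrable (M := M) mg') => x Sx; rewrite normr_id; exact: bg.
- exact: (finite_measure_integrable_cst mu M sphere_measurable).
Qed.

End SphereMeasure.

Section ComplexSphereIntegral.
Context {R : realType} {d : nat}.
Local Notation C := R[i].
Local Notation S := (@unit_sphere R d : set (borel_space R d)).
Variable mu : {finite_measure set (borel_space R d) -> \bar R}.
Implicit Types (f g : 'rV[C]_d -> C).

(** The explicit bound M controls the integrals uniformly in n when g runs through a sequence of
    symbols. *)
Definition nice g (M : R) := [/\
  measurable_fun S (fun x => complex.Re (g x) : R),
  measurable_fun S (fun x => complex.Im (g x) : R) & forall x, S x -> nrm (g x) <= M].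

Lemma cintegral_bound g M : nice g M ->
  `|complex.Re (cintegral mu S g)| <= M * mass mu /\
  `|complex.Im (cintegral mu S g)| <= M * mass mu.
Proof.
move=> [mr mi bg]; split; apply: sphere_integral_le => // x Sx.
  by apply: le_trans (absRe_le_nrm _) (bg x Sx).
by apply: le_trans (absIm_le_nrm _) (bg x Sx).
Qed.

Lemma nice_lin a f g M N : nice f M -> nice g N ->
  nice (fun x => a * f x + g x) (nrm a * M + N).
Proof.
move=> [mr mi bf] [nr ni bg]; split.
- under eq_fun do rewrite ReD ReM.
  apply: measurable_funD => //; apply: measurable_funB; exact: measurable_funM.
- under eq_fun do rewrite ImD ImM.
  apply: measurable_funD => //; apply: measurable_funD; exact: measurable_funM.
move=> x Sx; rewrite (le_trans (nrmD _ _)) // nrmM lerD //; last exact: bg.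
by rewrite ler_wpM2l ?nrm_ge0 // bf.
Qed.

Lemma nice_int g M : nice g M ->
  mu.-integrable S (EFin \o (fun x => complex.Re (g x))) /\
  mu.-integrable S (EFin \o (fun x => complex.Im (g x))).
Proof.
move=> [mr mi bg]; split; apply: (@sphere_integrable _ _ mu _ M) => // x Sx.
  by apply: le_trans (absRe_le_nrm _) (bg x Sx).
by apply: le_trans (absIm_le_nrm _) (bg x Sx).
Qed.

Lemma cintegral_lin a f g M N : nice f M -> nice g N ->
  cintegral mu S (fun x => a * f x + g x) = a * cintegral mu S f + cintegral mu S g.
Proof.
move=> nf ng; have [fr fi] := nice_int nf; have [gr gi] := nice_int ng.
have mS := @sphere_measurable R d.
have iZ (k : R) (h : borel_space R d -> R) : mu.-integrable S (EFin \o h) ->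
    mu.-integrable S (EFin \o (fun x => k * h x)).
  by move=> ih; have := integrableZl mS k ih; apply: eq_integrable.
have iD (h k : borel_space R d -> R) : mu.-integrable S (EFin \o h) ->
    mu.-integrable S (EFin \o k) -> mu.-integrable S (EFin \o (fun x => h x + k x)).
  by move=> ih ik; have := integrableD mS ih ik; apply: eq_integrable.
have iB (h k : borel_space R d -> R) : mu.-integrable S (EFin \o h) ->
    mu.-integrable S (EFin \o k) -> mu.-integrable S (EFin \o (fun x => h x - k x)).
  by move=> ih ik; have := integrableB mS ih ik; apply: eq_integrable.
apply: eq_ReIm; rewrite ?ReD ?ImD ?ReM ?ImM /cintegral /=.
  under eq_Rintegral do rewrite ReD ReM.
  rewrite RintegralD //; last by apply: iB; exact: iZ.
  by rewrite RintegralB ?RintegralZl //; exact: iZ.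
under eq_Rintegral do rewrite ImD ImM.
rewrite RintegralD //; last by apply: iD; exact: iZ.
by rewrite RintegralD ?RintegralZl //; exact: iZ.
Qed.

Lemma nice_holder g (r M : R) : 1 < r -> (forall x, S x -> nrm (g x) <= M) ->
  (forall x, bnorm x < r -> forall e : R, 0 < e -> exists2 t : R, 0 < t &
     forall y, bnorm y < r -> bnorm (x - y) < t -> nrm (g x - g y) < e) ->
  nice g M.
Proof.
move=> r1 bg hg; split => //; apply: (measurable_sphere r1) => x xr e e0;
  have [t t0 ht] := hg x xr e e0; exists t => // y yr xy; apply: le_lt_trans (ht y yr xy).
  by rewrite -ReN -ReD absRe_le_nrm.
by rewrite -ImN -ImD absIm_le_nrm.
Qed.

Lemma inv_sub_le (a b : C) (q : R) : q < 1 -> nrm a <= q -> nrm b <= q ->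
  nrm ((1 - a)^-1 - (1 - b)^-1) <= nrm (a - b) / (1 - q) ^+ 2.
Proof.
move=> q1 aq bq.
have lb (c : C) : nrm c <= q -> 1 - q <= nrm (1 - c).
  by move=> cq; have := nrmD (1 - c) c; rewrite subrK nrm1; lra.
have a0 := one_sub_neq0 (le_lt_trans aq q1).
have b0 := one_sub_neq0 (le_lt_trans bq q1).
have q0 : 0 < 1 - q by rewrite subr_gt0.
have E : (a - b) = ((1 - a)^-1 - (1 - b)^-1) * ((1 - a) * (1 - b)) by field; rewrite a0 b0.
rewrite ler_pdivlMr ?exprn_gt0 // E !nrmM ler_wpM2l ?nrm_ge0 //.
by rewrite expr2 ler_pM ?(ltW q0) // lb.
Qed.

Lemma herglotz_kernel_nice z : unit_ball z ->
  nice (fun zeta => (1 + herm z zeta) / (1 - herm z zeta)) (2 / (1 - bnorm z)).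
Proof.
move=> /unit_ballP hz; have bz0 := bnorm_ge0 z.
(* Chosen so that r > 1 and |z| r < 1: the denominator stays away from 0 on the ball of radius r. *)
pose r := 2 / (1 + bnorm z); pose q := bnorm z * r.
have p0 : 0 < 1 + bnorm z by rewrite ltr_wpDr.
have r1 : 1 < r by rewrite ltr_pdivlMr // mul1r; lra.
have q1 : q < 1 by rewrite /q /r mulrA ltr_pdivrMr // mul1r; lra.
apply: (nice_holder r1) => [x /unit_sphereP Sx|x xr e e0].
  have h1 : nrm (herm z x) <= bnorm z by rewrite (le_trans (herm_le _ _)) // Sx mulr1.
  have h2 : 1 - bnorm z <= nrm (1 - herm z x).
    by have := nrmD (1 - herm z x) (herm z x); rewrite subrK nrm1; lra.
  have h3 : nrm (1 + herm z x) <= 2 by rewrite (le_trans (nrmD _ _)) // nrm1; lra.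
  have bz1 : 0 < 1 - bnorm z by rewrite subr_gt0.
  have n0 : 0 < nrm (1 - herm z x) by apply: lt_le_trans h2.
  rewrite ler_pdivlMr //.
  have E : (1 + herm z x) / (1 - herm z x) * (1 - herm z x) = 1 + herm z x.
    by rewrite divfK //; apply/one_sub_neq0/(le_lt_trans h1).
  apply: le_trans h3; rewrite -(congr1 nrm E) [leRHS]nrmM.
  by rewrite ler_wpM2l ?nrm_ge0.
exists (e * (1 - q) ^+ 2 / 2); first by rewrite divr_gt0 // mulr_gt0 // exprn_gt0 // subr_gt0.
move=> y yr xy.
have hq (v : 'rV[C]_d) : bnorm v < r -> nrm (herm z v) <= q.
  by move=> vr; rewrite (le_trans (herm_le _ _)) // /q ler_wpM2l // ltW.
have ax := one_sub_neq0 (le_lt_trans (hq x xr) q1).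
have ay := one_sub_neq0 (le_lt_trans (hq y yr) q1).
have -> : (1 + herm z x) / (1 - herm z x) - (1 + herm z y) / (1 - herm z y) =
    2%:R * ((1 - herm z x)^-1 - (1 - herm z y)^-1) by field; rewrite ax ay.
rewrite nrmM nrm_nat.
have h := inv_sub_le q1 (hq x xr) (hq y yr).
have hB : herm z x - herm z y = herm z (x - y).
  rewrite /herm -sumrB; apply: eq_bigr => j _.
  by rewrite !mxE rmorphB mulrBr.
have h' : nrm (herm z (x - y)) <= bnorm (x - y).
  by rewrite (le_trans (herm_le _ _)) // ler_piMl ?bnorm_ge0 // ltW.
have q2 : 0 < (1 - q) ^+ 2 by rewrite exprn_gt0 // subr_gt0.
move: h; rewrite hB ler_pdivlMr // => h.
move: xy; rewrite ltr_pdivlMr // => xy.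
rewrite -(ltr_pM2r q2); lra.
Qed.

End ComplexSphereIntegral.

(** * The functional attached to a measure *)

Section MplusRplus.
Context {R : realType} {d : nat}.
Local Notation C := R[i].
Local Notation B := (set_type (@unit_ball R d)).
Local Notation S := (@unit_sphere R d : set (borel_space R d)).
Variable H : rkhs (@da_kernel R d).
Local Notation dot := (rkhs_dot H).
Local Notation normE := (rkhs_normE (r := H)).
Local Notation ker := (@rkhs_ker _ _ _ H).
Variable mu : {finite_measure set (borel_space R d) -> \bar R}.
Implicit Types (z w v : 'rV[C]_d) (T : H -> H).

(** Total version of the kernel map, with default value 0 off the ball, so that integrands are
    functions on C^d. *)
Definition kerz w : H := if insub w is Some u then ker u else 0.

Lemma kerzE w (hw : unit_ball w) : kerz w = ker (SigSub (mem_set hw)).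
Proof.
rewrite /kerz; case: insubP => [u _ uw|]; last by rewrite mem_set.
by congr ker; apply: val_inj.
Qed.

Lemma dot_kerz w v : unit_ball w -> unit_ball v ->
  dot (kerz w) (kerz v) = (1 - herm v w)^-1.
Proof. by move=> hw hv; rewrite (kerzE hw) (kerzE hv) dot_ker. Qed.

Lemma nrm_kerz w : unit_ball w -> nrm (kerz w) ^+ 2 = (1 - bnorm w ^+ 2)^-1.
Proof.
move=> hw; apply: (@complexI R); rewrite -(dotxx normE) dot_kerz // hermzz.
by rewrite -[1 - _]/(1%:C%C - _) -rmorphB -fmorphV.
Qed.

Lemma kerz_sub w v (q : R) : q < 1 -> bnorm w <= q -> bnorm v <= q ->
  nrm (kerz w - kerz v) ^+ 2 <= 2 * bnorm (w - v) / (1 - q) ^+ 2.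
Proof.
move=> q1 wq vq.
have hw : unit_ball w by apply/unit_ballP; apply: le_lt_trans q1.
have hv : unit_ball v by apply/unit_ballP; apply: le_lt_trans q1.
have -> : nrm (kerz w - kerz v) ^+ 2 =
    complex.Re ((1 - herm w w)^-1 - (1 - herm v w)^-1)
    + complex.Re ((1 - herm v v)^-1 - (1 - herm w v)^-1).
  have -> : nrm (kerz w - kerz v) ^+ 2 = complex.Re (dot (kerz w - kerz v) (kerz w - kerz v)).
    by rewrite (dotxx normE).
  by rewrite dotBl !dotBr !dot_kerz // !(ReD, ReN); ring.
have hq (x y : 'rV[C]_d) : bnorm x <= q -> bnorm y <= q -> nrm (herm x y) <= q.
  move=> xq yq; rewrite (le_trans (herm_le _ _)) //.
  have := bnorm_ge0 x; have := bnorm_ge0 y; nra.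
have key (x y : 'rV[C]_d) : bnorm x <= q -> bnorm y <= q ->
    complex.Re ((1 - herm x x)^-1 - (1 - herm y x)^-1) <= bnorm (x - y) / (1 - q) ^+ 2.
  move=> xq yq; apply: le_trans (Re_le_nrm _) _.
  apply: le_trans (inv_sub_le q1 (hq x x xq xq) (hq y x yq xq)) _.
  rewrite ler_wpM2r ?invr_ge0 ?sqr_ge0 //.
  have -> : herm x x - herm y x = herm (x - y) x.
    by rewrite /herm -sumrB; apply: eq_bigr => j _; rewrite !mxE mulrBl.
  rewrite (le_trans (herm_le _ _)) // ler_piMr ?bnorm_ge0 //.
  by rewrite (le_trans xq) // ltW.
have h1 := key w v wq vq; have h2 := key v w vq wq.
have bs : bnorm (v - w) = bnorm (w - v).
  by congr Num.sqrt; apply: eq_bigr => j _; rewrite !mxE nrmC.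
move: h2; rewrite bs; lra.
Qed.

(** Tends to 1; the shift to n + 2 keeps it positive at n = 0. *)
Definition radius (n : nat) : R := 1 - n.+2%:R^-1.

Lemma radius_bounds n : 0 < radius n < 1.
Proof.
have h : (n.+2%:R : R)^-1 < 1 by rewrite invf_lt1 ?ltr1n.
have h' : 0 < (n.+2%:R : R)^-1 by rewrite invr_gt0.
rewrite /radius; move: (n.+2%:R^-1) h h' => t h h'; apply/andP; split; lra.
Qed.

(** Conjugated because the resolvent pairs z bilinearly with the point: bilin z (point n zeta) is
    the radius times <z,zeta>. *)
Definition point n (zeta : 'rV[C]_d) : 'rV[C]_d := (radius n)%:C%C *: map_mx Num.conj zeta.

Lemma bnorm_point n zeta : bnorm (point n zeta) = radius n * bnorm zeta.
Proof.
have /andP[r0 _] := radius_bounds n.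
apply/eqP; rewrite -(@eqrXn2 _ 2) ?mulr_ge0 ?bnorm_ge0 ?(ltW r0) // exprMn !bnorm2.
rewrite mulr_sumr; apply/eqP/eq_bigr => j _.
by rewrite !mxE nrmM nrmR nrm_conj exprMn real_normK ?num_real.
Qed.

Lemma point_sub n x y : point n (x - y) = point n x - point n y.
Proof. by rewrite /point -scalerBr; congr (_ *: _); apply/matrixP => i j; rewrite !mxE rmorphB. Qed.

Lemma point_ball n zeta : S zeta -> unit_ball (point n zeta).
Proof.
move=> /unit_sphereP h; apply/unit_ballP; rewrite bnorm_point h mulr1.
by case/andP: (radius_bounds n).
Qed.

(** For zeta on the sphere the factor 1 - r^2 normalizes the kernel vector, so this is the value at
    T of a vector state. *)
Definition symbol n T (zeta : 'rV[C]_d) : C :=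
  (1 - radius n ^+ 2)%:C%C * dot (T (kerz (point n zeta))) (kerz (point n zeta)).

Lemma symbol_nice n T (M : R) : bounded_op T -> 0 <= M ->
  (forall x, nrm (T x) <= M * nrm x) -> nice (symbol n T) M.
Proof.
move=> bT M0 hM; have /andP[r0 r1] := radius_bounds n.
set r := radius n in r0 r1.
have r2 : 0 < 1 - r ^+ 2 by rewrite subr_gt0 expr_lt1 // ltW.
(* [point n] maps the ball of radius r' > 1 into the ball of radius q < 1, where kernel vectors are
   bounded and vary continuously. *)
pose q := (1 + r) / 2; pose r' := q / r.
have q1 : q < 1 by rewrite /q; lra.
have r'1 : 1 < r' by rewrite ltr_pdivlMr // mul1r /q; lra.
apply: (nice_holder r'1) => [x Sx|x xr e e0].
  have hp := point_ball n Sx.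
  rewrite /symbol nrmM nrmR -/r gtr0_norm //.
  have h1 : nrm (dot (T (kerz (point n x))) (kerz (point n x))) <= M * nrm (kerz (point n x)) ^+ 2.
    rewrite (le_trans (dot_CS normE _ _)) // expr2 mulrA ler_wpM2r ?nrm_ge0 //.
  rewrite nrm_kerz // bnorm_point in h1; move/unit_sphereP : Sx => Sx.
  move: h1; rewrite Sx mulr1 -/r => h1.
  by rewrite mulrC -ler_pdivlMr.
have hq (y : 'rV[C]_d) : bnorm y < r' -> bnorm (point n y) <= q.
  by rewrite bnorm_point -/r => /ltW; rewrite ler_pdivlMr // mulrC.
set c := 2 * M * (1 - q)^-1 + 1.
have q0 : 0 < 1 - q by rewrite subr_gt0.
have c0 : 0 < c by rewrite ltr_wpDl // !mulr_ge0 // invr_ge0 ltW.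
have kb (y : 'rV[C]_d) : bnorm y < r' -> nrm (kerz (point n y)) <= (1 - q)^-1.
  move=> yr; have yq := hq y yr.
  have hb : unit_ball (point n y) by apply/unit_ballP; apply: le_lt_trans q1.
  rewrite -(@ler_pXn2r _ 2) ?nnegrE ?nrm_ge0 ?invr_ge0 ?(ltW q0) // nrm_kerz // exprVn.
  rewrite lef_pV2 ?posrE ?exprn_gt0 //; last first.
    by rewrite subr_gt0 expr_lt1 ?bnorm_ge0 //; apply/unit_ballP.
  have := bnorm_ge0 (point n y); nra.
exists ((e / c) ^+ 2 * (1 - q) ^+ 2 / 2).
  by rewrite divr_gt0 // mulr_gt0 // exprn_gt0 // divr_gt0.
move=> y yr xy.
set kx := kerz (point n x); set ky := kerz (point n y).
have E : symbol n T x - symbol n T y = (1 - r ^+ 2)%:C%C * (dot (T (kx - ky)) kx + dot (T ky) (kx - ky)).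
  by rewrite /symbol -mulrBr (bopB _ _ bT) dotBl dotBr addrA subrK.
have kk : nrm (kx - ky) < e / c.
  rewrite -(@ltr_pXn2r _ 2) ?nnegrE ?nrm_ge0 ?divr_ge0 ?(ltW e0) ?(ltW c0) //.
  apply: le_lt_trans (kerz_sub q1 (hq x xr) (hq y yr)) _.
  rewrite ltr_pdivrMr ?exprn_gt0 // -point_sub bnorm_point -/r.
  have := bnorm_ge0 (x - y); move: xy; rewrite ltr_pdivlMr //.
  move: (bnorm _) ((e / c) ^+ 2 * (1 - q) ^+ 2) => b t; nra.
rewrite E nrmM nrmR gtr0_norm //.
have h1 : nrm (dot (T (kx - ky)) kx) <= M * nrm (kx - ky) * (1 - q)^-1.
  rewrite (le_trans (dot_CS normE _ _)) // ler_pM ?nrm_ge0 //; exact: kb.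
have h2 : nrm (dot (T ky) (kx - ky)) <= M * (1 - q)^-1 * nrm (kx - ky).
  rewrite (le_trans (dot_CS normE _ _)) // ler_wpM2r ?nrm_ge0 // (le_trans (hM _)) //.
  by rewrite ler_wpM2l //; exact: kb.
have h3 := nrmD (dot (T (kx - ky)) kx) (dot (T ky) (kx - ky)).
have h4 : c * nrm (kx - ky) < e by rewrite mulrC -ltr_pdivlMr.
have h5 := nrm_ge0 (kx - ky).
have h6 : nrm (dot (T (kx - ky)) kx + dot (T ky) (kx - ky)) < e.
  by apply: le_lt_trans h4; rewrite /c; lra.
apply: le_lt_trans h6; rewrite ler_piMl ?nrm_ge0 //.
by rewrite gerBl sqr_ge0.
Qed.

Definition rho_n n T : C := cintegral mu S (symbol n T).

Definition rho_mu T : C := (ulim (fun n => complex.Re (rho_n n T)) +i*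
                            ulim (fun n => complex.Im (rho_n n T)))%C.

Lemma symbol_bound T : bounded_op T -> exists2 M : R, 0 <= M & forall n, nice (symbol n T) M.
Proof.
move=> bT; have [_ [M M0 hM]] := (bounded_opP _).1 bT.
by exists M => // n; exact: symbol_nice.
Qed.

Lemma rho_mu_lin a T1 T2 : bounded_op T1 -> bounded_op T2 ->
  rho_mu (fun x => a *: T1 x + T2 x) = a * rho_mu T1 + rho_mu T2.
Proof.
move=> b1 b2; have [M M0 n1] := symbol_bound b1; have [N N0 n2] := symbol_bound b2.
have E n : rho_n n (fun x => a *: T1 x + T2 x) = a * rho_n n T1 + rho_n n T2.
  rewrite -(cintegral_lin mu a (n1 n) (n2 n)); congr cintegral; apply/funext => x.
  by rewrite /symbol dotDl dotZl; ring.
have r1 n := (cintegral_bound mu (n1 n)).1; have i1 n := (cintegral_bound mu (n1 n)).2.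
have r2 n := (cintegral_bound mu (n2 n)).1; have i2 n := (cintegral_bound mu (n2 n)).2.
have ReE T : complex.Re (rho_mu T) = ulim (fun n => complex.Re (rho_n n T)) by [].
have ImE T : complex.Im (rho_mu T) = ulim (fun n => complex.Im (rho_n n T)) by [].
apply: eq_ReIm; rewrite !(ReD, ImD, ReM, ImM, ReE, ImE).
  rewrite -mulNr -(ulim_lin (complex.Re a) (- complex.Im a) r1 i1 r2).
  by congr ulim; apply/funext => n; rewrite E ReD ReM mulNr.
rewrite -(ulim_lin (complex.Re a) (complex.Im a) i1 r1 i2).
by congr ulim; apply/funext => n; rewrite E ImD ImM.
Qed.

Lemma rho_mu_Re_ge0 T : bounded_op T ->
  (forall w, unit_ball w -> 0 <= complex.Re (dot (T (kerz w)) (kerz w))) ->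
  0 <= complex.Re (rho_mu T).
Proof.
move=> bT hT; have [M M0 nT] := symbol_bound bT.
apply: (ulim_ge0 (fun n => (cintegral_bound mu (nT n)).1)) => n.
apply: Rintegral_ge0 => x Sx; rewrite /symbol ReRM mulr_ge0 //; last exact/hT/point_ball.
have /andP[r0 r1] := radius_bounds n.
by rewrite subr_ge0 expr_le1 // ltW.
Qed.

Lemma rho_mu_positive T T' : bounded_op T -> bounded_op T' -> adjoint dot T T' ->
  0 <= rho_mu (T' \o T).
Proof.
move=> bT bT' hT; have bTT := bounded_op_comp bT' bT.
have E w : dot ((T' \o T) (kerz w)) (kerz w) = (nrm (T (kerz w)) ^+ 2)%:C%C.
  by rewrite -(dotxx normE) /= (adjoint_sym hT).
rewrite ge0cE; apply/andP; split; last first.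
  by apply: rho_mu_Re_ge0 => // w _; rewrite E /= sqr_ge0.
apply/eqP; rewrite /= -[RHS]ulim_cst; congr ulim; apply/funext => n.
rewrite /rho_n /cintegral /=; under eq_Rintegral do rewrite /symbol E -rmorphM /=.
by rewrite (Rintegral_cst mu (@sphere_measurable R d)) mul0r.
Qed.

Lemma symbol_herglotz n z zeta : unit_ball z -> S zeta ->
  symbol n (herglotz_op H z) zeta = 2 / (1 - (radius n)%:C%C * herm z zeta) - 1.
Proof.
move=> hz Sz; have hp := point_ball n Sz.
rewrite /symbol (kerzE hp) -evE herglotz_opE evB evZ ev_res // !evE dot_ker /= hermzz.
have -> : bilin z (point n zeta) = (radius n)%:C%C * herm z zeta.
  by rewrite /bilin /herm mulr_sumr; apply: eq_bigr => j _; rewrite !mxE; ring.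
rewrite bnorm_point; move/unit_sphereP : Sz => Sz; rewrite Sz mulr1.
have /andP[r0 r1] := radius_bounds n.
have -> : 1 - (radius n ^+ 2)%:C%C = (1 - radius n ^+ 2)%:C%C :> C by rewrite rmorphB.
have h1 : ((1 - radius n ^+ 2)%:C%C : C) != 0.
  by apply/eqP => /complexI h; have := expr_lt1 (ltn0Sn 1) (ltW r0); rewrite r1 -subr_gt0 h ltxx.
set c := (1 - radius n ^+ 2)%:C%C in h1 *; move: c h1 => c c0.
have h2 : nrm ((radius n)%:C%C * herm z zeta) < 1.
  rewrite nrmM nrmR gtr0_norm //; have := herm_le z zeta; rewrite Sz mulr1.
  move/unit_ballP : hz => hz; have := nrm_ge0 (herm z zeta); nra.
by field; rewrite c0 one_sub_neq0.
Qed.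

(** For H(z,S) the averages do converge: its symbols tend to the Herglotz kernel uniformly on the
    sphere, with error at most K / (n + 2). *)
Lemma rho_mu_herglotz z : unit_ball z ->
  rho_mu (herglotz_op H z) =
  cintegral mu S (fun zeta => (1 + herm z zeta) / (1 - herm z zeta)).
Proof.
move=> hz; set g := fun zeta => _.
have bH := alg_bounded (toeplitz_Cstar H) (@toeplitz_herglotz _ _ H _ hz).
have [M M0 nH] := symbol_bound bH.
have ng := herglotz_kernel_nice hz; rewrite -/g in ng.
have z1 : bnorm z < 1 by apply/unit_ballP.
have z0 : 0 < 1 - bnorm z by rewrite subr_gt0.
pose K := 2 / (1 - bnorm z) ^+ 2.
have K0 : 0 <= K by rewrite divr_ge0 // sqr_ge0.
have close n zeta : S zeta -> nrm (- 1 * g zeta + symbol n (herglotz_op H z) zeta) <= K / n.+2%:R.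
  move=> Sz; rewrite symbol_herglotz // /g; move/unit_sphereP : Sz => Sz.
  have /andP[r0 r1] := radius_bounds n.
  have h1 : nrm (herm z zeta) <= bnorm z by have := herm_le z zeta; rewrite Sz mulr1.
  have h2 : nrm ((radius n)%:C%C * herm z zeta) <= bnorm z.
    by rewrite nrmM nrmR gtr0_norm // (le_trans _ h1) // ler_piMl ?nrm_ge0 // ltW.
  have a1 := one_sub_neq0 (le_lt_trans h1 z1); have a2 := one_sub_neq0 (le_lt_trans h2 z1).
  have -> : -1 * ((1 + herm z zeta) / (1 - herm z zeta)) +
       (2 / (1 - (radius n)%:C%C * herm z zeta) - 1) =
      2%:R * ((1 - (radius n)%:C%C * herm z zeta)^-1 - (1 - herm z zeta)^-1).
    by field; rewrite a1 a2.
  rewrite nrmM nrm_nat.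
  have := inv_sub_le z1 h2 h1.
  have -> : (radius n)%:C%C * herm z zeta - herm z zeta = - (n.+2%:R^-1)%:C%C * herm z zeta.
    by rewrite /radius rmorphB rmorph1; ring.
  rewrite nrmM nrmN nrmR ger0_norm ?invr_ge0 // => h3.
  have h4 : n.+2%:R^-1 * nrm (herm z zeta) / (1 - bnorm z) ^+ 2 <= n.+2%:R^-1 / (1 - bnorm z) ^+ 2.
    rewrite ler_wpM2r ?invr_ge0 ?sqr_ge0 // ler_piMr ?invr_ge0 //.
    by apply: le_trans h1 (ltW z1).
  have := le_trans h3 h4.
  rewrite /K; move: (n.+2%:R^-1) ((1 - bnorm z) ^+ 2)^-1 => ? ?; lra.
have nd n : nice (fun zeta => - 1 * g zeta + symbol n (herglotz_op H z) zeta) (K / n.+2%:R).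
  have [m1 m2 _] := nice_lin (-1) ng (nH n); split => //; exact: close.
have E n : rho_n n (herglotz_op H z) - cintegral mu S g =
    cintegral mu S (fun zeta => - 1 * g zeta + symbol n (herglotz_op H z) zeta).
  by rewrite (cintegral_lin mu (-1) ng (nH n)) mulN1r addrC.
have m0 : 0 <= mass mu.
  by rewrite /mass fine_ge0.
have lim (h : nat -> R) (l : R) : (forall n, `|h n - l| <= K / n.+2%:R * mass mu) -> h @ \oo --> l.
  move=> hl; apply/cvgrPdist_lt => e e0.
  have : 0 < e / (K * mass mu + 1) by rewrite divr_gt0 // ltr_wpDl // mulr_ge0.
  move=> /inv_nat_lt[N hN]; exists N => // n /= Nn; rewrite distrC.
  apply: le_lt_trans (hl n) _.
  have Km := mulr_ge0 K0 m0.
  have := hN n.+1 (leqW Nn); rewrite ltr_pdivlMr; last by rewrite ltr_wpDl.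
  have : 0 <= (n.+2%:R : R)^-1 by rewrite invr_ge0.
  by move: (n.+2%:R^-1) => t; lra.
apply: eq_ReIm; apply: ulim_eq; apply: lim => n.
  by rewrite -ReN -ReD E; exact: (cintegral_bound mu (nd n)).1.
by rewrite -ImN -ImD E; exact: (cintegral_bound mu (nd n)).2.
Qed.

End MplusRplus.

(** The third clause is what separates M+ from R+: a nonnegative real part at the kernel vectors
    alone suffices, which is weaker than at all vectors. The model is arbitrary, so that the
    functional can be compared with one given on the same space. *)
Lemma Mplus_rep (R : realType) (d : nat) (H : rkhs (@da_kernel R d)) f : Mplus R d f ->
  exists (rho : (H -> H) -> R[i]) (t : R),
  [/\ positive_functional (rkhs_dot H) (toeplitz_algebra H) rho,
      forall z, unit_ball z -> f z = rho (herglotz_op H z) + (0 +i* t)%C &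
      forall T, bounded_op T ->
       (forall u, 0 <= complex.Re (rkhs_dot H (T (rkhs_ker H u)) (rkhs_ker H u))) ->
       0 <= complex.Re (rho T)].
Proof.
move=> [mu [t fE]]; exists (rho_mu mu), t; split.
- split=> [a S T AS AT|S S' AS AS' hS].
    by apply: rho_mu_lin; exact: (alg_bounded (toeplitz_Cstar H)).
  by apply: rho_mu_positive => //; exact: (alg_bounded (toeplitz_Cstar H)).
- by move=> z hz; rewrite fE // rho_mu_herglotz.
- move=> T bT hT; apply: rho_mu_Re_ge0 => // w hw; rewrite (kerzE H hw); exact: hT.
Qed.

Lemma Mplus_sub_Rplus (R : realType) (d : nat) : Mplus R d `<=` Rplus R d.
Proof.
move=> f /(Mplus_rep (@drury_arveson R d))[rho [t [rhoP fE _]]].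
by exists (@drury_arveson R d), rho, t.
Qed.

(** * Strictness of the inclusions *)

Section Example.
Context {R : realType} {d : nat}.
Local Notation C := R[i].
Local Notation B := (set_type (@unit_ball R d)).
Variables (i j : 'I_d).
Hypothesis ij : i != j.
Implicit Types z w : 'rV[C]_d.

Lemma bnorm2_ge_pair z : nrm (z 0 i) ^+ 2 + nrm (z 0 j) ^+ 2 <= bnorm z ^+ 2.
Proof.
rewrite bnorm2 (bigD1 i) //= (bigD1 j) 1?eq_sym //= addrA lerDl.
by apply: sumr_ge0 => k _; exact: sqr_ge0.
Qed.

Definition plane (x y : C) : 'rV[C]_d := \row_k (if k == i then x else if k == j then y else 0).

Lemma plane_i x y : plane x y 0 i = x.
Proof. by rewrite mxE eqxx. Qed.
Lemma plane_j x y : plane x y 0 j = y.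
Proof. by rewrite mxE eq_sym (negPf ij) eqxx. Qed.

Lemma herm_plane z x y : herm z (plane x y) = z 0 i * x^* + z 0 j * y^*.
Proof.
rewrite /herm (bigD1 i) //= (bigD1 j) 1?eq_sym //= plane_i plane_j big1 ?addr0 // => k.
by case/andP => /negPf ki /negPf kj; rewrite mxE ki kj rmorph0 mulr0.
Qed.

Lemma plane_ball x y : nrm x ^+ 2 + nrm y ^+ 2 < 1 -> unit_ball (plane x y).
Proof.
move=> h; rewrite /unit_ball /= herm_plane plane_i plane_j !nrm_sqrC -rmorphD.
by rewrite (_ : (1 : C) = 1%:C%C) // ltcR.
Qed.

Variables (a b : C).
Hypotheses (a1 : nrm a <= 1) (b1 : nrm b <= 1).

Definition quad z : C := a * z 0 i ^+ 2 + b * z 0 j ^+ 2.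

Definition cayley z : C := (1 + quad z) / (1 - quad z).

Lemma quad_lt1 z : unit_ball z -> nrm (quad z) < 1.
Proof.
move=> /unit_ballP hz; have h : bnorm z ^+ 2 < 1 by rewrite expr_lt1 ?bnorm_ge0.
apply: le_lt_trans h; apply: le_trans (bnorm2_ge_pair z).
have e (c x : C) : nrm c <= 1 -> nrm (c * x ^+ 2) <= nrm x ^+ 2.
  by move=> c1; rewrite nrmM nrmX ler_piMl ?exprn_ge0 ?nrm_ge0.
by rewrite (le_trans (nrmD _ _)) // lerD // e.
Qed.

Lemma cayley_Oplus : Oplus R d cayley.
Proof.
split=> [z hz|z hz].
  have q1 := one_sub_neq0 (quad_lt1 hz).
  have dc k : differentiable (fun z : 'rV[C]_d => z 0 k : C) z by exact: differentiable_coord.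
  have dq : differentiable (quad : 'rV[C]_d -> C) z.
    apply: (@differentiableD _ _ _ (fun z => a * z 0 i ^+ 2) (fun z => b * z 0 j ^+ 2)).
      apply: (@differentiableM _ _ (fun=> a) (fun z => z 0 i ^+ 2)); first exact: differentiable_cst.
      exact: (@differentiableM _ _ (fun z => z 0 i) (fun z => z 0 i)).
    apply: (@differentiableM _ _ (fun=> b) (fun z => z 0 j ^+ 2)); first exact: differentiable_cst.
    exact: (@differentiableM _ _ (fun z => z 0 j) (fun z => z 0 j)).
  apply: (@differentiableM _ _ (fun z => 1 + quad z) (fun z => (1 - quad z)^-1)).
    exact: (differentiableD (differentiable_cst (1 : C) z) dq).
  have dB := differentiableB (differentiable_cst (1 : C) z) dq.
  exact: (@differentiableV _ _ (fun z => 1 - quad z) z dB q1).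
have := quad_lt1 hz; rewrite /cayley; move: (quad z) => q q1.
have n0 : 0 < nrm (1 - q) ^+ 2.
  rewrite exprn_gt0 // lt_neqAle nrm_ge0 andbT eq_sym.
  by apply/eqP => /nrm0_eq0/eqP; exact/negP/one_sub_neq0.
(* Multiplication by the conjugate of the denominator shows that the real part is (1 - |q|^2) / |1 -
   q|^2. *)
have E : (1 + q) / (1 - q) = ((nrm (1 - q) ^+ 2)^-1)%:C%C * ((1 + q) * (1 - q)^*).
  have -> : ((nrm (1 - q) ^+ 2)^-1)%:C%C = ((1 - q) * (1 - q)^*)^-1.
    by rewrite nrm_sqrC fmorphV.
  have h1 := one_sub_neq0 q1.
  have h2 : (1 - q)^* != 0 by rewrite fmorph_eq0.
  by move: (1 - q)^* h2 => c c0; field; rewrite h1 c0.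
rewrite E ReRM mulr_ge0 ?invr_ge0 ?sqr_ge0 //.
have : 0 <= 1 - nrm q ^+ 2 by rewrite subr_ge0 expr_le1 ?nrm_ge0 // ltW.
rewrite nrm_sqr !(ReM, ReJ, ImJ, ReD, ImD, ReN, ImN) /=; lra.
Qed.

End Example.

(** * A function of O+ outside S+ *)

Section NotSplus.
Context {R : realType} {d : nat}.
Local Notation C := R[i].
Local Notation B := (set_type (@unit_ball R d)).
Variables (i j : 'I_d).
Hypothesis ij : i != j.

(* On the points (s, it) with s, t real, the kernel is real. *)
Definition real_kernel (p q : R * R) : R :=
  ((1 + (p.1 ^+ 2 - p.2 ^+ 2)) / (1 - (p.1 ^+ 2 - p.2 ^+ 2)) +
   (1 + (q.1 ^+ 2 - q.2 ^+ 2)) / (1 - (q.1 ^+ 2 - q.2 ^+ 2))) / (1 - (p.1 * q.1 + p.2 * q.2)).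

Definition real_point (p : R * R) : 'rV[C]_d := plane i j p.1%:C%C ('i%C * p.2%:C%C).

Lemma cayley_real_point p : cayley i j 1 1 (real_point p) =
  ((1 + (p.1 ^+ 2 - p.2 ^+ 2)) / (1 - (p.1 ^+ 2 - p.2 ^+ 2)))%:C%C.
Proof.
rewrite /cayley /quad /real_point plane_i (plane_j ij) !mul1r exprMn sqr_i mulN1r.
by rewrite rmorphM fmorphV rmorphD !rmorphB rmorph1 !rmorphXn.
Qed.

Lemma herm_real_point p q : herm (real_point p) (real_point q) = (p.1 * q.1 + p.2 * q.2)%:C%C.
Proof.
rewrite /real_point (herm_plane ij) plane_i (plane_j ij).
by apply: eq_ReIm; rewrite !(ReD, ImD, ReM, ImM, ReJ, ImJ) /=; ring.
Qed.

Lemma real_kernelE p q :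
  (cayley i j 1 1 (real_point p) + (cayley i j 1 1 (real_point q))^*) /
    (1 - herm (real_point p) (real_point q)) = (real_kernel p q)%:C%C.
Proof.
rewrite !cayley_real_point herm_real_point conjRC /real_kernel.
by rewrite -rmorphD -(rmorph1 (@real_complex_def R (Phant R))) -rmorphB -fmorphV -rmorphM.
Qed.

Lemma real_kernel_sum (l : seq (R * (R * R))) : Splus R d (cayley i j 1 1) ->
  (forall p, p \in l -> p.2.1 ^+ 2 + p.2.2 ^+ 2 < 1) ->
  0 <= \sum_(p <- l) \sum_(q <- l) p.1 * q.1 * real_kernel p.2 q.2.
Proof.
move=> [_ psd] hl.
have hB p : p \in l -> unit_ball (real_point p.2).
  move=> /hl h; apply: (plane_ball ij); rewrite nrmM nrm_i mul1r !nrmR.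
  by rewrite !real_normK ?num_real.
have u0 : B by exists 0; rewrite inE; exact: unit_ball0.
have := psd_seq [seq (p.1%:C%C, insubd u0 (real_point p.2)) | p <- l] psd.
rewrite big_map -ler0c rmorph_sum; congr (0 <= _).
apply: eq_big_seq => p pl; rewrite big_map rmorph_sum; apply: eq_big_seq => q ql /=.
have -> : (p.1 * q.1 * real_kernel p.2 q.2)%:C%C =
    p.1%:C%C * q.1%:C%C * (real_kernel p.2 q.2)%:C%C :> C by rewrite !rmorphM.
rewrite conjRC -real_kernelE /=.
by rewrite !insubdK // inE; exact: hB.
Qed.

(** The weights 1, 1, -1, -1 at (1/2, 0), (-1/2, 0), (0, i/2), (0, -i/2) cancel degrees 0 and 1 in
    the combination of kernel functions and leave a multiple of z_i^2 + z_j^2 in degree 2; the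
    origin adds a constant. With weight t at the origin the sum is 2 t^2 + (64/15) t + 272/225,
    minimal at t = -16/15, where its value is again -16/15. *)
Lemma cayley11_not_Splus : ~ Splus R d (cayley i j 1 1).
Proof.
pose P0 : R * R := (0, 0); pose P1 : R * R := (1 / 2, 0); pose P2 : R * R := (- (1 / 2), 0).
pose P3 : R * R := (0, 1 / 2); pose P4 : R * R := (0, - (1 / 2)).
move=> /(@real_kernel_sum [:: (- (16 / 15), P0); (1, P1); (1, P2); (-1, P3); (-1, P4)]).
have symK p q : real_kernel p q = real_kernel q p.
  by rewrite /real_kernel [X in X / _]addrC (mulrC p.1) (mulrC p.2).
have K00 : real_kernel P0 P0 = 2 by rewrite /real_kernel /=; field.
have K01 : real_kernel P0 P1 = 8 / 3 by rewrite /real_kernel /=; field.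
have K02 : real_kernel P0 P2 = 8 / 3 by rewrite /real_kernel /=; field.
have K03 : real_kernel P0 P3 = 8 / 5 by rewrite /real_kernel /=; field.
have K04 : real_kernel P0 P4 = 8 / 5 by rewrite /real_kernel /=; field.
have K11 : real_kernel P1 P1 = 40 / 9 by rewrite /real_kernel /=; field.
have K22 : real_kernel P2 P2 = 40 / 9 by rewrite /real_kernel /=; field.
have K12 : real_kernel P1 P2 = 8 / 3 by rewrite /real_kernel /=; field.
have K13 : real_kernel P1 P3 = 34 / 15 by rewrite /real_kernel /=; field.
have K14 : real_kernel P1 P4 = 34 / 15 by rewrite /real_kernel /=; field.
have K23 : real_kernel P2 P3 = 34 / 15 by rewrite /real_kernel /=; field.
have K24 : real_kernel P2 P4 = 34 / 15 by rewrite /real_kernel /=; field.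
have K33 : real_kernel P3 P3 = 8 / 5 by rewrite /real_kernel /=; field.
have K44 : real_kernel P4 P4 = 8 / 5 by rewrite /real_kernel /=; field.
have K34 : real_kernel P3 P4 = 24 / 25 by rewrite /real_kernel /=; field.
rewrite !big_cons !big_nil /= !(symK _ P0) (symK P2 P1) !(symK P3 P1) !(symK P3 P2).
rewrite !(symK P4 P1) !(symK P4 P2) !(symK P4 P3).
rewrite !(K00, K01, K02, K03, K04, K11, K12, K13, K14, K22, K23, K24, K33, K34, K44).
move=> h; have : (0 : R) <= - (16 / 15); last by lra.
apply: le_trans (h _) _; last by lra.
by move=> p; rewrite !inE => /or4P[/eqP->|/eqP->|/eqP->|/orP[]/eqP->] /=; lra.
Qed.

End NotSplus.

(** * A family of functions of S+ *)

Section SplusExample.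
Context {R : realType} {d : nat}.
Local Notation C := R[i].
Local Notation B := (set_type (@unit_ball R d)).
Variables (i j : 'I_d).
Hypothesis ij : i != j.

Lemma psd_sum {X : Type} (I : Type) (s : seq I) (P : pred I) (K : I -> X -> X -> C) :
  (forall t, psd_kernel (K t)) -> psd_kernel (fun x y => \sum_(t <- s | P t) K t x y).
Proof.
move=> hK n x a.
have -> : \sum_k \sum_l a k * (a l)^* * (\sum_(t <- s | P t) K t (x k) (x l)) =
    \sum_(t <- s | P t) \sum_k \sum_l a k * (a l)^* * K t (x k) (x l).
  rewrite [RHS]exchange_big; apply: eq_bigr => k _.
  rewrite [RHS]exchange_big; apply: eq_bigr => l _.
  by rewrite mulr_sumr.
by apply: sumr_ge0 => t _; exact: hK.
Qed.

Lemma psd_da_kernel : psd_kernel (@da_kernel R d).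
Proof.
move=> n x a.
have := sqr_ge0 (nrm (\sum_l (a l)^* *: rkhs_ker (@drury_arveson R d) (x l))).
rewrite -ler0c -(dotxx (@rkhs_normE _ _ _ (@drury_arveson R d))) dot_suml.
congr (0 <= _); rewrite [RHS]exchange_big; apply: eq_bigr => l _.
rewrite dot_sumr; apply: eq_bigr => k _.
by rewrite dotZl dotZr conjCK dot_ker /da_kernel; ring.
Qed.

Lemma psd_one {X : Type} : psd_kernel (fun x y : X => 1 : C).
Proof.
have := @psd_gram R X unit [:: tt] (fun _ _ => 1).
by congr psd_kernel; apply/funext => x; apply/funext => y; rewrite big_seq1 rmorph1 mulr1.
Qed.

Variables (a b : R).
Hypothesis ab : a ^+ 2 + b ^+ 2 = 1.
Local Notation f := (cayley i j a%:C%C b%:C%C).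
Local Notation q := (quad i j a%:C%C b%:C%C).

Lemma ab_le1 : nrm (a%:C%C : C) <= 1 /\ nrm (b%:C%C : C) <= 1.
Proof.
have h (c : R) : c ^+ 2 <= 1 -> `|c| <= 1.
  by move=> c1; rewrite -(@ler_pXn2r _ 2) ?nnegrE // expr1n real_normK ?num_real.
by rewrite !nrmR; split; apply: h; rewrite -ab ?lerDl ?lerDr sqr_ge0.
Qed.

(* The difference <z,w>^2 - q(z) q(w)^* is a sum of squares because (a, b) is a unit vector. *)
Lemma psd_quad_defect : psd_kernel (fun z w : B =>
  (1 - q (val z) * (q (val w))^*) * da_kernel z w).
Proof.
pose c k (z : B) := val z 0 k.
(* Write s = <z,w>, T for its part over the indices other than i and j, and a prime for conjugate
   values at w. Then (1 - q q') / (1 - s) is 1 + s plus (s^2 - q q') / (1 - s), and s^2 - q q' = T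
   (s + z_i w_i' + z_j w_j') + h h' + 2 m m'. [L0] is s and [L3] carries the T term. *)
pose h (z : B) := b%:C%C * c i z ^+ 2 - a%:C%C * c j z ^+ 2.
pose m (z : B) := c i z * c j z.
pose K := @da_kernel R d.
pose mulc k (L : B -> B -> C) z w := c k z * (c k w)^* * L z w.
have pK : psd_kernel K := psd_da_kernel.
have pm k L : psd_kernel L -> psd_kernel (mulc k L) by exact: psd_conj.
pose L1 z w := \sum_(k <- index_enum 'I_d | true) mulc k K z w.
pose L2 z w := (L1 z w + mulc i K z w) + mulc j K z w.
pose L3 z w := \sum_(k <- index_enum 'I_d | (k != i) && (k != j)) mulc k L2 z w.
have p1 : psd_kernel L1 by apply: psd_sum => k; exact: pm.
have p2 : psd_kernel L2 by apply: psd_add; [apply: psd_add|]; rewrite // /L2; apply: pm.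
have p3 : psd_kernel L3 by apply: psd_sum => k; exact: pm.
pose L0 z w := \sum_(k <- index_enum 'I_d | true) mulc k (fun _ _ => 1) z w.
have p0 : psd_kernel L0 by apply: psd_sum => k; apply: pm; exact: psd_one.
have p4 := psd_conj h pK; have p5 := psd_conj m pK.
have := psd_add (psd_add (psd_add psd_one p0) p3) (psd_add p4 (psd_add p5 p5)).
congr psd_kernel; apply/funext => z; apply/funext => w.
have k0 : 1 - herm (val z) (val w) != 0 by exact: herm_neq0.
have herm_sum : \sum_(k < d) c k z * (c k w)^* = herm (val z) (val w) by [].
pose T := \sum_(k < d | (k != i) && (k != j)) c k z * (c k w)^*.
have hT : herm (val z) (val w) = c i z * (c i w)^* + (c j z * (c j w)^* + T).
  by rewrite -herm_sum (bigD1 i) //= (bigD1 j) 1?eq_sym.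
have E0 : L0 z w = herm (val z) (val w).
  by rewrite -herm_sum; apply: eq_bigr => k _; rewrite /mulc mulr1.
have E1 : L1 z w = herm (val z) (val w) * K z w.
  by rewrite -herm_sum mulr_suml.
have E3 : L3 z w = T * L2 z w by rewrite mulr_suml.
rewrite E0 E3 /L2 E1 /mulc /K /da_kernel /quad /h /m -/(c i z) -/(c i w) -/(c j z) -/(c j w).
rewrite hT in k0 *; clear hT E3; clearbody T.
have abC : (a%:C%C : C) ^+ 2 + b%:C%C ^+ 2 = 1 by rewrite -!rmorphXn -rmorphD ab.
rewrite !(rmorphB, rmorphD, rmorphM, rmorphXn) /= !conjRC.
move: (c i z) (c i w)^* (c j z) (c j w)^* (a%:C%C : C) (b%:C%C : C) abC k0 => x x' y y' A A' abC k0.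
have E : (A' * x ^+ 2 - A * y ^+ 2) * (A' * x' ^+ 2 - A * y' ^+ 2) =
    x ^+ 2 * x' ^+ 2 + y ^+ 2 * y' ^+ 2 -
    (A * x ^+ 2 + A' * y ^+ 2) * (A * x' ^+ 2 + A' * y' ^+ 2).
  transitivity ((A ^+ 2 + A' ^+ 2) * (x ^+ 2 * x' ^+ 2 + y ^+ 2 * y' ^+ 2) -
    (A * x ^+ 2 + A' * y ^+ 2) * (A * x' ^+ 2 + A' * y' ^+ 2)); first by ring.
  by rewrite abC mul1r.
rewrite E; move: ((A * x ^+ 2 + _) * _) => Q.
by field.
Qed.

(** With u = q(z) and v the conjugate of q(w), (1 + u) / (1 - u) + (1 + v) / (1 - v) = 2 (1 - u v) /
    ((1 - u) (1 - v)), so the kernel is twice the defect kernel rescaled by 1 / (1 - q). *)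
Lemma cayley_Splus : Splus R d f.
Proof.
have [a1 b1] := ab_le1.
split; first by have [] := cayley_Oplus ij a1 b1.
pose g (z : B) := (1 - q (val z))^-1.
have := psd_add (psd_conj g psd_quad_defect) (psd_conj g psd_quad_defect).
congr psd_kernel; apply/funext => z; apply/funext => w.
have hz := one_sub_neq0 (quad_lt1 ij a1 b1 (valB z)).
have hw : 1 - (q (val w))^* != 0.
  by apply: one_sub_neq0; rewrite nrm_conj; exact: (quad_lt1 ij a1 b1 (valB w)).
have k0 : 1 - herm (val z) (val w) != 0 by exact: herm_neq0.
rewrite /g /da_kernel /cayley; move: (q (val z)) (q (val w)) hz hw => u v hz hw.
rewrite !(fmorphV, rmorphM, rmorphB, rmorphD, rmorph1) /=; move: v^* hw => v' hw.
by field; rewrite hz hw k0.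
Qed.

End SplusExample.

(** * Second-order Taylor coefficients at the origin *)

Section SecondOrder.
Context {R : realType} {d : nat}.
Local Notation C := R[i].
Variable H : rkhs (@da_kernel R d).
Local Notation dot := (rkhs_dot H).
Local Notation normE := (rkhs_normE (r := H)).
Local Notation T_d := (toeplitz_algebra H).
Local Notation TC := (toeplitz_Cstar H).
Local Notation shift := (@Defs.shift _ _ H).
Variable rho : (H -> H) -> C.
Hypothesis rhoP : positive_functional dot T_d rho.
Variables (f : 'rV[C]_d -> C) (c : C).
Hypothesis fE : forall z, unit_ball z -> f z = rho (herglotz_op H z) + c.

Definition axis (k : 'I_d) (l : R) : 'rV[C]_d := \row_m (if m == k then l%:C%C else 0).

Lemma bnorm_axis k l : bnorm (axis k l) = `|l|.
Proof.
rewrite /bnorm (bigD1 k) //= mxE eqxx nrmR big1 ?addr0 ?sqrtr_sqr ?normr_id // => m /negPf mk.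
by rewrite mxE mk nrm0 expr0n.
Qed.

Lemma mulz_axis k l (x : H) : mulz (axis k l) x = l%:C%C *: shift k x.
Proof.
rewrite /mulz (bigD1 k) //= mxE eqxx big1 ?addr0 // => m /negPf mk.
by rewrite mxE mk scale0r.
Qed.

Lemma axis_ball k l : `|l| <= 1 / 2 -> unit_ball (axis k l).
Proof. by move=> hl; apply/unit_ballP; rewrite bnorm_axis; lra. Qed.

Let SS k := shift k \o shift k.
Let Rem k l := shift k \o (shift k \o (shift k \o res (H := H) (axis k l))).

Lemma toeplitz_SS k : T_d (SS k).
Proof. by apply: (alg_comp TC); exact: toeplitz_shift. Qed.

Lemma toeplitz_Rem k l : `|l| <= 1 / 2 -> T_d (Rem k l).
Proof.
move=> /(axis_ball k) hb; have [AR _ _] := resP H hb.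
by do 3! (apply: (alg_comp TC); first exact: toeplitz_shift).
Qed.

(** The relation res = 1 + l S_k res on the k-th axis, unfolded three times. *)
Lemma f_axis k l : `|l| <= 1 / 2 -> f (axis k l) =
  rho id + c + 2 * (l%:C%C * rho (shift k) + l%:C%C ^+ 2 * rho (SS k) + l%:C%C ^+ 3 * rho (Rem k l)).
Proof.
move=> hl; have hb := axis_ball k hl; have [AR h _] := resP H hb.
have ARem := toeplitz_Rem k hl; have ASS := toeplitz_SS k.
have AS : T_d (shift k) by exact: toeplitz_shift.
have bS := alg_bounded TC AS.
have RE : forall x, res (axis k l) x =
    x + l%:C%C *: shift k x + l%:C%C ^+ 2 *: SS k x + l%:C%C ^+ 3 *: Rem k l x.
  move=> x; rewrite /SS /Rem /=; set a : C := l%:C%C; set r := res _ x.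
  have hr : r = x + a *: shift k r by rewrite -mulz_axis -[X in _ = X + _](h x) -/r subrK.
  have h2 : shift k r = shift k x + a *: shift k (shift k r).
    by rewrite {1}hr (bopD _ _ bS) (bopZ _ _ bS).
  have h3 : shift k (shift k r) = shift k (shift k x) + a *: shift k (shift k (shift k r)).
    by rewrite {1}h2 (bopD _ _ bS) (bopZ _ _ bS).
  rewrite {1}hr [in LHS]h2 [in LHS]h3; move: (shift k (shift k (shift k r))) (shift k (shift k x)) (shift k x) => u v w.
  by vector_ring (rkhs_normE (r := H)).
have A3 : T_d (fun x => l%:C%C ^+ 3 *: Rem k l x) by exact: (alg_scale TC).
have A2 : T_d (fun x => l%:C%C ^+ 2 *: SS k x) by exact: (alg_scale TC).
have A1 : T_d (fun x => l%:C%C *: shift k x) by exact: (alg_scale TC).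
have A01 : T_d (fun x => x + l%:C%C *: shift k x) by exact: (alg_add TC (alg_id TC) A1).
have A012 := alg_add TC A01 A2.
rewrite fE // herglotz_opE (rho_sub rhoP (alg_scale TC _ AR) (alg_id TC)) (rho_scale TC rhoP) //.
have -> : res (axis k l) = (fun x => x + l%:C%C *: shift k x + l%:C%C ^+ 2 *: SS k x +
    l%:C%C ^+ 3 *: Rem k l x) by apply/funext.
rewrite (rho_add rhoP A012 A3) (rho_add rhoP A01 A2) (rho_add rhoP (alg_id TC) A1).
by rewrite !(rho_scale TC rhoP) //; ring.
Qed.

(** Adding the values at l and - l removes the terms in l and isolates the value at S_k^2. For |l|
    <= 1/2 the resolvent has norm at most 2, so each remainder is at most 4 rho 1, and the
    combination 2 l^3 (v - v') at most 16 rho 1 l^3. *)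
Lemma second_order k : exists2 K : R, 0 <= K & forall l : R, 0 < l <= 1 / 2 ->
  nrm (f (axis k l) + f (axis k (- l)) - 2 * (rho id + c) - 4 * l%:C%C ^+ 2 * rho (SS k)) <= K * l ^+ 3.
Proof.
have r0 := rho_id normE TC rhoP.
have rr0 : 0 <= complex.Re (rho id) by move: r0; rewrite ge0cE => /andP[].
exists (16 * complex.Re (rho id)); first by rewrite mulr_ge0.
move=> l /andP[l0 l1].
have bR (m : R) : `|m| <= 1 / 2 -> nrm (rho (Rem k m)) <= 4 * complex.Re (rho id).
  move=> hm; have -> : 4 * complex.Re (rho id) = 2 * complex.Re (rho id) * 2 by ring.
  apply: (rho_bound normE TC rhoP) => //; first exact: toeplitz_Rem.
  move=> x; rewrite /Rem /= !(le_trans (shift_le _ _)) //.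
  rewrite (le_trans (res_le _ (axis_ball k hm))) // bnorm_axis mulrC.
  rewrite ler_wpM2r ?nrm_ge0 // -[leRHS]invrK lef_pV2 ?posrE ?invr_gt0 //; lra.
have h1 : `|l| <= 1 / 2 by rewrite gtr0_norm.
have h2 : `|- l| <= 1 / 2 by rewrite normrN.
rewrite (f_axis k h1) (f_axis k h2).
set L : C := l%:C%C.
have -> : (- l)%:C%C = - L by rewrite rmorphN.
have even (w s u v v' : C) : w + 2 * (L * s + L ^+ 2 * u + L ^+ 3 * v) +
    (w + 2 * (- L * s + (- L) ^+ 2 * u + (- L) ^+ 3 * v')) - 2 * w - 4 * L ^+ 2 * u =
    2%:R * (L ^+ 3 * (v - v')) by ring.
rewrite even.
rewrite nrmM nrm_nat nrmM nrmX nrmR gtr0_norm //.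
have h := le_trans (nrmB _ _) (lerD (bR l h1) (bR (- l) h2)).
have l3 : 0 <= l ^+ 3 by rewrite exprn_ge0 // ltW.
have := ler_wpM2l l3 h; lra.
Qed.

End SecondOrder.

Lemma second_order_uniq {R : realType} (F : R -> R[i]) (u v : R[i]) (K K' : R) : 0 <= K -> 0 <= K' ->
  (forall l : R, 0 < l <= 1 / 2 -> nrm (F l - 4 * l%:C%C ^+ 2 * u) <= K * l ^+ 3) ->
  (forall l : R, 0 < l <= 1 / 2 -> nrm (F l - 4 * l%:C%C ^+ 2 * v) <= K' * l ^+ 3) -> u = v.
Proof.
move=> K0 K'0 hu hv; apply/eqP; rewrite -subr_eq0; apply/eqP/nrm0_eq0/eqP.
rewrite eq_le nrm_ge0 andbT; apply: (@le_eps _ _ _ (K + K')); first exact: addr_ge0.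
move=> e e0; rewrite add0r; pose l := Num.min e (1 / 2).
have l0 : 0 < l by rewrite lt_min e0 divr_gt0.
have l1 : 0 < l <= 1 / 2 by rewrite l0 ge_min lexx orbT.
have le : l <= e by rewrite ge_min lexx.
have h : 4 * l ^+ 2 * nrm (u - v) <= (K + K') * l ^+ 3.
  have <- : nrm (4%:R * l%:C%C ^+ 2 * (u - v)) = 4 * l ^+ 2 * nrm (u - v).
    by rewrite nrmM nrmM nrmX nrmR gtr0_norm // nrm_nat.
  have -> : 4%:R * l%:C%C ^+ 2 * (u - v) =
      (F l - 4 * l%:C%C ^+ 2 * v) - (F l - 4 * l%:C%C ^+ 2 * u) by ring.
  have := nrmB (F l - 4 * l%:C%C ^+ 2 * v) (F l - 4 * l%:C%C ^+ 2 * u).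
  have := hu l l1; have := hv l l1; lra.
have l2 : 0 < l ^+ 2 by rewrite exprn_gt0.
have h' : 4 * nrm (u - v) <= (K + K') * l.
  by rewrite -(ler_pM2l l2); move: h; rewrite exprS; lra.
have := ler_wpM2l (addr_ge0 K0 K'0) le; have := nrm_ge0 (u - v); lra.
Qed.

(** * A function of S+ outside R+ *)

Section NotRplus.
Context {R : realType} {d : nat}.
Local Notation C := R[i].
Variables (i j : 'I_d).
Hypothesis ij : i != j.
Variables (a b : R).
Hypothesis ab : a ^+ 2 + b ^+ 2 = 1.
Hypotheses (a0 : a != 0) (b0 : b != 0).
Local Notation f := (cayley i j a%:C%C b%:C%C).

Lemma cayley_second_order (c : R) (F : R -> C) : `|c| <= 1 ->
  (forall l : R, F l = (1 + c%:C%C * l%:C%C ^+ 2) / (1 - c%:C%C * l%:C%C ^+ 2)) ->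
  forall l : R, 0 < l <= 1 / 2 ->
  nrm (F l + F (- l) - 2 * 1 - 4 * l%:C%C ^+ 2 * c%:C%C) <= 8 * l ^+ 3.
Proof.
move=> c1 FE l /andP[l0 l1].
have -> : F (- l) = F l by rewrite !FE rmorphN /= sqrrN.
rewrite FE.
have cl : `|c * l ^+ 2| <= 1 / 4.
  rewrite normrM [`|l ^+ 2|]ger0_norm ?sqr_ge0 //; have := normr_ge0 c; nra.
have -> : (1 + c%:C%C * l%:C%C ^+ 2) / (1 - c%:C%C * l%:C%C ^+ 2) +
    (1 + c%:C%C * l%:C%C ^+ 2) / (1 - c%:C%C * l%:C%C ^+ 2) - 2 * 1 - 4 * l%:C%C ^+ 2 * c%:C%C =
    (4 * (c ^+ 2 * l ^+ 4) / (1 - c * l ^+ 2))%:C%C :> C.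
  have n0 : 1 - (c%:C%C : C) * l%:C%C ^+ 2 != 0.
    apply: one_sub_neq0; rewrite -rmorphXn -rmorphM nrmR; lra.
  rewrite !(rmorphM, fmorphV, rmorphB, rmorphXn, rmorph1, rmorph_nat) /=.
  by move: (c%:C%C : C) (l%:C%C : C) n0 => x y n0; field.
rewrite nrmR normrM normfV [in X in _ / X]ger0_norm; last first.
  by move: cl; rewrite ler_norml => /andP[]; lra.
have d0 : 1 / 2 <= 1 - c * l ^+ 2 by move: cl; rewrite ler_norml => /andP[]; lra.
rewrite ler_pdivrMr; last by lra.
have c2 : c ^+ 2 <= 1.
  by rewrite -real_normK ?num_real // expr_le1.
have l3 : 0 <= l ^+ 3 by rewrite exprn_ge0 // ltW.
have l4 := exprn_ge0 4 (ltW l0).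
rewrite ger0_norm; last by rewrite mulr_ge0 // mulr_ge0 ?sqr_ge0.
have -> : 4 * (c ^+ 2 * l ^+ 4) = 4 * (c ^+ 2 * l) * l ^+ 3 by ring.
have : c ^+ 2 * l <= 1 by have := sqr_ge0 c; nra.
nra.
Qed.

Lemma cayley_axis_i l : f (axis i l) = (1 + a%:C%C * l%:C%C ^+ 2) / (1 - a%:C%C * l%:C%C ^+ 2).
Proof. by rewrite /cayley /quad !mxE eqxx eq_sym (negPf ij) expr0n mulr0 addr0. Qed.

Lemma cayley_axis_j l : f (axis j l) = (1 + b%:C%C * l%:C%C ^+ 2) / (1 - b%:C%C * l%:C%C ^+ 2).
Proof. by rewrite /cayley /quad !mxE eqxx (negPf ij) expr0n mulr0 add0r. Qed.

Lemma herglotz0 (H : rkhs (@da_kernel R d)) : herglotz_op H 0 = id.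
Proof.
apply/funext => x; rewrite herglotz_opE.
have [_ h _] := resP H (@unit_ball0 R d).
have -> : res 0 x = x.
  rewrite -[RHS]h /mulz big1 ?subr0 // => k _; by rewrite mxE scale0r.
by rewrite scaler_nat mulr2n addrK.
Qed.

(** The five nonnegative quantities p1 - a^2, p2 - b^2, p3, p4 and 1 - (p1 + p2 + p3 + p4) add up to
    1 - a^2 - b^2 = 0. *)
Lemma squeeze (p1 p2 p3 p4 : C) : 0 <= p1 - (a ^+ 2)%:C%C -> 0 <= p2 - (b ^+ 2)%:C%C ->
  0 <= p3 -> 0 <= p4 -> 0 <= 1 - (p1 + p2 + (p3 + p4)) -> p1 - (a ^+ 2)%:C%C = 0 /\ p3 = 0.
Proof.
move=> q1 q2 h3 h4 h; have z : p1 - (a ^+ 2)%:C%C + p3 <= 0.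
  have -> : p1 - (a ^+ 2)%:C%C + p3 =
      1 - ((1 - (p1 + p2 + (p3 + p4))) + (p2 - (b ^+ 2)%:C%C) + p4) - (a ^+ 2 + b ^+ 2)%:C%C.
    by rewrite rmorphD /=; ring.
  by rewrite ab rmorph1 addrAC subrr sub0r oppr_le0 (addr_ge0 (addr_ge0 h q2)).
have z0 : p1 - (a ^+ 2)%:C%C + p3 = 0 by apply: le_anti; rewrite z addr_ge0.
by move/eqP: z0; rewrite paddr_eq0 // => /andP[/eqP-> /eqP->].
Qed.

Lemma cayley_not_Rplus : ~ Rplus R d f.
Proof.
move=> [H [rho [t [rhoP fE]]]].
have normE := rkhs_normE (r := H).
have TC := toeplitz_Cstar H.
pose dot := rkhs_dot H.
have [a1 b1] := ab_le1 ab; rewrite !nrmR in a1 b1.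
have f0 : f 0 = 1 by rewrite /cayley /quad !mxE expr0n /= !mulr0 addr0 addr0 subr0 divr1.
have f0' : rho id + (0 +i* t)%C = 1.
  by rewrite -f0 fE; [rewrite herglotz0 | exact: unit_ball0].
(* The value at the identity is real, so the real part of f(0) = 1 determines it. *)
have rid : rho id = 1.
  have r0 := ge0c_Re (rho_id normE TC rhoP).
  have := congr1 (@complex.Re R) f0'; rewrite ReD /= addr0 => h.
  by rewrite r0 h.
have [K K0 hK] := second_order rhoP fE i; have [L L0 hL] := second_order rhoP fE j.
rewrite f0' in hK hL.
pose Si := @Defs.shift _ _ H i; pose Sj := @Defs.shift _ _ H j.
pose ci := @coshift _ _ H i; pose cj := @coshift _ _ H j.
have rSi : rho (Si \o Si) = a%:C%C.
  apply: (@second_order_uniq _ (fun l => f (axis i l) + f (axis i (- l)) - 2 * 1)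
    _ _ K 8 K0 _ hK) => //.
  exact: (@cayley_second_order a (fun l => f (axis i l)) a1 cayley_axis_i).
have rSj : rho (Sj \o Sj) = b%:C%C.
  apply: (@second_order_uniq _ (fun l => f (axis j l) + f (axis j (- l)) - 2 * 1)
    _ _ L 8 L0 _ hL) => //.
  exact: (@cayley_second_order b (fun l => f (axis j l)) b1 cayley_axis_j).
have ASi : toeplitz_algebra H Si by exact: toeplitz_shift.
have ASj : toeplitz_algebra H Sj by exact: toeplitz_shift.
have adi : adjoint dot Si ci by exact: coshift_adjoint.
have adj : adjoint dot Sj cj by exact: coshift_adjoint.
have Aci := alg_adjoint normE TC ASi adi; have Acj := alg_adjoint normE TC ASj adj.
have comm x : Si (Sj x) = Sj (Si x).
  by apply: evP => u; rewrite !shiftE; ring.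
have ccomm x : ci (cj x) = cj (ci x).
  by apply: (dot_inj normE) => y; rewrite -!adi -!adj -!adi comm.
pose p1 := rho ((Si \o Si) \o (ci \o ci)).
pose p2 := rho ((Sj \o Sj) \o (cj \o cj)).
pose p3 := rho ((Si \o Sj) \o (cj \o ci)).
pose p4 := rho ((Sj \o Si) \o (ci \o cj)).
have AA T1 T2 T3 T4 : toeplitz_algebra H T1 -> toeplitz_algebra H T2 ->
    toeplitz_algebra H T3 -> toeplitz_algebra H T4 -> toeplitz_algebra H ((T1 \o T2) \o (T3 \o T4)).
  by move=> h1 h2 h3 h4; apply: (alg_comp TC); exact: (alg_comp TC).
have adii := adjoint_comp (adjoint_sym adi) (adjoint_sym adi).
have adjj := adjoint_comp (adjoint_sym adj) (adjoint_sym adj).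
have adij := adjoint_comp (adjoint_sym adj) (adjoint_sym adi).
have adji := adjoint_comp (adjoint_sym adi) (adjoint_sym adj).
have p1E : 0 <= p1 by exact: (rho_sq normE TC rhoP (alg_comp TC Aci Aci) adii).
have p3E : 0 <= p3 by exact: (rho_sq normE TC rhoP (alg_comp TC Acj Aci) adij).
have p4E : 0 <= p4 by exact: (rho_sq normE TC rhoP (alg_comp TC Aci Acj) adji).
(* The row contraction inequality applied to x, S_i^* x and S_j^* x. *)
have sum1 : 0 <= 1 - (p1 + p2 + (p3 + p4)).
  pose Q1 := (Si \o Si) \o (ci \o ci); pose Q2 := (Sj \o Sj) \o (cj \o cj).
  pose Q3 := (Si \o Sj) \o (cj \o ci); pose Q4 := (Sj \o Si) \o (ci \o cj).
  have A1 : toeplitz_algebra H Q1 by exact: AA.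
  have A2 : toeplitz_algebra H Q2 by exact: AA.
  have A3 : toeplitz_algebra H Q3 by exact: AA.
  have A4 : toeplitz_algebra H Q4 by exact: AA.
  have A12 := alg_add TC A1 A2; have A34 := alg_add TC A3 A4.
  have A1234 := alg_add TC A12 A34.
  have := rho_ge0 normE TC rhoP (alg_sub TC (alg_id TC) A1234).
  rewrite (rho_sub rhoP (alg_id TC) A1234) (rho_add rhoP A12 A34) (rho_add rhoP A1 A2).
  rewrite (rho_add rhoP A3 A4) rid; apply => x.
  have D1 : dot (Q1 x) x = (nrm (ci (ci x)) ^+ 2)%:C%C.
    by rewrite -(dotxx normE) /Q1 /= adi adi.
  have D2 : dot (Q2 x) x = (nrm (cj (cj x)) ^+ 2)%:C%C.
    by rewrite -(dotxx normE) /Q2 /= adj adj.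
  have D3 : dot (Q3 x) x = (nrm (cj (ci x)) ^+ 2)%:C%C.
    by rewrite -(dotxx normE) /Q3 /= adi adj.
  have D4 : dot (Q4 x) x = (nrm (ci (cj x)) ^+ 2)%:C%C.
    by rewrite -(dotxx normE) /Q4 /= adj adi.
  have row y : nrm (ci y) ^+ 2 + nrm (cj y) ^+ 2 <= nrm y ^+ 2.
    apply: le_trans (row_contraction y); rewrite (bigD1 i) //= (bigD1 j) 1?eq_sym //= addrA lerDl.
    by apply: sumr_ge0 => k _; exact: sqr_ge0.
  have G (y1 y2 y3 y4 : H) : dot (x - (y1 + y2 + (y3 + y4))) x =
      dot x x - (dot y1 x + dot y2 x + (dot y3 x + dot y4 x)) by rewrite dotBl !dotDl.
  suff: 0 <= dot (x - (Q1 x + Q2 x + (Q3 x + Q4 x))) x by [].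
  move: (Q1 x) (Q2 x) (Q3 x) (Q4 x) D1 D2 D3 D4 => y1 y2 y3 y4 D1 D2 D3 D4.
  rewrite G D1 D2 D3 D4 (dotxx normE) -!rmorphD -rmorphB ler0c.
  have := row x; have := row (ci x); have := row (cj x); lra.
pose T1 x := ci (ci x) - a%:C%C *: x.
have AT1 : toeplitz_algebra H T1.
  exact: (alg_sub TC (alg_comp TC Aci Aci) (alg_scale TC _ (alg_id TC))).
(* As [rho] takes the value m at S^2 and at its adjoint, its value at (S^2 - m) (c^2 - m) is the
   value at S^2 c^2 minus m^2, which is therefore nonnegative. *)
have lower (S c : H -> H) (m : R) : toeplitz_algebra H S -> toeplitz_algebra H c ->
   adjoint dot S c -> rho (S \o S) = m%:C%C ->
   adjoint dot (fun x => c (c x) - m%:C%C *: x) (fun x => S (S x) - m%:C%C *: x) /\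
   rho ((fun x => S (S x) - m%:C%C *: x) \o (fun x => c (c x) - m%:C%C *: x)) =
     rho ((S \o S) \o (c \o c)) - (m ^+ 2)%:C%C.
  move=> AS Ac ad rS; have ad' := adjoint_sym ad.
  split; first by move=> x y; rewrite dotBl dotBr dotZl dotZr conjRC !ad'.
  have ASS := alg_comp TC AS AS; have Acc := alg_comp TC Ac Ac.
  have bS := alg_bounded TC AS.
  have A4 := alg_comp TC ASS Acc.
  have -> : (fun x => S (S x) - m%:C%C *: x) \o (fun x => c (c x) - m%:C%C *: x) =
     (fun x => (((S \o S) \o (c \o c)) x - m%:C%C *: (S \o S) x)
         - (m%:C%C *: (c \o c) x - (m ^+ 2)%:C%C *: x)).
    apply/funext => x /=; rewrite (bopB _ _ bS) (bopB _ _ bS) !(bopZ _ _ bS) rmorphXn /=.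
    by vector_ring normE.
  have rcc : rho (c \o c) = m%:C%C.
    by rewrite (rho_adjoint normE TC rhoP ASS (adjoint_comp ad ad)) rS conjRC.
  rewrite (rho_sub rhoP (alg_sub TC A4 (alg_scale TC _ ASS))
    (alg_sub TC (alg_scale TC _ Acc) (alg_scale TC _ (alg_id TC)))).
  rewrite (rho_sub rhoP A4 (alg_scale TC _ ASS)).
  rewrite (rho_sub rhoP (alg_scale TC _ Acc) (alg_scale TC _ (alg_id TC))).
  rewrite (rho_scale TC rhoP _ ASS) (rho_scale TC rhoP _ Acc).
  by rewrite (rho_scale TC rhoP _ (alg_id TC)) rS rcc rid rmorphXn /=; ring.
have [ad1 e1] := lower Si ci a ASi Aci adi rSi.
have [ad2 e2] := lower Sj cj b ASj Acj adj rSj.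
have q1 : 0 <= p1 - (a ^+ 2)%:C%C.
  by rewrite -e1; exact: (rho_sq normE TC rhoP AT1 ad1).
have q2 : 0 <= p2 - (b ^+ 2)%:C%C.
  rewrite -e2; apply: (rho_sq normE TC rhoP _ ad2).
  exact: (alg_sub TC (alg_comp TC Acj Acj) (alg_scale TC _ (alg_id TC))).
have [z1 z3] := squeeze q1 q2 p3E p4E sum1.
(* [T1] and cj ci are null for [rho], so [rho] kills cj^2 T1 and (cj ci)^2. As cj^2 T1 = (cj ci)^2 -
   a cj^2 and rho (cj^2) = b, it follows that a b = 0. *)
have nul1 : rho ((cj \o cj) \o T1) = 0.
  by apply: (rho_null normE TC rhoP (alg_comp TC Acj Acj) AT1 ad1); rewrite e1.
have nul3 : rho ((cj \o ci) \o (cj \o ci)) = 0.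
  by apply: (rho_null normE TC rhoP (alg_comp TC Acj Aci) (alg_comp TC Acj Aci) adij); exact: z3.
have Ajj := alg_comp TC Acj Acj.
have bj := alg_bounded TC Acj.
have E : (cj \o cj) \o T1 = (fun x => ((cj \o ci) \o (cj \o ci)) x - a%:C%C *: (cj \o cj) x).
  apply/funext => x; rewrite /T1 /= !(bopB _ _ bj) !(bopZ _ _ bj).
  by rewrite ccomm.
have rcj : rho (cj \o cj) = b%:C%C.
  by rewrite (rho_adjoint normE TC rhoP (alg_comp TC ASj ASj) (adjoint_comp adj adj)) rSj conjRC.
move: nul1; rewrite E (rho_sub rhoP (AA _ _ _ _ Acj Aci Acj Aci) (alg_scale TC _ Ajj)).
rewrite (rho_scale TC rhoP) // nul3 sub0r rcj -rmorphM -rmorphN => /complexI /eqP.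
by rewrite oppr_eq0 mulf_eq0 (negPf a0) (negPf b0).
Qed.

End NotRplus.

(** * A function of R+ outside M+ *)

Section NotMplus.
Context {R : realType} {d : nat}.
Local Notation C := R[i].
Local Notation B := (set_type (@unit_ball R d)).
Variables (i j : 'I_d).
Hypothesis ij : i != j.
Variable H : rkhs (@da_kernel R d).
Local Notation dot := (rkhs_dot H).
Local Notation normE := (rkhs_normE (r := H)).
Local Notation TC := (toeplitz_Cstar H).
Local Notation S k := (@Defs.shift _ _ H k).

Definition vector_state (x : H) (T : H -> H) : C := dot (T x) x.

Lemma vector_state_positive x : positive_functional dot (toeplitz_algebra H) (vector_state x).
Proof.
split=> [a T1 T2 _ _|T T' _ _ hT]; first by rewrite /vector_state dotDl dotZl.
by rewrite /vector_state /= (adjoint_sym hT) (dotxx normE) ler0c sqr_ge0.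
Qed.

Definition sphere_defect (x : H) : H := x - S i (S i x) - S j (S j x).

Lemma sphere_defect_in : toeplitz_algebra H sphere_defect.
Proof.
apply: (alg_sub TC); first apply: (alg_sub TC).
- exact: (alg_id TC).
- by apply: (alg_comp TC (S := S i) (T := S i)); exact: toeplitz_shift.
- by apply: (alg_comp TC (S := S j) (T := S j)); exact: toeplitz_shift.
Qed.

Lemma dot_sphere_defect x (u : B) : dot (sphere_defect x) (rkhs_ker H u) =
  (1 - (val u 0 i ^+ 2 + val u 0 j ^+ 2)) * dot x (rkhs_ker H u).
Proof. by rewrite -!evE /sphere_defect !evB !shiftE; ring. Qed.

(* States coming from measures are limits of averages of normalized kernel vectors [k_u],
   on which [sphere_defect] takes the value [1 - u_i^2 - u_j^2], of nonnegative real part. *)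
Lemma vector_state_Mplus x :
  Mplus R d (fun z => vector_state x (herglotz_op H z)) ->
  0 <= complex.Re (vector_state x sphere_defect).
Proof.
pose f (z : 'rV[C]_d) := vector_state x (herglotz_op H z).
move=> /(Mplus_rep H)[rho [t [rhoP fE mono]]].
have {}fE z : unit_ball z -> f z = rho (herglotz_op H z) + (0 +i* t)%C by exact: fE.
have sP := vector_state_positive x.
have fE0 z : unit_ball z -> f z = vector_state x (herglotz_op H z) + 0.
  by rewrite addr0.
have f0 : f 0 = rho id + (0 +i* t)%C by rewrite fE ?herglotz0 //; exact: unit_ball0.
have f0' : f 0 = vector_state x id + 0 by rewrite fE0 ?herglotz0 //; exact: unit_ball0.
have sq k : rho (S k \o S k) = vector_state x (S k \o S k).
  have [K K0 hK] := second_order rhoP fE k; have [L L0 hL] := second_order sP fE0 k.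
  rewrite -f0 in hK; rewrite -f0' in hL.
  exact: (@second_order_uniq _ (fun l => f (axis k l) + f (axis k (- l)) - 2 * f 0) _ _ K L K0 L0 hK hL).
have Ak k : toeplitz_algebra H (S k \o S k) by apply: (alg_comp TC); exact: toeplitz_shift.
have split_defect r : positive_functional dot (toeplitz_algebra H) r ->
    r sphere_defect = r id - r (S i \o S i) - r (S j \o S j).
  move=> rP; rewrite -(rho_sub rP (alg_id TC) (Ak i)).
  by rewrite -(rho_sub rP (alg_sub TC (alg_id TC) (Ak i)) (Ak j)).
have -> : complex.Re (vector_state x sphere_defect) = complex.Re (rho sphere_defect).
  (* The constant i t enters f(0), so only the real parts of the two values at the identity are
     known to agree; hence the statement about a real part. *)
  have e : complex.Re (rho id) = complex.Re (vector_state x id).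
    by have := congr1 (@complex.Re R) f0; rewrite f0' !ReD /= !addr0.
  rewrite (split_defect _ sP) (split_defect _ rhoP) (sq i) (sq j); move: e.
  by move: (rho id) (vector_state x _) => r s e; rewrite !(ReD, ReN) e.
apply: mono; first exact: (alg_bounded TC sphere_defect_in).
move=> u; rewrite dot_sphere_defect (dotxx normE) mulrC ReRM mulr_ge0 ?sqr_ge0 //.
have h := valB u; rewrite ReD ReN /= subr_ge0.
apply: le_trans (Re_le_nrm _) _; apply: le_trans (nrmD _ _) _; rewrite !nrmX.
apply: le_trans (bnorm2_ge_pair ij (val u)) _.
by rewrite expr_le1 ?bnorm_ge0 // ltW //; apply/unit_ballP.
Qed.

Definition pt (p : R * R) : 'rV[C]_d := plane i j p.1%:C%C p.2%:C%C.

Lemma pt_ball p : p.1 ^+ 2 + p.2 ^+ 2 < 1 -> unit_ball (pt p).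
Proof.
move=> h; apply: (plane_ball ij); rewrite !nrmR.
by rewrite !real_normK ?num_real.
Qed.

(** Pairing of the defect of the kernel vector at p with the kernel vector at q. The numerator sees
    only q, so the matrix is not symmetric. *)
Definition defect_kernel (p q : R * R) : R :=
  (1 - (q.1 ^+ 2 + q.2 ^+ 2)) / (1 - (p.1 * q.1 + p.2 * q.2)).

Definition comb (l : seq (R * (R * R))) : H :=
  \sum_(p <- l) (p.1)%:C%C *: kerz H (pt p.2).

Lemma comb_defect l : (forall p, p \in l -> p.2.1 ^+ 2 + p.2.2 ^+ 2 < 1) ->
  vector_state (comb l) sphere_defect =
  (\sum_(p <- l) \sum_(q <- l) p.1 * q.1 * defect_kernel p.2 q.2)%:C%C.
Proof.
move=> hl; have bT := alg_bounded TC sphere_defect_in.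
rewrite /vector_state {1}/comb (bop_sum _ _ _ bT) dot_suml rmorph_sum.
apply: eq_big_seq => p pl; rewrite /comb dot_sumr rmorph_sum; apply: eq_big_seq => q ql.
have hp := pt_ball (hl p pl); have hq := pt_ball (hl q ql).
rewrite (bopZ _ _ bT) dotZl dotZr conjRC (kerzE H hq) dot_sphere_defect -(kerzE H hq) dot_kerz //=.
have -> : herm (pt q.2) (pt p.2) = (p.2.1 * q.2.1 + p.2.2 * q.2.2)%:C%C.
  rewrite (herm_plane ij) /pt plane_i (plane_j ij) !conjRC rmorphD !rmorphM /=; ring.
rewrite /pt plane_i (plane_j ij) /defect_kernel.
rewrite !(rmorphM, fmorphV, rmorphB, rmorphD, rmorph1, rmorphXn) /=; ring.
Qed.

End NotMplus.

(** The six outer points are opposite pairs of norm 9/10 on the lines of slope 0, 4/3 and -4/3: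
    nearly a regular hexagon, with rational coordinates. Equal weights imitate an average over
    rotations, which keeps only powers of z_i^2 + z_j^2. With weight - t at the origin the sum is
    about t^2 - 7.14 t + 12.21, and t = 7/2 is close to the minimizer, with a negative value. *)
Lemma Rplus_not_Mplus (R : realType) (d : nat) (i j : 'I_d) : i != j -> ~ Rplus R d `<=` Mplus R d.
Proof.
move=> ij; pose H := @drury_arveson R d.
pose p0 : R * R := (0, 0).
pose u1 : R * R := (9 / 10, 0); pose v1 : R * R := (- (9 / 10), 0).
pose u2 : R * R := (27 / 50, 18 / 25); pose v2 : R * R := (- (27 / 50), - (18 / 25)).
pose u3 : R * R := (27 / 50, - (18 / 25)); pose v3 : R * R := (- (27 / 50), 18 / 25).
pose l : seq (R * (R * R)) := [:: (- (7 / 2), p0); (1, u1); (1, v1); (1, u2); (1, v2); (1, u3); (1, v3)].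
have hl p : p \in l -> p.2.1 ^+ 2 + p.2.2 ^+ 2 < 1.
  by rewrite !inE => /orP[/eqP->|/or4P[/eqP->|/eqP->|/eqP->|/or3P[]/eqP->]] /=; lra.
move=> /(_ (fun z => vector_state (comb i j H l) (herglotz_op H z))) h.
have /(vector_state_Mplus ij) : Mplus R d (fun z => vector_state (comb i j H l) (herglotz_op H z)).
  apply: h; exists H, (vector_state (comb i j H l)), 0; split; first exact: vector_state_positive.
  by move=> z _; rewrite addr0.
rewrite (comb_defect ij) // [complex.Re _]/=.
(* Sum over one block of two opposite pairs: only these totals, not the single entries, enter the
   final linear arithmetic. *)
pose N (p q p' q' : R * R) := defect_kernel p q + defect_kernel p q' + defect_kernel p' q + defect_kernel p' q'.
have k00 : defect_kernel p0 p0 = 1 by rewrite /defect_kernel /=; field.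
have kp0 p : defect_kernel p p0 = 1.
  by rewrite /defect_kernel /= !mulr0 expr0n /= !addr0 !subr0 divr1.
have k01 : defect_kernel p0 u1 = 19 / 100 by rewrite /defect_kernel /=; field.
have k02 : defect_kernel p0 v1 = 19 / 100 by rewrite /defect_kernel /=; field.
have k03 : defect_kernel p0 u2 = 19 / 100 by rewrite /defect_kernel /=; field.
have k04 : defect_kernel p0 v2 = 19 / 100 by rewrite /defect_kernel /=; field.
have k05 : defect_kernel p0 u3 = 19 / 100 by rewrite /defect_kernel /=; field.
have k06 : defect_kernel p0 v3 = 19 / 100 by rewrite /defect_kernel /=; field.
have N11 : N u1 u1 v1 v1 = 7600 / 3439 by rewrite /N /defect_kernel /=; field.
have N22 : N u2 u2 v2 v2 = 7600 / 3439 by rewrite /N /defect_kernel /=; field.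
have N33 : N u3 u3 v3 v3 = 7600 / 3439 by rewrite /N /defect_kernel /=; field.
have N12 : N u1 u2 v1 v2 = 2 * (95 / 257) + 2 * (95 / 743) by rewrite /N /defect_kernel /=; field.
have N21 : N u2 u1 v2 v1 = 2 * (95 / 257) + 2 * (95 / 743) by rewrite /N /defect_kernel /=; field.
have N13 : N u1 u3 v1 v3 = 2 * (95 / 257) + 2 * (95 / 743) by rewrite /N /defect_kernel /=; field.
have N31 : N u3 u1 v3 v1 = 2 * (95 / 257) + 2 * (95 / 743) by rewrite /N /defect_kernel /=; field.
have N23 : N u2 u3 v2 v3 = 2 * (475 / 3067) + 2 * (475 / 1933) by rewrite /N /defect_kernel /=; field.
have N32 : N u3 u2 v3 v2 = 2 * (475 / 3067) + 2 * (475 / 1933) by rewrite /N /defect_kernel /=; field.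
rewrite !big_cons !big_nil /= !kp0 k01 k02 k03 k04 k05 k06 !mul1r !mulr1.
move: N11 N12 N13 N21 N22 N23 N31 N32 N33; rewrite /N; lra.
Qed.

Theorem theorem3p6 (R : realType) (d : nat) (hd : (2 <= d)%N) :
  [/\ Mplus R d `<` Rplus R d,
      Rplus R d `<` Splus R d
    & Splus R d `<` Oplus R d].
Proof.
pose i : 'I_d := Ordinal (ltnW hd); pose j : 'I_d := Ordinal hd.
have ij : i != j by [].
split; split.
- exact: Mplus_sub_Rplus.
- exact: (Rplus_not_Mplus ij).
- exact: Rplus_sub_Splus.
(* A rational point of the unit circle with both coordinates nonzero, as [cayley_not_Rplus]
   requires. *)
- have ab : (3 / 5 : R) ^+ 2 + (4 / 5) ^+ 2 = 1 by field.
  move=> h; apply: (cayley_not_Rplus ij ab); last exact/h/cayley_Splus.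
    by lra.
  by lra.
- exact: Splus_sub_Oplus.
- have n1 : nrm (1 : R[i]) <= 1 by rewrite nrm1.
  by move=> h; apply: (cayley11_not_Splus ij); exact/h/(cayley_Oplus ij n1 n1).
Qed.
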